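(* The space $\mathcal Y(C)$ is Fréchet and its dual can be identified with $$\mathcal U(M):=\{u\in L^1(M)\mid\|u\|\in\mathcal U\}$$ through the bilinear form $$\langle y,u\rangle:=E\int y\,du$$ (that is, $u\mapsto\langle\cdot,u\rangle$ is a well-defined linear bijection of $\mathcal U(M)$ onto the topological dual of $\mathcal Y(C)$). For every $p\in\mathcal P$, every $y\in L^1(C)$ and every $u\in L^1(M)$, $$E\int y\,du\le p(\|y\|)\,p^\circ(\|u\|)$$ and $$p^\circ(\|u\|)=\sup_{y\in L^\infty(C)}\left\{E\int y\,du\ \middle|\ p(\|y\|)\le1\right\}.$$ In particular, $u\mapsto p^\circ(\|u\|)$ is the polar of $y\mapsto p(\|y\|)$.
   Context: Spaces of random variables. $(\Omega,\mathcal F,P)$ is a complete probability space, $L^1=L^1(\Omega,\mathcal F,P)$ and $L^\infty=L^\infty(\Omega,\mathcal F,P)$. $\mathcal P$ is a countable collection, forming a nondecreasing sequence, of symmetric ($p(-\xi)=p(\xi)$) sublinear functions $p:L^1\to[0,\infty]$, each satisfying: (1) $p$ is lower semicontinuous on $L^1$; (2) there is a constant $c$ with $\frac1c\|\xi\|_{L^1}\le p(\xi)\le c\|\xi\|_{L^\infty}$ for all $\xi\in L^1$; (3) $p(\xi_1)\le p(\xi_2)$ whenever $|\xi_1|\le|\xi_2|$; (4) $p(\xi^\nu)\searrow 0$ whenever $(\xi^\nu)_{\nu=1}^\infty\subset L^\infty$ decreases to $0$ almost surely. Let $\operatorname{dom}p=\{p<\infty\}$ and $\tilde{\mathcal Y}=\bigcap_{p\in\mathcal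 P}\operatorname{dom}p$ with the locally convex topology generated by $\mathcal P$; $\mathcal Y$ is the closure of $L^\infty$ in $\tilde{\mathcal Y}$. For $p\in\mathcal P$ and $\eta\in L^1$, $p^\circ(\eta)=\sup_{\xi\in L^\infty}\{E(\xi\eta)\mid p(\xi)\le1\}\in[0,\infty]$, and $\mathcal U=\bigcup_{p\in\mathcal P}\operatorname{dom}p^\circ$. Path spaces. $T\in(0,\infty]$ is fixed; if $T=\infty$, $[0,T]$ is the one-point compactification of $\mathbb R_+$. $C$ is the Banach space of continuous functions $y$ on $[0,T]$ with the supremum norm $\|y\|$. $M$ is the space of (finite signed) Borel measures on $[0,T]$ with total variation norm $\|u\|$. $L^1(C)$ is the space of (measurable, not necessarily adapted) continuous processes $y$ with $E\|y\|<\infty$, $L^\infty(C)$ those with $\|y\|\in L^\infty$, and $L^1(M)$ the space of random measures $u$ with values in $M$ and $E\|u\|<\infty$. Processes that coincide almost surely everywhere on $[0,T]$ are identified. $\mathcal Y(C)=\{y\in L^1(C)\mid\|y\|\in\mathcal Y\}$, with the topology induced by the seminorms $y\mapsto p(\|y\|)$, $p\in\mathcal P$. Convention: the displayed inequality is in the extended reals with $0\cdot\infty=0$, and is void when its right-hand side is $+\infty$. *)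

(* Defs.v *)
From HB Require Import structures.
From mathcomp Require Import all_boot all_order all_algebra.
From mathcomp Require Import all_classical all_reals all_analysis.
From mathcomp Require Import measurable_realfun ess_sup_inf.

Set Implicit Arguments.
Unset Strict Implicit.
Unset Printing Implicit Defensive.

Import Order.TTheory GRing.Theory Num.Def Num.Theory.
Import numFieldNormedType.Exports.

Local Open Scope classical_set_scope.
Local Open Scope ring_scope.

(* The interval [0, T] of the extended line, 0 < T <= +oo, with the subspace
   topology: for T = +oo this is the one-point compactification of R_+. The
   measurable structure is the Borel sigma-algebra. *)
Definition time (R : realType) (T : \bar R) (T0 : (0 < T)%E) : Type :=
  set_type [set t : \bar R | (0 <= t <= T)%E].

Section time_structure.
Context (R : realType) (T : \bar R) (T0 : (0 < T)%E).

HB.instance Definition _ := Topological.copy (time T0)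
  (set_type [set t : \bar R | (0 <= t <= T)%E]).

Let time0 : time T0.
Proof. by exists 0%E; rewrite inE /= lexx ltW. Defined.

HB.instance Definition _ := isPointed.Build (time T0) time0.

HB.instance Definition _ := Measurable.copy (time T0)
  (g_sigma_algebraType (@open (time T0))).

End time_structure.

Section time_theory.
Context (R : realType) (T : \bar R) (T0 : (0 < T)%E).

Let cT : R := contract T.

Let cT_gt0 : 0 < cT.
Proof. by rewrite /cT -contract0 lt_contract. Qed.

Let clamp (r : R) : R := Num.max 0 (Num.min r cT).

Let clamp_itv r : 0 <= clamp r <= cT.
Proof. by rewrite /clamp le_max lexx/= ge_max (ltW cT_gt0) ge_min lexx orbT. Qed.

Let clamp_le1 r : `|clamp r| <= 1.
Proof.
have /andP[h0 h1] := clamp_itv r; rewrite ger0_norm// (le_trans h1)//.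
by rewrite (le_trans (ler_norm _))// contract_le1.
Qed.

Let expand_clamp r : [set t : \bar R | (0 <= t <= T)%E] (expand (clamp r)).
Proof.
have /andP[h0 h1] := clamp_itv r; rewrite /= -[X in (X <= _)%E]expand0.
by rewrite le_expand//= -[leRHS]contractK le_expand.
Qed.

(* A continuous map of R onto [0, T]. *)
Definition time_param (r : R) : time T0 := SigSub (mem_set (expand_clamp r)).

Lemma time_param_surj t : exists2 r, r \in `[0, cT] & time_param r = t.
Proof.
case: t => t tT; exists (contract t).
  move: (tT); rewrite inE /= => /andP[t0 t1].
  by rewrite in_itv/= -[X in X <= _]contract0 !le_contract t0 t1.
apply/val_inj => /=.
move: tT; rewrite inE /= => /andP[t0 t1].
have -> : clamp (contract t) = contract t.
  rewrite /clamp min_l ?le_contract// max_r//.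
  by rewrite -[X in X <= _]contract0 le_contract.
by rewrite contractK.
Qed.

Lemma time_param_continuous : continuous time_param.
Proof.
apply: continuous_comp_initial => r.
apply/cvg_ballP => e e0.
have cc : continuous clamp.
  move=> x; apply: (@continuous_max R R (cst 0) (fun r => Num.min r cT)).
    exact: cst_continuous.
  apply: (@continuous_min R R id (cst cT)); first exact: cvg_id.
  exact: cst_continuous.
near=> s; rewrite /ball/= /ereal_ball /time_param/=.
rewrite !expandK ?inE//.
by near: s; move/cvgrPdist_lt : (cc r); exact.
Unshelve. all: by end_near. Qed.

End time_theory.

Section path_norm.
Context (R : realType) (T : \bar R) (T0 : (0 < T)%E).
Implicit Types y z : time T0 -> R.

Definition path_norm y : R := sup (range (fun t => `|y t|)).

Lemma path_bounded y : continuous y -> has_ubound (range (fun t => `|y t|)).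
Proof.
move=> cy.
pose f r := `|y (time_param T0 r)|.
have cf : continuous f.
  move=> r; apply: (@continuous_comp R R R (y \o time_param T0) Num.norm).
    by apply: continuous_comp; [exact: time_param_continuous|exact: cy].
  exact: norm_continuous.
have cT0 : 0 <= contract T.
  by rewrite -[X in X <= _]contract0 le_contract ltW.
have [c _ hc] := EVT_max cT0 (continuous_subspaceT cf).
exists (f c) => _ [t _ <-].
by have [r rT <-] := time_param_surj t; exact: hc.
Qed.

Lemma path_norm_ub y t : continuous y -> `|y t| <= path_norm y.
Proof. by move=> cy; apply: ub_le_sup; [exact: path_bounded|exists t]. Qed.

Lemma path_norm_le y (M : R) : (forall t, `|y t| <= M) -> path_norm y <= M.
Proof.
move=> yM; apply: ge_sup; first by exists `|y point|; exists point.
by move=> _ [t _ <-].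
Qed.

Lemma path_norm_ge0 y : continuous y -> 0 <= path_norm y.
Proof. by move=> cy; exact: le_trans (path_norm_ub point cy). Qed.

Lemma path_norm0 : path_norm (0 : time T0 -> R) = 0.
Proof.
apply/eqP; rewrite eq_le; apply/andP; split.
  by apply: path_norm_le => t; rewrite normr0.
by apply: path_norm_ge0; exact: cst_continuous.
Qed.

Lemma path_normD y z : continuous y -> continuous z ->
  path_norm (y + z) <= path_norm y + path_norm z.
Proof.
move=> cy cz; apply: path_norm_le => t.
by rewrite (le_trans (ler_normD _ _))// lerD// path_norm_ub.
Qed.

Lemma path_normZ (a : R) y : continuous y ->
  path_norm (a *: y) = `|a| * path_norm y.
Proof.
have le b z : continuous z -> path_norm (b *: z) <= `|b| * path_norm z.
  move=> cz; apply: path_norm_le => t.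
  by rewrite normrZ ler_wpM2l// path_norm_ub.
move=> cy; apply/eqP; rewrite eq_le le//=.
have [->|a0] := eqVneq a 0.
  by rewrite normr0 mul0r scale0r path_norm0.
have caz : continuous (a *: y).
  by move=> t; apply: (@continuousZr R _ _ y a t); exact: cy.
rewrite -ler_pdivlMl ?normr_gt0// -normfV.
by rewrite -{1}(scalerK a0 y) le.
Qed.

Lemma path_norm_countable y : continuous y ->
  path_norm y = sups (fun n => `|y (time_param T0 (ratr (odflt 0%Q (unpickle n))))|) 0%N.
Proof.
move=> cy; set s := (RHS).
have ubs : has_ubound (sdrop
    (fun n => `|y (time_param T0 (ratr (odflt 0%Q (unpickle n))))|) 0%N).
  by exists (path_norm y) => _ [n _ <-]; exact: path_norm_ub.
apply/eqP; rewrite eq_le; apply/andP; split; last first.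
  apply: ge_sup; last by move=> _ [n _ <-]; exact: path_norm_ub.
  by exists `|y (time_param T0 (ratr (odflt 0%Q (unpickle 0%N))))|; exists 0%N.
apply: path_norm_le => t; rewrite leNgt; apply/negP => st.
have [r _ rt] := time_param_surj t.
pose f r := `|y (time_param T0 r)|.
have cf : continuous f.
  move=> x; apply: (@continuous_comp R R R (y \o time_param T0) Num.norm).
    by apply: continuous_comp; [exact: time_param_continuous|exact: cy].
  exact: norm_continuous.
have oA : open (f @^-1` [set x | s < x]).
  by apply: open_comp; [move=> x _; exact: cf|exact: open_gt].
have A0 : (f @^-1` [set x | s < x]) !=set0 by exists r; rewrite /f/= rt.
have [q [/= sq [k _ kq]]] := dense_rat A0 oA.
move: sq; rewrite ltNge => /negP; apply.
apply: ub_le_sup => //; exists (pickle k) => //=.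
by rewrite pickleK/= /f kq.
Qed.

End path_norm.

Section seminormed.
Local Open Scope convex_scope.
Context (R : realType) (V : lmodType R).

Definition seminorm (q : V -> R) : Prop :=
  (forall x y, q (x + y) <= q x + q y) /\
  (forall a x, q (a *: x) = `|a| * q x).

(* V with the topology generated by the seminorms (q n), n : nat; the sets
   seminorm_ball x n e form a neighbourhood basis at x. *)
Definition seminormed (q : nat -> V -> R) (qP : forall n, seminorm (q n)) : Type :=
  V.

Context (q : nat -> V -> R) (qP : forall n, seminorm (q n)).
Local Notation E := (seminormed qP).

Definition seminorm_ball (x : V) (n : nat) (e : R) : set V :=
  [set y | forall i, (i <= n)%N -> q i (y - x) < e].

Let q0 i : q i 0 = 0.
Proof. by rewrite -(scale0r (0 : V)) (qP i).2 normr0 mul0r. Qed.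

Let qN i x : q i (- x) = q i x.
Proof. by rewrite -scaleN1r (qP i).2 normrN normr1 mul1r. Qed.

Let q_ge0 i x : 0 <= q i x.
Proof.
by have := (qP i).1 x (- x); rewrite subrr q0 qN -mulr2n pmulrn_lge0.
Qed.

Let qB i x y z : q i (x - z) <= q i (x - y) + q i (y - z).
Proof.
have -> : x - z = (x - y) + (y - z) by rewrite addrA subrK.
exact: (qP i).1.
Qed.

HB.instance Definition _ := GRing.Lmodule.on E.
HB.instance Definition _ := Choice.on E.

Definition seminorm_nbhs (x : E) : set_system E :=
  filter_from [set ne : nat * R | 0 < ne.2]
    (fun ne => seminorm_ball x ne.1 ne.2).

HB.instance Definition _ := hasNbhs.Build E seminorm_nbhs.

Let ball_center x n e : 0 < e -> seminorm_ball x n e x.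
Proof. by move=> e0 i _; rewrite subrr q0. Qed.

Let nbhs_pfilter (x : E) : ProperFilter (nbhs x).
Proof.
apply: filter_from_proper; last first.
  by move=> [n e]/= e0; exists x; exact: ball_center.
apply: filter_from_filter; first by exists (0%N, 1) => /=.
move=> [n e] [m f] /= e0 f0.
exists (maxn n m, Num.min e f); first by rewrite /= lt_min e0 f0.
move=> y /= yx; split=> i hi.
  have /yx : (i <= maxn n m)%N by rewrite leq_max hi.
  by rewrite lt_min => /andP[].
have /yx : (i <= maxn n m)%N by rewrite leq_max hi orbT.
by rewrite lt_min => /andP[].
Qed.

Let nbhs_single (x : E) (A : set E) : nbhs x A -> A x.
Proof. by move=> [[n e]/= e0]; apply; exact: ball_center. Qed.

Let nbhs_ball (x : V) n e : 0 < e -> nbhs (x : E) (seminorm_ball x n e : set E).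
Proof. by move=> e0; exists (n, e). Qed.

Let ball_half (x y z : V) n e :
  seminorm_ball x n (e / 2) y -> seminorm_ball y n (e / 2) z ->
  seminorm_ball x n e z.
Proof.
move=> xy yz i hi; rewrite (le_lt_trans (qB i _ y _))//.
by rewrite (splitr e) ltrD ?xy ?yz.
Qed.

Let nbhs_nbhs (x : E) (A : set E) : nbhs x A -> nbhs x (nbhs^~ A).
Proof.
move=> [[n e]/= e0 sA]; exists (n, e / 2); first by rewrite /= divr_gt0.
move=> y xy; exists (n, e / 2); first by rewrite /= divr_gt0.
by move=> z yz; apply: sA; exact: ball_half xy yz.
Qed.

HB.instance Definition _ :=
  Nbhs_isNbhsTopological.Build E nbhs_pfilter nbhs_single nbhs_nbhs.

Let add_cont : continuous (fun x : E * E => x.1 + x.2).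
Proof.
move=> [x y]/= A [[n e]/= e0 sA].
exists (seminorm_ball x n (e / 2), seminorm_ball y n (e / 2)) => /=.
  by split; apply: nbhs_ball; rewrite divr_gt0.
move=> [u v]/= [ux vy]; apply: sA => i hi /=.
rewrite (_ : u + v - (x + y) = (u - x) + (v - y)); last first.
  by rewrite opprD addrACA.
by rewrite (le_lt_trans ((qP i).1 _ _))// (splitr e) ltrD ?ux ?vy.
Qed.

Let scale_cont : continuous (fun z : R^o * E => z.1 *: z.2).
Proof.
move=> [a x]/= A [[n e]/= e0 sA].
pose M := \sum_(i < n.+1) q i x.
have qM i : (i <= n)%N -> q i x <= M.
  move=> hi; rewrite /M (bigD1 (Ordinal (hi : (i < n.+1)%N)))//= lerDl.
  by rewrite sumr_ge0.
have M0 : 0 <= M by rewrite sumr_ge0.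
pose d := Num.min 1 (e / 2 / (M + 1)).
pose f := e / 2 / (`|a| + 1).
have M1 : 0 < M + 1 by rewrite ltr_wpDl.
have a1 : 0 < `|a| + 1 by rewrite ltr_wpDl.
have d0 : 0 < d by rewrite lt_min ltr01 !divr_gt0.
have f0 : 0 < f by rewrite !divr_gt0.
exists (ball (a : R^o) d, seminorm_ball x n f) => /=.
  by split; [exact: (@nbhsx_ballx _ R^o)|exact: nbhs_ball].
move=> [b y]/= [ab xy]; apply: sA => i hi /=.
move: ab; rewrite /ball/= /d lt_min => /andP[ab1 abM].
rewrite (_ : b *: y - a *: x = b *: (y - x) + (b - a) *: x); last first.
  by rewrite scalerBr scalerBl addrA subrK.
rewrite (le_lt_trans ((qP i).1 _ _))// !(qP i).2 (splitr e) ltrD//.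
  have b1 : `|b| < `|a| + 1.
    rewrite -[b](subrK a) addrC (le_lt_trans (ler_normD _ _))//.
    by rewrite ltrD2l distrC.
  have [b0|b0] := eqVneq `|b| 0; first by rewrite b0 mul0r divr_gt0.
  apply: (@lt_trans _ _ (`|b| * f)).
    by rewrite ltr_pM2l ?xy// lt_neqAle eq_sym b0/=.
  by rewrite /f mulrCA gtr_pMr ?divr_gt0// ltr_pdivrMr// mul1r.
apply: (@le_lt_trans _ _ (`|b - a| * M)); first by rewrite ler_wpM2l ?qM.
apply: (@le_lt_trans _ _ (`|b - a| * (M + 1))).
  by rewrite ler_wpM2l// lerDl.
by rewrite -ltr_pdivlMr// distrC.
Qed.

Let ball_open (x : V) n e : open (seminorm_ball x n e : set E).
Proof.
rewrite openE => y xy.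
pose f := \big[Num.min/1]_(i < n.+1) (e - q i (y - x)).
have f0 : 0 < f.
  rewrite /f; elim/big_ind : _ => //; first by move=> ? ? ? ?; rewrite lt_min; apply/andP.
  by move=> i _; rewrite subr_gt0 xy// -ltnS.
exists (n, f) => // z yz i hi.
have := yz i hi.
have : f <= e - q i (y - x) by exact: (bigmin_le _ (Ordinal (hi : (i < n.+1)%N))).
rewrite lerBrDr => h1 h2.
by rewrite (le_lt_trans (qB i _ y _))// (lt_le_trans _ h1)// ltrD2r.
Qed.

Let loc_convex : exists2 B : set_system E,
  (forall b, b \in B -> convex_set b) & basis B.
Proof.
exists [set B | exists x n e, B = seminorm_ball x n e].
  move=> _ /[!inE] -[x [n [e ->]]].
  apply/convex_setW => y z; rewrite !inE => xy xz l l0 l1.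
  rewrite inE => i hi /=.
  have l1' : 0 < 1 - l%:num by rewrite subr_gt0.
  have <- : l%:num *: (y - x) + (1 - l%:num) *: (z - x) =
      (y : convex_lmodType V) <| l |> (z : convex_lmodType V) - x.
    rewrite !scalerBr addrACA -opprD -scalerDl.
    by rewrite (_ : l%:num + (1 - l%:num) = 1) ?scale1r// addrC subrK.
  rewrite (le_lt_trans ((qP i).1 _ _))// !(qP i).2.
  rewrite (ger0_norm (ltW l0)) (ger0_norm (ltW l1')).
  have -> : e = l%:num * e + (1 - l%:num) * e.
    by rewrite -mulrDl addrC subrK mul1r.
  by rewrite ltrD// ltr_pM2l// ?xy ?xz.
split; first by move=> _ [x [n [e ->]]]; exact: ball_open.
move=> x A [[n e]/= e0 sA]; exists (seminorm_ball x n e) => //=.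
by split; [exists x, n, e|exact: ball_center].
Qed.

HB.instance Definition _ := PreTopologicalLmod_isTvs.Build R E
  add_cont scale_cont loc_convex.
HB.instance Definition _ :=
  PreTopologicalNmodule_isTopologicalNmodule.Build E add_cont.
HB.instance Definition _ :=
  TopologicalNmodule_isTopologicalLmodule.Build R E scale_cont.
HB.instance Definition _ := Uniform_isTvs.Build R E loc_convex.

End seminormed.

Definition metrizable (R : realType) (X : topologicalType) : Prop :=
  exists dist : X -> X -> R,
    [/\ forall x y, dist x y = 0 <-> x = y,
        forall x y, dist x y = dist y x,
        forall x y z, dist x z <= dist x y + dist y z &
        forall x, nbhs x = filter_from [set e : R | 0 < e]
                             (fun e => [set y | dist x y < e])].

(* Local convexity is part of tvsType, and Cauchy filters are those of the
   uniformity of the topological vector space. *)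
Definition frechet (R : realType) (E : tvsType R) : Prop :=
  metrizable R E /\
  forall F : set_system E, ProperFilter F -> cauchy F -> exists x : E, F --> x.

Section quotient_lmodule.
Context (R : pzRingType) (V : lmodType R) (N : zmodClosed V) (NZ : scaler_closed N).
Local Open Scope quotient_scope.

Definition quot_lmod of scaler_closed N : Type := Quotient.quot N.
Local Notation Q := (quot_lmod NZ).

HB.instance Definition _ := EqQuotient.on Q.
HB.instance Definition _ := GRing.Zmodule.on Q.

Let scaleq (a : R) : Q -> Q := lift_op1 Q ( *:%R a).

Let pi_scale a : {morph \pi_Q : x / a *: x >-> scaleq a x}.
Proof.
move=> x; rewrite /scaleq; unlock; apply/eqP.
rewrite -Quotient.idealrBE -scalerBr NZ//.
by rewrite Quotient.idealrBE reprK.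
Qed.

Let scalerA_quot a b v : scaleq a (scaleq b v) = scaleq (a * b) v.
Proof. by rewrite -[v]reprK -!pi_scale scalerA. Qed.

Let scale1_quot : left_id 1 scaleq.
Proof. by move=> v; rewrite -[v]reprK -pi_scale scale1r. Qed.

Let scalerD_quot : right_distributive scaleq +%R.
Proof.
move=> a u v; rewrite -[u]reprK -[v]reprK.
by rewrite -[X in scaleq a X]raddfD -!pi_scale scalerDr raddfD.
Qed.

Let scalerDl_quot v : {morph scaleq^~ v : a b / a + b}.
Proof.
by move=> a b; rewrite -[v]reprK -!pi_scale scalerDl raddfD.
Qed.

HB.instance Definition _ := GRing.Zmodule_isLmodule.Build R Q
  scalerA_quot scale1_quot scalerD_quot scalerDl_quot.

Lemma pi_quot_scale a (x : V) : \pi_Q (a *: x) = a *: \pi_Q x.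
Proof. exact: pi_scale. Qed.

Lemma pi_quot_add (x y : V) :
  \pi_Q (x + y) = \pi_Q x + \pi_Q y.
Proof. exact: raddfD. Qed.

Lemma pi_quot_eq (x y : V) :
  \pi_Q x = \pi_Q y <-> x - y \in N.
Proof. by rewrite Quotient.idealrBE; split=> [->|/eqP]. Qed.

End quotient_lmodule.

Section random_variables.
Context d (Omega : measurableType d) (R : realType) (P : probability Omega R).
Implicit Types (xi eta : Omega -> R) (p : (Omega -> R) -> \bar R).

(* A function p on L^1 is represented by a function on all of Omega -> R of
   which only the values at integrable functions matter; by admissible_mono it
   is invariant under almost sure equality there. *)
Record admissible p : Prop := Admissible {
  admissible_ge0 : {in Lfun P 1, forall xi, (0 <= p xi)%E} ;
  admissible_sym : {in Lfun P 1, forall xi, p (- xi) = p xi} ;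
  admissible_subadd : {in Lfun P 1 &, forall xi eta,
    (p (xi + eta)%R <= p xi + p eta)%E} ;
  admissible_homo : forall a : R, 0 < a ->
    {in Lfun P 1, forall xi, p (a *: xi) = (a%:E * p xi)%E} ;
  admissible_lsc : {in Lfun P 1, forall xi (a : R), (a%:E < p xi)%E ->
    exists2 e : R, 0 < e & {in Lfun P 1, forall eta,
      ('N[P]_1[EFin \o (eta - xi)%R] < e%:E)%E -> (a%:E < p eta)%E}} ;
  admissible_bounds : exists2 c : R, 0 < c & {in Lfun P 1, forall xi,
    (c^-1%:E * 'N[P]_1[EFin \o xi] <= p xi)%E /\
    (p xi <= c%:E * 'N[P]_+oo[EFin \o xi])%E} ;
  admissible_mono : {in Lfun P 1 &, forall xi eta,
    {ae P, forall w, `|xi w| <= `|eta w|} -> (p xi <= p eta)%E} ;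
  admissible_cvg0 : forall xi : nat -> Omega -> R,
    (forall n, xi n \in Lfun P +oo%E) ->
    {ae P, forall w, nonincreasing_seq (xi ^~ w) /\
                     xi n w @[n --> \oo] --> 0} ->
    p (xi n) @[n --> \oo] --> 0%E
}.

Record seminorm_seq := SeminormSeq {
  sseq :> nat -> (Omega -> R) -> \bar R ;
  sseq_admissible : forall n, admissible (sseq n) ;
  sseq_nondecreasing : forall n,
    {in Lfun P 1, forall xi, (sseq n xi <= sseq n.+1 xi)%E}
}.

Definition dom_seq (pp : seminorm_seq) : set (Omega -> R) :=
  [set xi | xi \in Lfun P 1 /\ forall n, (pp n xi < +oo)%E].

(* The closure of L^oo in dom_seq pp; the sets
   [set eta | forall i, (i <= n)%N -> pp i (xi - eta) < e] form a neighbourhood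
   basis at xi for the topology generated by pp. *)
Definition Yspace (pp : seminorm_seq) : set (Omega -> R) :=
  [set xi | dom_seq pp xi /\ forall n (e : R), 0 < e ->
    exists2 eta, eta \in Lfun P +oo%E &
      forall i, (i <= n)%N -> (pp i (xi - eta)%R < e%:E)%E].

Definition polar p eta : \bar R :=
  ereal_sup [set ('E_P[xi \* eta])%E | xi in
    [set xi | xi \in Lfun P +oo%E /\ (p xi <= 1)%E]].

Definition Uspace (pp : seminorm_seq) : set (Omega -> R) :=
  [set eta | eta \in Lfun P 1 /\ exists n, (polar (pp n) eta < +oo)%E].

Lemma Loo_sub_L1 xi : xi \in Lfun P +oo%E -> xi \in Lfun P 1.
Proof.
by apply: Lfun_subset => //; [rewrite leey|exact: fin_num_measure|rewrite leey].
Qed.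

Lemma Lfun_dominated (r : \bar R) xi eta : (1 <= r)%E ->
  measurable_fun setT xi -> eta \in Lfun P r ->
  (forall w, `|xi w| <= `|eta w|) -> xi \in Lfun P r.
Proof.
move=> r1 mxi /andP[/[!inE]/= meta feta] xieta.
apply/andP; split; rewrite inE//= /finite_norm.
apply: le_lt_trans feta; rewrite unlock.
move: r r1 => [r r1| _|//].
  rewrite gt0_ler_poweR ?invr_ge0 ?(le_trans ler01)//.
  - by rewrite in_itv/= leey integral_ge0// => w _; rewrite poweR_ge0.
  - by rewrite in_itv/= leey integral_ge0// => w _; rewrite poweR_ge0.
  apply: ge0_le_integral => //.
  - by move=> w _; rewrite lee_fin powR_ge0.
  - apply/measurable_EFinP; apply: (measurableT_comp (measurable_powR _)) => //.
    exact: measurableT_comp.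
  - apply/measurable_EFinP; apply: (measurableT_comp (measurable_powR _)) => //.
    exact: measurableT_comp.
  - move=> w _; rewrite lee_fin ge0_ler_powR ?nnegrE//.
    by rewrite (le_trans ler01).
case: ifPn => // _; apply: le_ess_sup; apply: nearW => w /=.
by rewrite lee_fin.
Qed.

End random_variables.

Section Yspace_theory.
Context d (Omega : measurableType d) (R : realType) (P : probability Omega R).
Implicit Types (xi eta : Omega -> R) (p : (Omega -> R) -> \bar R).

Lemma Lfun0 (r : \bar R) : (1 <= r)%E -> (0 : Omega -> R) \in Lfun P r.
Proof. by move=> r1; case: (Lfun_submod_closed P r1). Qed.

Lemma LfunD (r : \bar R) xi eta : (1 <= r)%E -> xi \in Lfun P r ->
  eta \in Lfun P r -> xi + eta \in Lfun P r.
Proof.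
move=> r1 hx he; have [_ /(_ 1 xi eta hx he)] := Lfun_submod_closed P r1.
by rewrite scale1r.
Qed.

Lemma LfunZ (r : \bar R) (b : R) xi : (1 <= r)%E -> xi \in Lfun P r ->
  b *: xi \in Lfun P r.
Proof.
move=> r1 hx; have [h0 /(_ b xi 0 hx h0)] := Lfun_submod_closed P r1.
by rewrite addr0.
Qed.

Lemma Lfun_measurable (r : \bar R) xi : xi \in Lfun P r -> measurable_fun setT xi.
Proof. by case/andP => /[!inE]. Qed.

Lemma admissible0 p : admissible P p -> p 0 = 0%E.
Proof.
move=> ap; have h0 : (0 : Omega -> R) \in Lfun P 1 by exact: Lfun0.
have [c c0 /(_ _ h0)[_]] := admissible_bounds ap.
rewrite (_ : EFin \o (0 : Omega -> R) = cst 0%E)//.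
rewrite Lnorm0 ?mule0//.
by move=> le0; apply/eqP; rewrite eq_le le0 (admissible_ge0 ap).
Qed.

Lemma admissibleZ p (a : R) xi : admissible P p -> xi \in Lfun P 1 ->
  p (a *: xi) = (`|a|%:E * p xi)%E.
Proof.
move=> ap hxi.
have [a0|a0|->] := ltgtP a 0; last first.
- by rewrite scale0r normr0 mul0e; exact: admissible0.
- by rewrite gtr0_norm//; exact: (admissible_homo ap).
rewrite ltr0_norm// -(admissible_homo ap) ?oppr_gt0// scaleNr.
by rewrite (admissible_sym ap)//; exact: LfunZ.
Qed.

Lemma sseq_le (pp : seminorm_seq P) i n xi : (i <= n)%N -> xi \in Lfun P 1 ->
  (pp i xi <= pp n xi)%E.
Proof.
move=> + hxi; elim: n => [|n ih]; first by rewrite leqn0 => /eqP ->.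
rewrite leq_eqVlt => /predU1P[->//|]; rewrite ltnS => /ih.
by move=> /le_trans; apply; exact: sseq_nondecreasing.
Qed.

Variable pp : seminorm_seq P.

Lemma dom_seqD xi eta : dom_seq pp xi -> dom_seq pp eta ->
  dom_seq pp (xi + eta).
Proof.
move=> [hx px] [he pe]; split; first exact: LfunD.
move=> n; rewrite (le_lt_trans (admissible_subadd (sseq_admissible pp n) _ _))//.
exact: lte_add_pinfty.
Qed.

Lemma dom_seqZ (a : R) xi : dom_seq pp xi -> dom_seq pp (a *: xi).
Proof.
move=> [hx px]; split; first exact: LfunZ.
move=> n; rewrite (admissibleZ a (sseq_admissible pp n) hx).
by rewrite lte_mul_pinfty// lee_fin.
Qed.

Lemma Yspace0 : Yspace pp 0.
Proof.
split.
  split; first exact: Lfun0.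
  by move=> n; rewrite (admissible0 (sseq_admissible pp n)).
move=> n e e0; exists 0; first by apply: Lfun0; rewrite leey.
by move=> i _; rewrite subrr (admissible0 (sseq_admissible pp i)) lte_fin.
Qed.

Lemma YspaceD xi eta : Yspace pp xi -> Yspace pp eta -> Yspace pp (xi + eta).
Proof.
move=> [dx hx] [de he]; split; first exact: dom_seqD.
move=> n e e0; have e20 : 0 < e / 2 by rewrite divr_gt0.
have [x xoo xlt] := hx n _ e20; have [y yoo ylt] := he n _ e20.
exists (x + y); first by apply: LfunD; rewrite ?leey.
move=> i hi; rewrite opprD addrACA (splitr e) EFinD.
have LB f g : dom_seq pp f -> g \in Lfun P +oo%E -> f - g \in Lfun P 1.
  move=> [hf _] /Loo_sub_L1 hg; apply: LfunD => //.
  by rewrite -scaleN1r; exact: LfunZ.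
apply: (le_lt_trans (admissible_subadd (sseq_admissible pp i) _ _)).
- exact: LB.
- exact: LB.
by rewrite lteD// ?xlt ?ylt.
Qed.

Lemma YspaceZ (a : R) xi : Yspace pp xi -> Yspace pp (a *: xi).
Proof.
move=> [dx hx]; split; first exact: dom_seqZ.
move=> n e e0; have a1 : 0 < `|a| + 1 by rewrite ltr_wpDl.
have [x xoo xlt] := hx n (e / (`|a| + 1)) (divr_gt0 e0 a1).
exists (a *: x); first by apply: LfunZ; rewrite ?leey.
move=> i hi; rewrite -scalerBr.
have hxx : xi - x \in Lfun P 1.
  apply: LfunD => //; first by case: dx.
  by rewrite -scaleN1r; apply: LfunZ => //; exact: Loo_sub_L1.
rewrite (admissibleZ a (sseq_admissible pp i) hxx).
have := xlt i hi; have := admissible_ge0 (sseq_admissible pp i) hxx.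
case: (pp i (xi - x)) => // r; rewrite lee_fin lte_fin => r0 re.
rewrite lte_fin (@le_lt_trans _ _ ((`|a| + 1) * r))//.
  by rewrite ler_wpM2r// lerDl.
by rewrite -ltr_pdivlMl// mulrC.
Qed.

Lemma Yspace_solid xi eta : measurable_fun setT xi ->
  (forall w, `|xi w| <= `|eta w|) -> Yspace pp eta -> Yspace pp xi.
Proof.
move=> mxi xieta [[he pe] hcl].
have hxi : xi \in Lfun P 1 by exact: Lfun_dominated xieta.
split.
  split=> // n; apply: le_lt_trans (pe n).
  by apply: (admissible_mono (sseq_admissible pp n)) => //; exact: nearW.
move=> n e e0; have [z zoo hz] := hcl n e e0.
pose x w := Num.max (- `|z w|) (Num.min (xi w) `|z w|).
have mz : measurable_fun setT z by exact: Lfun_measurable zoo.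
have mx : measurable_fun setT x.
  apply: measurable_maxr.
    by apply: measurableT_comp => //; exact: measurableT_comp.
  by apply: measurable_minr => //; exact: measurableT_comp.
have xz w : `|x w| <= `|z w|.
  rewrite ler_norml /x le_max lexx/= ge_max ge_min lexx orbT andbT.
  by rewrite (@le_trans _ _ 0) ?oppr_le0.
have xoo : x \in Lfun P +oo%E by apply: Lfun_dominated xz; rewrite ?leey.
have xiz w : `|xi w - x w| <= `|eta w - z w|.
  have hb : `|xi w| - `|z w| <= `|eta w - z w|.
    by rewrite (le_trans _ (lerB_dist _ _))// lerD2r.
  rewrite /x; have [h1|h1] := leP (xi w) `|z w|; last first.
    have nz : - `|z w| <= `|z w| by rewrite (@le_trans _ _ 0) ?oppr_le0.
    rewrite (max_r nz).
    have xz0 : 0 <= xi w - `|z w| by rewrite subr_ge0 ltW.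
    by rewrite (ger0_norm xz0) (le_trans _ hb)// lerD2r ler_norm.
  have [h2|h2] := leP (- `|z w|) (xi w); first by rewrite subrr normr0.
  have xz0 : xi w + `|z w| < 0 by rewrite -ltrBrDr sub0r.
  rewrite opprK (ltr0_norm xz0) opprD (le_trans _ hb)// lerD2r.
  by rewrite -normrN ler_norm.
exists x => // i hi; apply: le_lt_trans (hz i hi).
have LB f g : f \in Lfun P 1 -> g \in Lfun P +oo%E -> f - g \in Lfun P 1.
  move=> hf /Loo_sub_L1 hg; apply: LfunD => //.
  by rewrite -scaleN1r; exact: LfunZ.
apply: (admissible_mono (sseq_admissible pp i)); [exact: LB|exact: LB|].
apply: nearW => w; exact: xiz.
Qed.

End Yspace_theory.

Section processes.
Context d (Omega : measurableType d) (R : realType) (P : probability Omega R).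
Context (T : \bar R) (T0 : (0 < T)%E).
Implicit Types y z : Omega -> time T0 -> R.

(* Every path is continuous; completeness of P makes this no restriction on
   processes with almost surely continuous paths, up to indistinguishability. *)
Definition continuous_process y : Prop :=
  (forall w, continuous (y w)) /\
  measurable_fun setT (fun x : Omega * time T0 => y x.1 x.2).

Definition norm_process y : Omega -> R := fun w => path_norm (y w).

Definition L1C : set (Omega -> time T0 -> R) :=
  [set y | continuous_process y /\ norm_process y \in Lfun P 1].

Definition LooC : set (Omega -> time T0 -> R) :=
  [set y | continuous_process y /\ norm_process y \in Lfun P +oo%E].

Lemma continuous_process0 : continuous_process (0 : Omega -> time T0 -> R).
Proof. by split; [move=> w; exact: cst_continuous|exact: measurable_cst]. Qed.

Lemma continuous_processD y z : continuous_process y -> continuous_process z ->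
  continuous_process (y + z).
Proof.
move=> [cy my] [cz mz]; split; last exact: measurable_funD.
by move=> w t; apply: continuousD; [exact: cy|exact: cz].
Qed.

Lemma continuous_processZ (a : R) y : continuous_process y ->
  continuous_process (a *: y).
Proof.
move=> [cy my]; split; last by apply: measurable_funM => //; exact: measurable_cst.
by move=> w t; apply: (@continuousZr R _ _ (y w) a t); exact: cy.
Qed.

Lemma measurable_norm_process y : continuous_process y ->
  measurable_fun setT (norm_process y).
Proof.
move=> [cy my].
rewrite (_ : norm_process y = fun w => sups (fun n =>
  `|y w (time_param T0 (ratr (odflt 0%Q (unpickle n))))|) 0%N); last first.
  by apply/funext => w; exact: path_norm_countable.
apply: measurable_fun_sups.
  move=> w _; exists (path_norm (y w)) => _ [n _ <-].
  exact: path_norm_ub.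
move=> n; apply: measurableT_comp => //.
set t := time_param _ _.
exact: (measurableT_comp my (pair2_measurable t)).
Qed.

Variable pp : seminorm_seq P.

(* Y(C) before identification of indistinguishable processes. *)
Definition YCfun : {pred Omega -> time T0 -> R} :=
  [pred y | `[< L1C y /\ Yspace pp (norm_process y) >]].

Lemma YCfun_submod_closed : submod_closed YCfun.
Proof.
have sub y : continuous_process y -> Yspace pp (norm_process y) -> y \in YCfun.
  by move=> cy Yy; apply/asboolP; split => //; split => //; case: Yy => -[].
have n0 : norm_process (0 : Omega -> time T0 -> R) = 0.
  by apply/funext => w; exact: path_norm0.
split.
  apply: sub; first exact: continuous_process0.
  by rewrite n0; exact: Yspace0.
move=> a y z /asboolP[[cy _] Yy] /asboolP[[cz _] Yz].
have cayz : continuous_process (a *: y + z).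
  by apply: continuous_processD => //; exact: continuous_processZ.
apply: sub => //.
apply: (@Yspace_solid _ _ _ _ _ _ (`|a| *: norm_process y + norm_process z)).
- exact: measurable_norm_process.
- move=> w.
  have ge0 x : continuous_process x -> 0 <= norm_process x w.
    by move=> [cx _]; exact: path_norm_ge0.
  rewrite ger0_norm ?ge0// ger0_norm; last first.
    by rewrite addr_ge0// ?ge0// mulr_ge0// ge0.
  rewrite -[leRHS]/(`|a| * path_norm (y w) + path_norm (z w)).
  have [cy1 _] := cy; have [cz1 _] := cz.
  rewrite -path_normZ; last exact: cy1.
  have [cay _] := continuous_processZ a cy.
  by apply: path_normD; [exact: cay|exact: cz1].
- by apply: YspaceD => //; exact: YspaceZ.
Qed.

HB.instance Definition _ := GRing.isSubmodClosed.Build _ _ YCfun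
  YCfun_submod_closed.

Definition YCpre : Type := {y | y \in YCfun}.

HB.instance Definition _ := SubChoice.on YCpre.
HB.instance Definition _ := [SubChoice_isSubLmodule of YCpre by <:].

Definition YCnull : {pred YCpre} :=
  [pred y | `[< {ae P, forall w, forall t, val y w t = 0} >]].

End processes.

Section process_ops.
Context (S I : Type) (R : realType).
Implicit Types y z : S -> I -> R.

Lemma scale_processE (a : R) y w t : (a *: y) w t = a * y w t.
Proof. by []. Qed.

Lemma sub_processE y z w t : (y - z) w t = y w t - z w t.
Proof. by []. Qed.

End process_ops.

Section YC.
Context d (Omega : measurableType d) (R : realType) (P : probability Omega R).
Context (T : \bar R) (T0 : (0 < T)%E) (pp : seminorm_seq P).
Local Notation pre := (YCpre T0 pp).
Local Notation null := (@YCnull _ _ _ P _ T0 pp).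

Let null_zmod_closed : zmod_closed null.
Proof.
split; first by apply/asboolP; exact: nearW.
move=> x y /asboolP hx /asboolP hy; apply/asboolP.
apply: filterS2 hx hy => w hx hy t.
by rewrite -[LHS]/(val x w t - val y w t) hx hy subrr.
Qed.

HB.instance Definition _ := GRing.isZmodClosed.Build _ null null_zmod_closed.

Let null_scaler_closed : scaler_closed null.
Proof.
move=> a x /asboolP hx; apply/asboolP; apply: filterS hx => w hx t.
have -> : val (a *: x) = a *: val x by rewrite linearZ.
by rewrite scale_processE hx mulr0.
Qed.

Local Open Scope quotient_scope.

(* Y(C): processes modulo indistinguishability. *)
Definition YCquot : Type := quot_lmod null_scaler_closed.

HB.instance Definition _ := GRing.Lmodule.on YCquot.
HB.instance Definition _ := EqQuotient.on YCquot.

Definition YCrepr (y : YCquot) : Omega -> time T0 -> R := val (repr y).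

Lemma YCreprP (y : YCquot) : L1C P (YCrepr y) /\ Yspace pp (norm_process (YCrepr y)).
Proof. by rewrite /YCrepr; case: (repr y) => /= ? /asboolP. Qed.

Lemma YC_eqP (u v : pre) : \pi_YCquot u = \pi_YCquot v <->
  {ae P, forall w, forall t, val u w t = val v w t}.
Proof.
rewrite (pi_quot_eq null_scaler_closed u v); split=> [/asboolP|] h.
  apply: filterS h => w h t; apply/eqP; rewrite -subr_eq0; apply/eqP; exact: h.
by apply/asboolP; apply: filterS h => w h t; apply/eqP; rewrite subr_eq0; apply/eqP; exact: h.
Qed.

Definition YCseminorm (n : nat) (y : YCquot) : R :=
  fine (pp n (norm_process (YCrepr y))).

Let YCseminorm_pi n (u : pre) :
  YCseminorm n (\pi_YCquot u) = fine (pp n (norm_process (val u))).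
Proof.
rewrite /YCseminorm /YCrepr; congr fine.
have /YC_eqP h : \pi_YCquot (repr (\pi_YCquot u)) = \pi_YCquot u by rewrite reprK.
have eqn : {ae P, forall w, norm_process (val (repr (\pi_YCquot u))) w =
                            norm_process (val u) w}.
  by apply: filterS h => w h; congr path_norm; apply/funext.
have L1 (x : pre) : norm_process (val x) \in Lfun P 1.
  by case: x => x /= /asboolP[[_ ]].
apply/eqP; rewrite eq_le; apply/andP; split;
  apply: (admissible_mono (sseq_admissible pp n)) => //;
  by apply: filterS eqn => w ->.
Qed.

Lemma YCseminormP n : seminorm (YCseminorm n).
Proof.
have fin (x : pre) : (0 <= pp n (norm_process (val x)) < +oo)%E.
  case: x => x /= /asboolP[[_ x1] [[_ dx] _]].
  by rewrite dx andbT (admissible_ge0 (sseq_admissible pp n)).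
have finn (x : pre) : pp n (norm_process (val x)) \is a fin_num.
  by have /andP[x0 x1] := fin x; rewrite ge0_fin_numE.
have L1 (x : pre) : norm_process (val x) \in Lfun P 1.
  by case: x => x /= /asboolP[[_ ]].
have cont (x : pre) w : continuous (val x w).
  by case: x => x /= /asboolP[[[+ _] _] _]; exact.
split.
  move=> x y; rewrite -[x]reprK -[y]reprK -[X in YCseminorm n X]pi_quot_add.
  rewrite !YCseminorm_pi; set u := repr x; set v := repr y.
  rewrite -fineD// fine_le// ?fin_numD ?finn//.
  apply: le_trans (admissible_subadd (sseq_admissible pp n) (L1 u) (L1 v)).
  apply: (admissible_mono (sseq_admissible pp n)) => //.
    exact: LfunD.
  apply: nearW => w.
  rewrite (ger0_norm (path_norm_ge0 (cont (u + v) w))).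
  rewrite (le_trans (path_normD (cont u w) (cont v w)))//.
  exact: ler_norm.
move=> a x; rewrite -[x]reprK -[X in YCseminorm n X]pi_quot_scale.
rewrite !YCseminorm_pi; set u := repr x.
rewrite (_ : norm_process (val (a *: u)) = `|a| *: norm_process (val u)).
  rewrite (admissibleZ _ (sseq_admissible pp n))// normr_id.
  by rewrite fineM.
have -> : val (a *: u) = a *: val u by rewrite linearZ.
by apply/funext => w; apply: path_normZ; exact: cont.
Qed.

Definition YC : tvsType R := seminormed YCseminormP.

Definition YCclass (y : YCpre T0 pp) : YC := \pi_YCquot y.

End YC.

Section charges.
Context d (X : measurableType d) (R : realType) (nu : {charge set X -> \bar R}).

Let Hahn_ex : exists PN, hahn_decomposition nu PN.1 PN.2.
Proof. by have [A [N AN]] := Hahn_decomposition nu; exists (A, N). Qed.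

(* The Jordan decomposition does not depend on the choice of a Hahn
   decomposition. *)
Definition hahn := cid Hahn_ex.

Definition total_variation : R := fine (charge_variation (svalP hahn) setT).

Definition charge_integral (f : X -> R) : R :=
  \int[jordan_pos (svalP hahn)]_x f x - \int[jordan_neg (svalP hahn)]_x f x.

End charges.

Section random_measures.
Context d (Omega : measurableType d) (R : realType) (P : probability Omega R).
Context (T : \bar R) (T0 : (0 < T)%E).
Local Notation M := (charge (time T0) R).
Implicit Types u v : Omega -> M.

Definition variation_process u : Omega -> R :=
  fun w => total_variation (u w).

Definition L1M : set (Omega -> M) :=
  [set u : Omega -> M | (forall A : set (time T0), measurable A ->
             measurable_fun setT (fun w => u w A)) /\
           variation_process u \in Lfun P 1].

Definition UM (pp : seminorm_seq P) : set (Omega -> M) :=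
  [set u : Omega -> M | L1M u /\ Uspace pp (variation_process u)].

(* Charges are compared on Borel sets only: a {charge set X -> \bar R} is a
   function on all subsets of X, unspecified on the nonmeasurable ones. *)
Definition ae_eq_measure u v : Prop :=
  {ae P, forall w, forall A : set (time T0),
    measurable A -> u w A = v w A}.

Definition lin_comb (a : R) u v : Omega -> M :=
  fun w => cadd (cscale a (u w)) (v w).

Definition path_integral (y : Omega -> time T0 -> R) u : Omega -> R :=
  fun w => charge_integral (u w) (y w).

Definition pairing (y : Omega -> time T0 -> R) u : \bar R :=
  'E_P[path_integral y u]%E.

End random_measures.

(* Main.v *)
Require Import Defs.
From HB Require Import structures.
From mathcomp Require Import all_boot all_order all_algebra.
From mathcomp Require Import all_classical all_reals all_analysis.
From mathcomp Require Import measurable_realfun ess_sup_inf ring lra zify.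

Set Implicit Arguments.
Unset Strict Implicit.
Unset Printing Implicit Defensive.

Import Order.TTheory GRing.Theory Num.Theory.
Import numFieldNormedType.Exports.

Local Open Scope classical_set_scope.
Local Open Scope ring_scope.

(** The interval [0, T] is a continuous image of [0, 1], so that a path is the
    uniform limit of its piecewise linear interpolations on dyadic grids, and the
    integral of a path against a signed measure is a limit of Riemann sums
    (charge_riemann_cvg). Hence path integrals are measurable, and linear in the
    measure. The total variation is the limit of the sums of the absolute values
    of the integrals of the hat functions of the grid (hat_variation_cvg), and so
    it is measurable as well.

    The inequality is Hoelder's inequality for p and its polar, applied to the
    norm of y and the variation of u (pairing_abs_le). It is the definition of the
    polar for bounded variables, and truncation with Fatou's lemma gives the
    general case. It is sharp: the products of bounded variables with continuous
    paths which interpolate the sign of u w attain the polar of the variation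
    (polar_le_sup_pairing). This is the formula for the polar; it also shows that
    the pairing is continuous and that only u = 0 annihilates Y(C).

    A sequence of seminorms gives a metrizable topology, in which it suffices to
    find limits of fast Cauchy sequences. Since p dominates the L^1 norm, the paths
    of such a sequence of processes converge uniformly almost surely, and lower
    semicontinuity of p carries the estimates to the limit (fast_cauchy_limit).

    It remains to represent a continuous functional, which is bounded by a multiple
    of p (|y|) for a single p. Let Phi be its restriction to bounded processes. For
    a continuous function g >= 0 on the interval, the supremum of Phi (1_A z) over
    the processes z with 0 <= z <= g is a finite measure in the event A: it is
    additive because such processes can be glued, and countably additive and
    absolutely continuous because p (1_A) tends to 0 when A decreases to the empty
    set. Its density is the integral of g against a random measure which is yet to
    be found, for the positive part of Phi. Countably many g determine this random
    measure: the ramps of the dyadic grids. Their densities, which are monotone and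
    interlace under refinement of the grid, are approximate distribution functions;
    the corresponding quantile functions converge uniformly (level_quantile_dist),
    and the limit transports Lebesgue measure to the random measure
    (quantile_measure_integral). The same is done for - Phi. The difference u of the
    two random measures represents Phi (bounded_functional_representation), because
    a bounded process can be replaced by its interpolations, on which Phi is a
    finite sum of expectations of products with the densities. By the formula for
    the polar, the bound on Phi puts u into U(M); truncation of paths shows that
    bounded processes are dense in Y(C), and so the representation extends
    (UM_surjective). *)

(** * The time interval as a continuous image of the unit interval *)

Lemma near_half_pow (R : realType) (e : R) : 0 < e ->
  \forall n \near \oo, 2 ^- n < e.
Proof.
move=> e0; have lt1 : `|2^-1| < 1 :> R by rewrite gtr0_norm ?invf_lt1// ltr1n.
have /cvgrPdist_lt/(_ _ e0) := @cvg_geometric R 1 _ lt1.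
by apply: filterS => n; rewrite sub0r normrN /geometric /= mul1r exprVn ger0_norm.
Qed.

Section coordinates.
Context (R : realType) (T : \bar R) (T0 : (0 < T)%E).

(** contract is an order isomorphism of the extended line onto [- 1, 1]: after
    division by its value at T it maps the interval onto [0, 1], also for
    T = +oo. *)
Definition coord (t : time T0) : R := contract (val t) / contract T.

Definition node (r : R) : time T0 := time_param T0 (r * contract T).

Lemma contract_horizon_gt0 : 0 < contract T.
Proof. by rewrite -contract0 lt_contract. Qed.

Lemma coord_itv t : 0 <= coord t <= 1.
Proof.
have cT := contract_horizon_gt0.
case: t => t tT; rewrite /coord /=; move: (tT); rewrite inE /= => /andP[t0 t1].
rewrite ler_pdivrMr// mul1r le_contract t1 andbT divr_ge0 ?(ltW cT)//.
by rewrite -[leLHS]contract0 le_contract.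
Qed.

Lemma coordK t : node (coord t) = t.
Proof.
have cT := contract_horizon_gt0.
rewrite /coord /node mulfVK ?gt_eqF//; apply/val_inj => /=.
case: t => t /= tT; move: (tT); rewrite inE /= => /andP[t0 t1].
rewrite min_l ?le_contract// max_r ?contractK//.
by rewrite -[X in X <= _]contract0 le_contract.
Qed.

Lemma node_continuous : continuous node.
Proof.
move=> r; apply: (@continuous_comp R R (time T0)
    (fun r => r * contract T) (time_param T0)).
  by apply: mulrr_continuous.
exact: time_param_continuous.
Qed.

Lemma coord_continuous : continuous coord.
Proof.
have cT := contract_horizon_gt0.
move=> t; apply: (@continuous_comp (time T0) R R
    (fun t => contract (val t)) (fun r => r / contract T)).
  apply: (@continuous_comp (time T0) (\bar R) R val (@contract R)); first exact: initial_continuous.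
  move=> /= A; rewrite -nbhs_ballE => -[e e0 sA].
  have : nbhs (val t) (ball (val t) e) by exact: nbhsx_ballx.
  by apply: filterS => x; exact: sA.
by apply: mulrr_continuous.
Qed.

Lemma continuous_measurable_time (g : time T0 -> R) : continuous g ->
  measurable_fun setT g.
Proof.
move=> /continuousP cg; apply: (measurability _ (RGenOpens.measurableE R)).
move=> _ [_ [a [b ->] <-]]; rewrite setTI.
by apply: sub_sigma_algebra; exact/cg/interval_open.
Qed.

Lemma node_measurable : measurable_fun setT node.
Proof.
apply: (@measurability _ _ _ _ _ _ (@open (time T0))) => //.
move=> _ [A oA <-]; rewrite setTI; apply: open_measurable.
by move: oA; apply: (continuousP _).1; exact: node_continuous.
Qed.

Lemma coord_measurable : measurable_fun setT coord.
Proof. by apply: continuous_measurable_time; exact: coord_continuous. Qed.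

End coordinates.

(** * Dyadic interpolation *)

Section hats.
Context (R : realType).
Implicit Types (n i : nat) (s : R).

Definition grid n i : R := i%:R / 2 ^+ n.

(** Descends from 1 to 0 between the nodes i and i + 1. Hats are differences of
    consecutive ramps; ramps, unlike hats, are ordered, along a grid and under
    its refinement. *)
Definition ramp n i s : R := Num.max 0 (Num.min 1 (i.+1%:R - 2 ^+ n * s)).

Definition hat n i s : R :=
  if i is j.+1 then ramp n j.+1 s - ramp n j s else ramp n 0 s.

Definition interp n (x : nat -> R) s : R :=
  \sum_(i < (2 ^ n).+1) x i * hat n i s.

Lemma ramp_ge0 n i s : 0 <= ramp n i s.
Proof. by rewrite /ramp le_max lexx. Qed.

Lemma ramp_nondecreasing n i j s : (i <= j)%N -> ramp n i s <= ramp n j s.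
Proof.
move=> ij; have : (i.+1%:R : R) <= j.+1%:R by rewrite ler_nat.
rewrite /ramp; set u := i.+1%:R; set v := j.+1%:R; set x := _ * _ => uv.
rewrite !(maxEle, minEle); do 4 case: ifPn; rewrite -?ltNge; lra.
Qed.

Lemma hat_ge0 n i s : 0 <= hat n i s.
Proof.
case: i => [|i] /=; first exact: ramp_ge0.
by rewrite subr_ge0; exact: ramp_nondecreasing.
Qed.

Lemma sum_hat_ramp n m s : \sum_(i < m.+1) hat n i s = ramp n m s.
Proof.
elim: m => [|m ih]; first by rewrite big_ord1.
by rewrite big_ord_recr /= ih addrC subrK.
Qed.

Lemma sum_hat n s : s <= 1 -> \sum_(i < (2 ^ n).+1) hat n i s = 1.
Proof.
move=> s1; rewrite sum_hat_ramp /ramp min_l ?max_r//.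
rewrite -natr1 natrX.
have : 2 ^+ n * s <= 2 ^+ n by rewrite ler_piMr// exprn_ge0.
lra.
Qed.

Lemma hat_neq0 n i s : 0 <= s -> hat n i s != 0 -> `|s - grid n i| <= 2 ^- n.
Proof.
move=> s0 h; have n0 : (0 : R) < 2 ^+ n by rewrite exprn_gt0.
suff : `|2 ^+ n * s - i%:R| <= 1.
  rewrite (_ : s - grid n i = 2 ^- n * (2 ^+ n * s - i%:R)).
    by rewrite normrM gtr0_norm ?invr_gt0// => h1; rewrite ler_piMr// invr_ge0 ltW.
  by rewrite mulrBr mulKf ?gt_eqF// /grid [_^-1 * _]mulrC.
have x0 : 0 <= 2 ^+ n * s by rewrite mulr_ge0// ltW.
move: h x0; rewrite /hat /ramp; set x := _ * s.
case: i => [|i] /=.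
  rewrite !(maxEle, minEle) ler_norml; do 2 case: ifPn; rewrite -?ltNge ?eqxx// => *; lra.
rewrite -[i.+2%:R]natr1 -[i.+1%:R]natr1 ler_norml.
rewrite !(maxEle, minEle); do 4 case: ifPn; rewrite -?ltNge ?subrr ?eqxx// => *; lra.
Qed.

Lemma interp_bound n x s M : s <= 1 ->
  (forall i, (i <= 2 ^ n)%N -> `|x i| <= M) -> `|interp n x s| <= M.
Proof.
move=> s1 xM; rewrite (le_trans (ler_norm_sum _ _ _))//.
rewrite -[leRHS]mulr1 -(sum_hat n s1) mulr_sumr ler_sum// => i _.
by rewrite normrM (ger0_norm (hat_ge0 _ _ _)) ler_wpM2r ?hat_ge0// xM// -ltnS.
Qed.

(** The interpolation is a convex combination of the values at those nodes which
    are at distance at most the mesh from s. *)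
Lemma interp_dist n x s c e : 0 <= s <= 1 -> 0 <= e ->
  (forall i, (i <= 2 ^ n)%N -> `|s - grid n i| <= 2 ^- n -> `|x i - c| <= e) ->
  `|interp n x s - c| <= e.
Proof.
move=> /andP[s0 s1] e0 xe.
have -> : interp n x s - c = \sum_(i < (2 ^ n).+1) (x i - c) * hat n i s.
  under [RHS]eq_bigr do rewrite mulrBl.
  by rewrite sumrB -mulr_sumr sum_hat// mulr1.
rewrite (le_trans (ler_norm_sum _ _ _))//.
rewrite -[leRHS]mulr1 -(sum_hat n s1) mulr_sumr ler_sum// => i _.
rewrite normrM (ger0_norm (hat_ge0 _ _ _)).
have [->|h] := eqVneq (hat n i s) 0; first by rewrite !mulr0.
by rewrite ler_wpM2r ?hat_ge0// xe ?hat_neq0// -ltnS.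
Qed.

Lemma interp_by_parts n (x : nat -> R) s : s <= 1 ->
  interp n x s =
  x (2 ^ n)%N * ramp n (2 ^ n) s - \sum_(i < 2 ^ n) (x i.+1 - x i) * ramp n i s.
Proof.
move=> s1; rewrite /interp; elim: (2 ^ n)%N => [|N ih].
  by rewrite big_ord_recr !big_ord0/= add0r subr0.
rewrite big_ord_recr [in RHS]big_ord_recr /= ih; ring.
Qed.

Lemma ramp_continuous n i : continuous (ramp n i).
Proof.
move=> s; apply: (@continuous_max R R (cst 0)
    (fun s => Num.min 1 (i.+1%:R - 2 ^+ n * s))); first exact: cst_continuous.
apply: (@continuous_min R R (cst 1) (fun s => i.+1%:R - 2 ^+ n * s)).
  exact: cst_continuous.
apply: (@continuousB _ R R (cst i.+1%:R) (fun s => 2 ^+ n * s)).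
  exact: cst_continuous.
by apply: mulrl_continuous.
Qed.

Lemma hat_continuous n i : continuous (hat n i).
Proof.
case: i => [|i]; first exact: ramp_continuous.
by move=> s; apply: (@continuousB _ R R); exact: ramp_continuous.
Qed.

(** The ramps of the finer grid descend over the left and over the right half of
    the cell over which the ramp of the coarser grid descends. *)
Lemma ramp_refine n i s :
  ramp n.+1 i.*2 s <= ramp n i s <= ramp n.+1 i.*2.+1 s.
Proof.
rewrite /ramp exprS -mulrA; set x := _ * s.
have -> : i.*2.+2%:R = 2 * i.+1%:R :> R by rewrite -doubleS -mul2n natrM.
have -> : i.*2.+1%:R = 2 * i.+1%:R - 1 :> R.
  by rewrite -natrM mul2n doubleS [in RHS]mulrSr addrK.
set u := i.+1%:R.
by apply/andP; split; rewrite !(maxEle, minEle);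
  do 4 case: ifPn; rewrite -?ltNge => *; lra.
Qed.

End hats.

Section interpolation.
Context (R : realType) (T : \bar R) (T0 : (0 < T)%E).
Implicit Types g : time T0 -> R.

Definition sample n g : nat -> R := fun i => g (node T0 (grid R n i)).

Definition time_hat n i : time T0 -> R := fun t => hat n i (coord t).

Lemma time_hat_continuous n i : continuous (time_hat n i).
Proof.
move=> t; apply: (@continuous_comp (time T0) R R (@coord R T T0) (hat n i)).
  exact: coord_continuous.
exact: hat_continuous.
Qed.

Definition time_ramp n i : time T0 -> R := fun t => ramp n i (coord t).

Lemma time_ramp_continuous n i : continuous (time_ramp n i).
Proof.
move=> t; apply: (@continuous_comp (time T0) R R (@coord R T T0) (ramp n i)).
  exact: coord_continuous.
exact: ramp_continuous.
Qed.

Lemma time_ramp_ge0 n i t : 0 <= time_ramp n i t.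
Proof. exact: ramp_ge0. Qed.

Lemma time_ramp_top n t : time_ramp n (2 ^ n) t = 1.
Proof.
by rewrite /time_ramp -sum_hat_ramp sum_hat//; have /andP[] := coord_itv t.
Qed.

(** Heine's theorem, in the form of a near covering of the compact unit
    interval. *)
Lemma sample_cvg g : continuous g -> forall e : R, 0 < e ->
  \forall n \near \oo, forall t i,
    `|coord t - grid R n i| <= 2 ^- n -> `|sample n g i - g t| <= e.
Proof.
move=> cg e e0.
pose h r := g (node T0 r).
have ch : continuous h.
  move=> r; apply: (@continuous_comp R (time T0) R (node T0) g).
    exact: node_continuous.
  exact: cg.
have /compact_near_coveringP/(_ nat \oo (fun n r =>
    forall s, `|r - s| <= 2 ^- n -> `|h s - h r| <= e)) :
    compact (`[0, 1]%classic : set R) by exact: segment_compact.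
case.
  move=> r _.
  have e20 : 0 < e / 2 by rewrite divr_gt0.
  have /cvgrPdist_lt/(_ _ e20)/nbhs_ballP[dl /= d0 hd] := ch r.
  have d20 : 0 < dl / 2 by rewrite divr_gt0.
  exists (ball r (dl / 2), [set n | 2 ^- n < dl / 2]) => /=.
    split; first exact: nbhsx_ballx.
    exact: near_half_pow.
  move=> [r' n] /= [rr' nd] s r's.
  have h1 : `|h r - h s| < e / 2.
    apply: hd; rewrite /ball /= (splitr dl).
    rewrite (le_lt_trans (ler_distD r' _ _))// ltrD//.
    exact: le_lt_trans nd.
  have h2 : `|h r - h r'| < e / 2.
    apply: hd; rewrite /ball /= (lt_le_trans rr')//.
    by rewrite ler_pdivrMr// ler_peMr ?ler1n// ltW.
  rewrite (le_trans (ler_distD (h r) _ _))// [leRHS](splitr e) lerD//.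
    by rewrite distrC ltW.
  exact: ltW.
move=> N _ hN; exists N => // n /= Nn t i hi.
rewrite -[in g t](coordK t).
have /(_ (coord t)) := hN n Nn; apply => //.
by rewrite /= in_itv /=; exact: coord_itv.
Qed.

Lemma interp_cvg g : continuous g -> forall e : R, 0 < e ->
  \forall n \near \oo, forall t,
    `|interp n (sample n g) (coord t) - g t| <= e.
Proof.
move=> cg e e0; apply: filterS (sample_cvg cg e0) => n h t.
apply: interp_dist; [exact: coord_itv|exact: ltW|].
by move=> i _; exact: h.
Qed.

Definition cell n i : set (time T0) :=
  [set t | grid R n i <= coord t < grid R n i.+1].

Lemma measurable_cell n i : measurable (cell n i).
Proof.
rewrite (_ : cell n i = @coord R T T0 @^-1` `[grid R n i, grid R n i.+1[).
  by rewrite -[X in measurable X]setTI; apply: coord_measurable.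
by apply/seteqP; split=> t /=; rewrite in_itv.
Qed.

(** The cells are a partition: t lies in the cell whose index is the integer part
    of 2 ^ n * coord t. *)
Lemma sum_cell n (x : nat -> R) t : exists2 i,
  (i <= 2 ^ n)%N /\ `|coord t - grid R n i| <= 2 ^- n &
  \sum_(j < (2 ^ n).+1) x j * \1_(cell n j) t = x i.
Proof.
have /andP[c0 c1] := coord_itv t.
have n0 : (0 : R) < 2 ^+ n by rewrite exprn_gt0.
pose i := Num.truncn (2 ^+ n * coord t).
have /andP[i1 i2] : i%:R <= 2 ^+ n * coord t < i.+1%:R.
  by apply: truncn_itv; rewrite mulr_ge0// ltW.
have h1 j : (grid R n j <= coord t) = (j%:R <= 2 ^+ n * coord t).
  by rewrite /grid ler_pdivrMr// mulrC.
have h2 j : (coord t < grid R n j) = (2 ^+ n * coord t < j%:R).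
  by rewrite /grid ltr_pdivlMr// mulrC.
have i2n : (i <= 2 ^ n)%N.
  rewrite -(@ler_nat R) natrX (le_trans i1)// ler_piMr// ltW//.
exists i.
  split => //; rewrite ger0_norm ?subr_ge0 ?h1//.
  rewrite lerBlDr -[leRHS]/(2 ^- n + i%:R / 2 ^+ n).
  rewrite (_ : 2 ^- n + _ = grid R n i.+1); last first.
    by rewrite /grid -[in RHS]natr1 mulrDl mul1r addrC.
  by rewrite ltW// h2.
rewrite (bigD1 (Ordinal (i2n : (i < (2 ^ n).+1)%N)))//= big1 ?addr0.
  by rewrite indicE mem_set ?mulr1// /cell /= h1 h2 i1.
move=> j ji; rewrite indicE memNset ?mulr0// /cell /= h1 h2 => /truncn_def jE.
by move/eqP : ji; apply; apply/val_inj; rewrite /= -jE.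
Qed.

End interpolation.

(** * Riemann sums *)

Section dominated_convergence_real.
Context d (X : measurableType d) (R : realType) (mu : {measure set X -> \bar R}).

Lemma Rintegral_dominated_cvg (f_ : nat -> X -> R) (f g : X -> R) :
  (forall n, measurable_fun setT (f_ n)) -> mu.-integrable setT (EFin \o g) ->
  {ae mu, forall x, f_ n x @[n --> \oo] --> f x} -> measurable_fun setT f ->
  (forall n, {ae mu, forall x, `|f_ n x| <= g x}) ->
  mu.-integrable setT (EFin \o f) /\
  \int[mu]_x f_ n x @[n --> \oo] --> \int[mu]_x f x.
Proof.
move=> mf_ ig f_f mf f_g.
have [] := @dominated_convergence _ _ _ mu setT measurableT
  (fun n => EFin \o f_ n) (EFin \o f) (EFin \o g).
- by move=> n; exact/measurable_EFinP.
- exact/measurable_EFinP.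
- apply: filterS f_f => x h _; by apply/fine_cvgP; split; [exact: nearW|exact: h].
- exact: ig.
- by have := ae_foralln f_g; apply: filterS => x h n _ /=; rewrite lee_fin.
- move=> fi _ cvg; split => //.
  apply: (@fine_cvg _ _ _ _ (fun n => \int[mu]_x (f_ n x)%:E)%E).
  rewrite /Rintegral fineK; first exact: cvg.
  exact: integrable_fin_num.
Qed.

End dominated_convergence_real.

Section riemann_sums.
Context (R : realType) (T : \bar R) (T0 : (0 < T)%E).
Implicit Types g : time T0 -> R.

Lemma Rintegral_sum d (X : measurableType d) (mu : {measure set X -> \bar R})
    I (s : seq I) (f : I -> X -> R) :
  (forall i, mu.-integrable setT (EFin \o f i)) ->
  mu.-integrable setT (EFin \o (fun x => \sum_(i <- s) f i x)) /\
  \int[mu]_x (\sum_(i <- s) f i x) = \sum_(i <- s) \int[mu]_x f i x.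
Proof.
move=> fi; elim: s => [|i s [ihi ih]].
  under [in X in _ /\ X]eq_Rintegral do rewrite big_nil.
  rewrite Rintegral_cst// mul0r big_nil; split => //.
  rewrite (_ : _ \o _ = cst 0%E); first exact: integrable0.
  by apply/funext => x /=; rewrite big_nil.
have E x : \sum_(j <- i :: s) f j x = f i x + \sum_(j <- s) f j x.
  by rewrite big_cons.
split.
  rewrite (_ : _ \o _ = (EFin \o f i) \+ (EFin \o fun x => \sum_(j <- s) f j x)).
    exact: integrableD.
  by apply/funext => x /=; rewrite E EFinD.
under eq_Rintegral do rewrite E.
by rewrite RintegralD// ih big_cons.
Qed.

Lemma continuous_integrable (mu : {finite_measure set (time T0) -> \bar R}) g :
  continuous g -> mu.-integrable setT (EFin \o g).
Proof.
move=> cg; apply: measurable_bounded_integrable => //.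
- by rewrite ltey_eq fin_num_measure.
- exact: continuous_measurable_time.
- exists (path_norm g); split; first exact: num_real.
  by move=> M gM t _ /=; rewrite (le_trans (path_norm_ub t cg))// ltW.
Qed.

Definition riemann_sum (nu : set (time T0) -> \bar R) g n : R :=
  \sum_(i < (2 ^ n).+1) sample n g i * fine (nu (cell n i)).

(** Riemann sums are integrals of step functions that converge to g uniformly. *)
Lemma riemann_sum_cvg (mu : {finite_measure set (time T0) -> \bar R}) g :
  continuous g -> riemann_sum mu g n @[n --> \oo] --> \int[mu]_t g t.
Proof.
move=> cg.
pose f_ n (t : time T0) := \sum_(i < (2 ^ n).+1) sample n g i * \1_(cell n i) t.
have indi n i : mu.-integrable setT
    (EFin \o (fun t => sample n g i * \1_(cell n i) t)).
  rewrite (_ : _ \o _ = (fun t => (sample n g i)%:E * (\1_(cell n i) t)%:E)%E).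
    by apply: integrableZl => //; apply: integrable_indic => //; exact: measurable_cell.
  by apply/funext => t /=; rewrite EFinM.
rewrite (_ : riemann_sum mu g = fun n => \int[mu]_t f_ n t); last first.
  apply/funext => n; rewrite (Rintegral_sum _ (fun i => indi n (val i))).2.
  apply: eq_bigr => i _; rewrite RintegralZl//; last first.
    by apply: integrable_indic => //; exact: measurable_cell.
  congr (_ * _); rewrite /Rintegral integral_indic ?setIT//; exact: measurable_cell.
apply: (@Rintegral_dominated_cvg _ _ _ mu f_ g (cst (path_norm g)) _ _ _ _ _).2.
- move=> n; apply/measurable_EFinP.
  have [+ _] := Rintegral_sum (index_enum 'I_(2 ^ n).+1) (fun i => indi n (val i)).
  by move/measurable_int.
- exact: finite_measure_integrable_cst.
- apply: nearW => t; apply/cvgrPdist_le => e e0.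
  have := sample_cvg cg e0; apply: filterS => n hn.
  by rewrite /f_; have [i [_ hi] ->] := sum_cell n (sample n g) t; rewrite distrC hn.
- exact: continuous_measurable_time.
- move=> n; apply: nearW => t.
  by rewrite /f_; have [i _ ->] := sum_cell n (sample n g) t; exact: path_norm_ub.
Qed.

End riemann_sums.

(** * Integrals against signed measures *)

Lemma cvg_seq_unique (R : realType) (u : nat -> R) (a b : R) :
  u @ \oo --> a -> u @ \oo --> b -> a = b.
Proof. by move=> ua ub; rewrite -(cvg_lim _ ua)// -(cvg_lim _ ub). Qed.

Lemma continuous_sum (R : realType) (X : topologicalType) I (s : seq I)
    (f : I -> X -> R) : (forall i, continuous (f i)) ->
  continuous (fun t => \sum_(i <- s) f i t).
Proof.
move=> cf t; apply: cvg_big => [|i _]; first exact: add_continuous.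
exact: cf.
Qed.

Section charges_on_time.
Context (R : realType) (T : \bar R) (T0 : (0 < T)%E).
Local Notation M := (charge (time T0) R).
Implicit Types (g : time T0 -> R) (nu : M).

(** charge_integral is defined by means of a chosen Hahn decomposition, which is
    neither additive in the charge nor measurable in a parameter; Riemann sums
    are both. *)
Lemma charge_riemann_cvg nu g : continuous g ->
  riemann_sum nu g n @[n --> \oo] --> charge_integral nu g.
Proof.
move=> cg; rewrite /charge_integral.
set p := jordan_pos _; set q := jordan_neg _.
rewrite (_ : riemann_sum nu g =
    fun n => riemann_sum p g n - riemann_sum q g n); last first.
  apply/funext => n; rewrite /riemann_sum -sumrB; apply: eq_bigr => i _.
  rewrite -mulrBr; congr (_ * _).
  have mc := @measurable_cell R T T0 n i.
  rewrite (jordan_decomp (svalP (hahn nu)) mc) /cadd/= cscaleN1 fineD/=.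
  - by rewrite fineN.
  - exact: (fin_num_measure p).
  - by rewrite fin_numN (fin_num_measure q).
by apply: cvgB; exact: riemann_sum_cvg.
Qed.

Lemma charge_integral_ext nu nu' g : continuous g ->
  (forall A, measurable A -> nu A = nu' A) ->
  charge_integral nu g = charge_integral nu' g.
Proof.
move=> cg E; apply: cvg_seq_unique (charge_riemann_cvg cg) _.
rewrite (_ : riemann_sum nu g = riemann_sum nu' g); first exact: charge_riemann_cvg.
apply/funext => n; apply: eq_bigr => i _; rewrite E//; exact: measurable_cell.
Qed.

Lemma charge_integral_lin (a : R) nu nu' g : continuous g ->
  charge_integral (cadd (cscale a nu) nu') g =
  a * charge_integral nu g + charge_integral nu' g.
Proof.
move=> cg; apply: cvg_seq_unique (charge_riemann_cvg cg) _.
rewrite (_ : riemann_sum _ g =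
    fun n => a * riemann_sum nu g n + riemann_sum nu' g n); last first.
  apply/funext => n; rewrite /riemann_sum mulr_sumr -big_split; apply: eq_bigr => i _.
  have mc := @measurable_cell R T T0 n i.
  rewrite /cadd/= /cscale/= fineD ?fineM ?fin_numM ?fin_num_measure//=.
  by rewrite mulrDr mulrCA.
by apply: cvgD; [apply: cvgMl_tmp|]; exact: charge_riemann_cvg.
Qed.

Lemma charge_integral_measure (mu : {finite_measure set (time T0) -> \bar R}) g :
  continuous g ->
  charge_integral (charge_of_finite_measure mu) g = \int[mu]_t g t.
Proof.
move=> cg; apply: cvg_seq_unique (charge_riemann_cvg cg) _.
exact: riemann_sum_cvg.
Qed.

Lemma charge_integral_sum nu I (s : seq I) (x : I -> R) (g : I -> time T0 -> R) :
  (forall i, continuous (g i)) ->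
  charge_integral nu (fun t => \sum_(i <- s) x i * g i t) =
  \sum_(i <- s) x i * charge_integral nu (g i).
Proof.
move=> cg.
have gi (mu : {finite_measure set (time T0) -> \bar R}) i :
    mu.-integrable setT (EFin \o (g i)) by exact: continuous_integrable.
have xgi (mu : {finite_measure set (time T0) -> \bar R}) i :
    mu.-integrable setT (EFin \o (fun t => x i * g i t)).
  rewrite (_ : _ \o _ = (fun t => (x i)%:E * (g i t)%:E)%E); first by apply: integrableZl => //; exact: gi.
  by apply/funext => t /=; rewrite EFinM.
have E (mu : {finite_measure set (time T0) -> \bar R}) :
    \int[mu]_t (\sum_(i <- s) x i * g i t) = \sum_(i <- s) x i * \int[mu]_t g i t.
  rewrite (Rintegral_sum s (xgi mu)).2.
  by apply: eq_bigr => i _; rewrite RintegralZl//; exact: gi.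
rewrite /charge_integral; set p := jordan_pos _; set q := jordan_neg _.
transitivity (\sum_(i <- s) x i * \int[p]_t g i t -
              \sum_(i <- s) x i * \int[q]_t g i t).
  by congr (_ - _); exact: E.
by rewrite -sumrB; apply: eq_bigr => i _; rewrite mulrBr.
Qed.

Lemma total_variation_ge0 nu : 0 <= Defs.total_variation nu.
Proof. by rewrite fine_ge0// /charge_variation/= adde_ge0. Qed.

Lemma charge_integral_le nu g (m : R) : continuous g ->
  (forall t, `|g t| <= m) -> `|charge_integral nu g| <= m * Defs.total_variation nu.
Proof.
move=> cg gm; rewrite /charge_integral /Defs.total_variation /charge_variation/=.
set p := jordan_pos _; set q := jordan_neg _.
have le (mu : {finite_measure set (time T0) -> \bar R}) :
    `|\int[mu]_t g t| <= m * fine (mu setT).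
  have gi := continuous_integrable mu cg.
  rewrite (le_trans (le_normr_Rintegral _ gi))//.
  rewrite -Rintegral_cst//; apply: le_Rintegral => //.
    exact: integrable_norm.
  exact: finite_measure_integrable_cst.
rewrite (le_trans (ler_normB _ _))// fineD ?fin_num_measure//.
by rewrite mulrDr lerD// le.
Qed.

End charges_on_time.

(** * The total variation as a limit over the hats *)

Section approximation_by_continuous_functions.
Context (R : realType) (T : \bar R) (T0 : (0 < T)%E).
Variable mu : {finite_measure set (time T0) -> \bar R}.
Implicit Types g : time T0 -> R.

Lemma interp_continuous n (x : nat -> R) :
  continuous (fun t : time T0 => interp n x (coord t)).
Proof.
rewrite /interp; apply: continuous_sum => i t.
apply: (@continuousM R (time T0) (cst (x i)) (time_hat n i)).
  exact: cst_continuous.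
exact: time_hat_continuous.
Qed.

(** An open set A is the pointwise limit of the interpolations of the
    indicator of those nodes around which A contains two cells. *)
Lemma open_approximation (A : set (time T0)) : open A ->
  exists g : nat -> time T0 -> R,
    [/\ forall n, continuous (g n), forall n t, 0 <= g n t <= 1 &
        forall t, g n t @[n --> \oo] --> (\1_A t : R)].
Proof.
move=> oA.
have oA' : open (node T0 @^-1` A).
  by move: oA; apply: (continuousP _).1; exact: node_continuous.
pose deep n i := `[< forall s : R, `|s - grid R n i| <= 2 ^- n -> A (node T0 s) >].
pose x n i : R := (deep n i)%:R.
exists (fun n t => interp n (x n) (coord t)); split.
- move=> n; exact: interp_continuous.
- move=> n t; have /andP[c0 c1] := coord_itv t; apply/andP; split.
    by rewrite sumr_ge0// => i _; rewrite mulr_ge0 ?hat_ge0.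
  rewrite (le_trans (ler_norm _))// interp_bound// => i _.
  by rewrite /x normr_nat lern1 leq_b1.
- move=> t; apply: cvg_near_cst.
  have [At|nAt] := pselect (A t); last first.
    apply: nearW => n; apply/eqP; rewrite -subr_eq0 -normr_le0.
    apply: interp_dist => //; first exact: coord_itv.
    move=> i _ ti; rewrite indicE memNset// subr0 normr_le0 /x.
    rewrite pnatr_eq0 eqb0; apply/asboolPn => /(_ _ ti).
    by rewrite coordK.
  have : nbhs (coord t) (node T0 @^-1` A).
    by apply: open_nbhs_nbhs; split => //=; rewrite coordK.
  move=> /nbhs_ballP[e /= e0 he].
  have e20 : 0 < e / 2 by rewrite divr_gt0.
  apply: filterS (near_half_pow e20) => n ne; apply/eqP; rewrite -subr_eq0 -normr_le0.
  apply: interp_dist => //; first exact: coord_itv.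
  move=> i _ ti; rewrite indicE mem_set// normr_le0 subr_eq0 /x.
  rewrite (_ : deep n i)//; apply/asboolP => s si; apply: he.
  rewrite /ball /= (splitr e) (le_lt_trans (ler_distD (grid R n i) _ _))//.
  by rewrite ltrD ?(le_lt_trans ti)// distrC (le_lt_trans si).
Qed.

Lemma indic_partial_sum (F : (set (time T0))^nat) N t : trivIset setT F ->
  0 <= \1_(\bigcup_k F k) t - \sum_(k < N) \1_(F k) t :> R.
Proof.
move=> tF; rewrite subr_ge0.
have [[k kN Fkt]|nF] := pselect (exists2 k : nat, (k < N)%N & F k t).
  rewrite (bigD1 (Ordinal kN))//= big1 ?addr0.
    by rewrite !indicE !mem_set//; exists k.
  move=> j jk; rewrite indicE memNset// => Fjt.
  have /eqP := tF _ _ I I (ex_intro _ t (conj Fkt Fjt)).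
  by move/eqP => kj; move/eqP : jk; apply; exact/val_inj.
rewrite big1 => [|j _]; first by rewrite indicE.
by rewrite indicE memNset// => Fjt; apply: nF; exists j.
Qed.

(** The sets that can be approximated form a Dynkin system, which contains the
    open sets. *)
Lemma L1_approximation (A : set (time T0)) : measurable A ->
  forall e : R, 0 < e -> exists g : time T0 -> R,
    [/\ continuous g, forall t, 0 <= g t <= 1 &
        \int[mu]_t `|g t - \1_A t| <= e].
Proof.
have ii g (B : set (time T0)) : continuous g -> measurable B ->
    mu.-integrable setT (EFin \o (fun t => `|g t - \1_B t|)).
  move=> cg mB; apply: (integrable_norm (f := fun t => g t - \1_B t)) => //.
  rewrite (_ : _ \o _ = (EFin \o g) \- (EFin \o \1_B))%E.
    apply: integrableB => //; first exact: continuous_integrable.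
    exact: integrable_indic.
  by apply/funext => t /=; rewrite EFinB.
move=> mA.
pose Pr (B : set (time T0)) := forall e : R, 0 < e -> exists g : time T0 -> R,
  [/\ continuous g, forall t, 0 <= g t <= 1 & \int[mu]_t `|g t - \1_B t| <= e].
apply: (@dynkin_induction _ (time T0) open Pr _ _ _ _ _ _ A mA) => //.
- exact: openI.
- move=> e e0; exists (cst 1); split.
  + exact: cst_continuous.
  + by move=> t; rewrite ler01 lexx.
  + rewrite (_ : (\int[mu]_t _) = \int[mu]_t (cst 0 t)); last first.
      by apply: eq_Rintegral => t _; rewrite indicT subrr normr0.
    by rewrite Rintegral_cst// mul0r ltW.
- move=> {mA}A oA e e0; have [g [cg g01 gA]] := open_approximation oA.
  have mA : measurable A by exact: sub_sigma_algebra.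
  have : \int[mu]_t `|g n t - \1_A t| @[n --> \oo] --> \int[mu]_t (cst 0 t).
    apply: (@Rintegral_dominated_cvg _ _ _ mu _ (cst 0) (cst 1) _ _ _ _ _).2.
    + by move=> n; apply/measurable_EFinP; exact: (measurable_int _ (ii _ _ (cg n) mA)).
    + exact: finite_measure_integrable_cst.
    + apply: nearW => t; apply/cvgrPdist_le => eps eps0.
      move/cvgrPdist_le : (gA t) => /(_ _ eps0); apply: filterS => n.
      by rewrite sub0r normrN normr_id distrC.
    + exact: measurable_cst.
    + move=> n; apply: nearW => t; rewrite normr_id indicE.
      have /andP[g0 g1] := g01 n t.
      by case: (t \in A); rewrite /= ler_norml; lra.
  rewrite Rintegral_cst// mul0r => /cvgrPdist_le/(_ _ e0)[N _ /(_ N (leqnn N))].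
  rewrite sub0r normrN => /(le_trans (ler_norm _)) h.
  by exists (g N); split.
- move=> S mS hS e e0; have [g [cg g01 gS]] := hS e e0.
  exists (fun t => 1 - g t); split.
  + move=> t; apply: (@continuousB R R (time T0) (cst 1) g); [exact: cst_continuous|exact: cg].
  + by move=> t; have := g01 t; lra.
  + apply: le_trans gS; rewrite le_eqVlt; apply/orP; left; apply/eqP.
    apply: eq_Rintegral => t _; rewrite distrC; congr (`|_|).
    by rewrite !indicE in_setC; case: (t \in S) => /=; lra.
- move=> F mF tF hF e e0.
  have mU : measurable (\bigcup_k F k) by exact: bigcup_measurable.
  have e20 : 0 < e / 2 by rewrite divr_gt0.
  have [N hN] : exists N, fine (mu (\bigcup_k F k)) -
      \sum_(k < N) fine (mu (F k)) <= e / 2.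
    have /fine_cvgP[_] : (fun n => \sum_(0 <= k < n) mu (F k))%E @ \oo -->
        (fine (mu (\bigcup_k F k)))%:E.
      rewrite fineK ?fin_num_measure//.
      by apply: measure_semi_sigma_additive.
    move=> /cvgrPdist_le/(_ _ e20)[N _ /(_ N (leqnn N))] /=.
    rewrite -sum_fine; last by move=> k _; rewrite fin_num_measure.
    by rewrite big_mkord => h; exists N; rewrite (le_trans (ler_norm _)).
  have eN0 : 0 < e / 2 / N.+1%:R by rewrite divr_gt0.
  have /choice[g hg] := fun k => hF k _ eN0.
  pose S t := \sum_(k < N) g k t.
  have cS : continuous S.
    by apply: continuous_sum => i; have [] := hg i.
  have cm : continuous (fun t => Num.min 1 (S t)).
    by move=> t; apply: (@continuous_min R _ (cst 1) S); [exact: cst_continuous|exact: cS].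
  exists (fun t => Num.min 1 (S t)); split => //.
    move=> t; rewrite le_min ler01 /= ge_min lexx /= andbT.
    by rewrite sumr_ge0// => k _; have [_ /(_ t)/andP[]] := hg k.
  pose b k t := `|g k t - \1_(F k) t|.
  pose r t : R := \1_(\bigcup_k F k) t - \sum_(k < N) \1_(F k) t.
  have bi k : mu.-integrable setT (EFin \o b k).
    by apply: ii => //; have [] := hg k.
  have [si sE] := Rintegral_sum (index_enum 'I_N) (fun i => integrable_indic mu (mF (val i))).
  have ri : mu.-integrable setT (EFin \o r).
    rewrite (_ : _ \o _ = (EFin \o \1_(\bigcup_k F k)) \-
        (EFin \o fun t => \sum_(k < N) \1_(F k) t)%R)%E.
      by apply: integrableB => //; exact: integrable_indic.
    by apply/funext => t /=; rewrite EFinB.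
  have [bsi bsE] := Rintegral_sum (index_enum 'I_N) (fun i => bi (val i)).
  apply: (@le_trans _ _ (\int[mu]_t (\sum_(k < N) b k t + r t))).
    apply: le_Rintegral => //.
    + exact: ii.
    + rewrite (_ : _ \o _ = (EFin \o r) \+
          (EFin \o fun t => \sum_(k < N) b k t)%R)%E; first exact: integrableD.
      by apply/funext => t /=; rewrite addrC EFinD.
    + move=> t _; have r0 : 0 <= r t by exact: indic_partial_sum.
      have h1 : `|Num.min 1 (S t) - \1_(\bigcup_k F k) t| <=
          `|S t - \1_(\bigcup_k F k) t|.
        rewrite minEle indicE; case: ifPn => // h.
        have i1 : (t \in \bigcup_k F k)%:R <= 1 :> R by rewrite lern1 leq_b1.
        by rewrite !ger0_norm ?subr_ge0 ?lerD2r ?(le_trans i1).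
      apply: (le_trans h1).
      rewrite (_ : S t - _ = \sum_(k < N) (g k t - \1_(F k) t) - r t); last first.
        by rewrite sumrB /r opprB addrA subrK.
      rewrite (le_trans (ler_normB _ _))// (ger0_norm r0) lerD2r.
      exact: ler_norm_sum.
  rewrite RintegralD// bsE (splitr e) lerD//.
    apply: (@le_trans _ _ (\sum_(k < N) e / 2 / N.+1%:R)).
      by apply: ler_sum => k _; have [] := hg k.
    rewrite sumr_const card_ord -[leLHS]mulr_natr -mulrA ler_piMr ?(ltW e20)//.
    by rewrite mulrC ltW// ltr_pdivrMr// mul1r ltr_nat.
  rewrite RintegralB//; last exact: integrable_indic.
  rewrite sE; apply: le_trans hN; rewrite lerB//.
    by rewrite /Rintegral integral_indic// setIT.
  by apply: ler_sum => k _; rewrite /Rintegral integral_indic// setIT.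
Qed.

End approximation_by_continuous_functions.

Section variation_by_hats.
Context (R : realType) (T : \bar R) (T0 : (0 < T)%E).
Local Notation M := (charge (time T0) R).
Implicit Types (g : time T0 -> R) (nu : M).

Section variation_measure.
Variable nu : M.

Definition variation_measure : set (time T0) -> \bar R :=
  measure_add (jordan_pos (svalP (hahn nu))) (jordan_neg (svalP (hahn nu))).

HB.instance Definition _ := Measure.on variation_measure.

Let fin_variation_measure : fin_num_fun variation_measure.
Proof.
move=> A mA; rewrite /variation_measure measure_addE fin_numD.
by rewrite !fin_num_measure.
Qed.

HB.instance Definition _ := @Measure_isFinite.Build _ _ _
  variation_measure fin_variation_measure.

End variation_measure.

Lemma charge_integralB nu g h : continuous g -> continuous h ->
  charge_integral nu (fun t => g t - h t) =
  charge_integral nu g - charge_integral nu h.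
Proof.
move=> cg ch; rewrite /charge_integral.
have E (mu : {finite_measure set (time T0) -> \bar R}) :
    \int[mu]_t (g t - h t) = \int[mu]_t g t - \int[mu]_t h t.
  by rewrite RintegralB//; exact: continuous_integrable.
set p := jordan_pos _; set q := jordan_neg _.
transitivity ((\int[p]_t g t - \int[p]_t h t) - (\int[q]_t g t - \int[q]_t h t)).
  by congr (_ - _); exact: E.
by ring.
Qed.

(** If g is close to the indicator of the positive set of a Hahn decomposition,
    in mean for the variation measure, then 2 g - 1 is close to the sign of the
    charge. *)
Lemma total_variation_approx nu (e : R) : 0 < e ->
  exists g, [/\ continuous g, forall t, `|g t| <= 1 &
    Defs.total_variation nu - e <= charge_integral nu g].
Proof.
move=> e0; have e20 : 0 < e / 2 by rewrite divr_gt0.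
set PN := sval (hahn nu).
have [[mP _] _ _ PN0] := svalP (hahn nu).
have [g [cg g01 gP]] := L1_approximation (variation_measure nu) mP e20.
pose p : {finite_measure set (time T0) -> \bar R} := jordan_pos (svalP (hahn nu)).
pose q : {finite_measure set (time T0) -> \bar R} := jordan_neg (svalP (hahn nu)).
have gi (mu : {finite_measure set (time T0) -> \bar R}) :
  mu.-integrable setT (EFin \o g) by exact: continuous_integrable.
have Pi (mu : {finite_measure set (time T0) -> \bar R}) :
  mu.-integrable setT (EFin \o \1_(PN.1)) by exact: integrable_indic.
have gPi (mu : {finite_measure set (time T0) -> \bar R}) :
    mu.-integrable setT (EFin \o (fun t => `|g t - \1_(PN.1) t|)).
  apply: (integrable_norm (f := fun t => g t - \1_(PN.1) t)) => //.
  rewrite (_ : _ \o _ = (EFin \o g) \- (EFin \o \1_(PN.1)))%E.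
    by apply: integrableB => //; [exact: gi|exact: Pi].
  by apply/funext => t /=; rewrite EFinB.
have pP : fine (p PN.1) = fine (p setT).
  have pE A : p A = jordan_pos (svalP (hahn nu)) A by [].
  congr fine; rewrite !pE !jordan_posE !cjordan_posE /crestr0 !mem_set//.
  by rewrite /crestr setTI setIid.
have qP : fine (q PN.1) = 0.
  have qE A : q A = jordan_neg (svalP (hahn nu)) A by [].
  rewrite qE jordan_negE cjordan_negE /crestr0 mem_set//.
  by rewrite /crestr PN0 charge0 oppe0.
have gpq : \int[p]_t `|g t - \1_(PN.1) t| + \int[q]_t `|g t - \1_(PN.1) t| <= e / 2.
  apply: le_trans gP; rewrite /Rintegral.
  rewrite (_ : (\int[variation_measure nu]_t _)%E =
    (\int[p]_t (`|g t - \1_(PN.1) t|)%:E + \int[q]_t (`|g t - \1_(PN.1) t|)%:E)%E).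
    have fin (mu : {finite_measure set (time T0) -> \bar R}) :
        (\int[mu]_t (`|g t - \1_(PN.1) t|)%:E)%E \is a fin_num.
      by apply: integrable_fin_num; [exact: measurableT|exact: (gPi mu)].
    by rewrite (fineD (fin p) (fin q)).
  apply: ge0_integral_measure_add => //.
  exact: (measurable_int _ (gPi p)).
have dist (mu : {finite_measure set (time T0) -> \bar R}) :
    `|\int[mu]_t g t - fine (mu PN.1)| <= \int[mu]_t `|g t - \1_(PN.1) t|.
  rewrite [in X in `|_ - X|](_ : fine _ = \int[mu]_t \1_(PN.1) t); last first.
    by rewrite /Rintegral integral_indic// setIT.
  rewrite -(RintegralB measurableT (gi mu) (Pi mu)); apply: le_normr_Rintegral => //.
  rewrite (_ : _ \o _ = (EFin \o g) \- (EFin \o \1_(PN.1)))%E.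
    by apply: integrableB => //; [exact: gi|exact: Pi].
  by apply/funext => t /=; rewrite EFinB.
have cG : continuous (fun t => 2 * g t - 1).
  move=> t; apply: (@continuousB R R (time T0) (fun t => 2 * g t) (cst 1)).
    apply: (@continuousM R (time T0) (cst 2) g); first exact: cst_continuous.
    exact: cg.
  exact: cst_continuous.
exists (fun t => 2 * g t - 1); split => //.
  by move=> t; have /andP[] := g01 t; rewrite ler_norml => *; lra.
have -> : charge_integral nu (fun t => 2 * g t - 1) =
    (2 * \int[p]_t g t - fine (p setT)) - (2 * \int[q]_t g t - fine (q setT)).
  have E (mu : {finite_measure set (time T0) -> \bar R}) :
      \int[mu]_t (2 * g t - 1) = 2 * \int[mu]_t g t - fine (mu setT).
    rewrite RintegralB//; last exact: finite_measure_integrable_cst.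
      rewrite RintegralZl//; last exact: (gi mu).
      by rewrite Rintegral_cst// mul1r.
    rewrite (_ : _ \o _ = (fun t => 2%:E * (g t)%:E)%E); first by apply: integrableZl => //; exact: gi.
    by apply/funext => t /=; rewrite EFinM.
  by congr (_ - _); exact: E.
have -> : Defs.total_variation nu = fine (p setT) + fine (q setT).
  by rewrite /Defs.total_variation /charge_variation/= fineD// fin_num_measure.
have := dist p; have := dist q; rewrite pP qP subr0 !ler_norml.
move: gpq; move: (\int[p]_t `|_|) (\int[q]_t `|_|) => a b ab /andP[h1 h2] /andP[h3 h4].
lra.
Qed.

Definition hat_variation n nu : R :=
  \sum_(i < (2 ^ n).+1) `|charge_integral nu (time_hat n i)|.

Lemma charge_integral_interp nu n (x : nat -> R) :
  charge_integral nu (fun t => interp n x (coord t)) =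
  \sum_(i < (2 ^ n).+1) x i * charge_integral nu (time_hat n i).
Proof.
apply: (charge_integral_sum nu _ (fun i : 'I_(2 ^ n).+1 => x i)
  (g := fun i => time_hat n i)) => i; exact: time_hat_continuous.
Qed.

Definition sign_path n nu : time T0 -> R := fun t =>
  interp n (fun i => Num.sg (charge_integral nu (time_hat n i))) (coord t).

Lemma sign_path_le1 n nu t : `|sign_path n nu t| <= 1.
Proof.
apply: interp_bound; first by have /andP[] := coord_itv t.
by move=> i _; rewrite normr_sg lern1 leq_b1.
Qed.

Lemma charge_integral_sign_path n nu :
  charge_integral nu (sign_path n nu) = hat_variation n nu.
Proof.
rewrite charge_integral_interp; apply: eq_bigr => i _.
by rewrite -normrEsg.
Qed.

Lemma hat_variation_le n nu : hat_variation n nu <= Defs.total_variation nu.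
Proof.
rewrite -charge_integral_sign_path (le_trans (ler_norm _))//.
rewrite -[leRHS]mul1r; apply: charge_integral_le; last exact: sign_path_le1.
exact: interp_continuous.
Qed.

(** Interpolation changes little the integral of a function which almost attains
    the total variation, and the integral of the interpolation is at most the
    sum over the hats. This makes the total variation of a random measure
    measurable. *)
Lemma hat_variation_cvg nu :
  hat_variation n nu @[n --> \oo] --> Defs.total_variation nu.
Proof.
apply/cvgrPdist_le => e e0; set tv := Defs.total_variation nu.
have tv0 : 0 <= tv by exact: total_variation_ge0.
have e20 : 0 < e / 2 by rewrite divr_gt0.
have [g [cg g1 ge]] := total_variation_approx nu e20.
have d0 : 0 < e / 2 / (tv + 1) by rewrite divr_gt0// ltr_wpDl.
have := interp_cvg cg d0; apply: filterS => n hn.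
rewrite ger0_norm ?subr_ge0 ?hat_variation_le//.
have h1 : `|charge_integral nu (fun t => interp n (sample n g) (coord t) - g t)| <=
    e / 2 / (tv + 1) * tv.
  apply: charge_integral_le hn => t.
  apply: (@continuousB R R (time T0) (fun t => interp n (sample n g) (coord t)) g).
    exact: interp_continuous.
  exact: cg.
have h2 : e / 2 / (tv + 1) * tv <= e / 2.
  rewrite -mulrA ler_piMr ?(ltW e20)// mulrC ler_pdivrMr ?mul1r ?lerDl//.
  by rewrite ltr_wpDl.
have h3 : charge_integral nu (fun t => interp n (sample n g) (coord t)) <=
    hat_variation n nu.
  rewrite charge_integral_interp; apply: ler_sum => i _.
  rewrite (le_trans (ler_norm _))// normrM ler_piMl//; exact: g1.
move: h1; rewrite charge_integralB//; last exact: interp_continuous.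
rewrite ler_norml => /andP[h4 _].
rewrite -/tv in ge.
move: ge h2 h3 h4; move: (e / 2 / _ * _) => a *; lra.
Qed.

End variation_by_hats.

(** * Hoelder's inequality for an admissible function and its polar *)

Section integral_bounds.
Context d (X : measurableType d) (R : realType) (mu : {measure set X -> \bar R}).

Lemma integral_lim_le (f_ : nat -> X -> R) (f : X -> R) (c : \bar R) :
  (forall n, measurable_fun setT (f_ n)) -> (forall n x, 0 <= f_ n x) ->
  (forall x, f_ n x @[n --> \oo] --> f x) ->
  (forall n, (\int[mu]_x (f_ n x)%:E <= c)%E) -> (\int[mu]_x (f x)%:E <= c)%E.
Proof.
move=> mf f0 cf fc.
have -> : (\int[mu]_x (f x)%:E)%E = (\int[mu]_x limn_einf (fun n => (f_ n x)%:E))%E.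
  apply: eq_integral => x _; apply/esym; apply: (cvg_limn_einf_sup _).1.
  by apply/fine_cvgP; split; [exact: nearW|exact: cf].
apply: le_trans (fatou mu measurableT _ _) _.
- by move=> n; exact/measurable_EFinP.
- by move=> n x _; rewrite lee_fin.
rewrite limn_einf_lim; apply: lime_le; first exact: is_cvg_einfs.
apply: nearW => n; apply: le_trans (fc n); apply: ereal_inf_lbound.
by exists n => /=.
Qed.

End integral_bounds.

Section random_variables.
Context d (Omega : measurableType d) (R : realType) (P : probability Omega R).
Implicit Types (xi eta : Omega -> R) (p : (Omega -> R) -> \bar R).

Let P1 : (0 < P [set: Omega])%E.
Proof. by rewrite probability_setT. Qed.

Lemma Lfun_bounded xi : xi \in Lfun P +oo%E ->
  exists2 M : R, 0 <= M & {ae P, forall w, `|xi w| <= M}.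
Proof.
move=> /andP[_ /[!inE]/=]; rewrite /finite_norm unlock P1 => /ess_supr_bounded[M hM].
exists (Num.max 0 M); first by rewrite le_max lexx.
by apply: filterS hM => w h; rewrite le_max h orbT.
Qed.

Lemma bounded_Lfun xi (M : R) : measurable_fun setT xi ->
  (forall w, `|xi w| <= M) -> xi \in Lfun P +oo%E.
Proof.
move=> mx xM; apply/andP; split; rewrite inE//= /finite_norm unlock P1.
apply: (@le_lt_trans _ _ M%:E); last exact: ltry.
by apply/ess_supP; apply: nearW => w /=; rewrite lee_fin.
Qed.

Lemma Loo_mul_L1 xi eta : xi \in Lfun P +oo%E -> eta \in Lfun P 1 ->
  xi \* eta \in Lfun P 1.
Proof.
move=> hxi heta; have [M M0 xM] := Lfun_bounded hxi.
have mxi := Lfun_measurable hxi; have meta := Lfun_measurable heta.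
have mprod : measurable_fun setT (xi \* eta) by exact: measurable_funM.
apply/Lfun1_integrable/integrableP; split; first exact/measurable_EFinP.
have /Lfun1_integrable ieta := heta.
have : P.-integrable setT (fun w => M%:E * (eta w)%:E)%E by exact: integrableZl.
move=> /integrableP[_]; apply: le_lt_trans.
apply: ae_ge0_le_integral => //.
- by apply: measurableT_comp => //; exact/measurable_EFinP.
- apply: measurableT_comp => //; apply: measurable_funeM.
  exact/measurable_EFinP.
- apply: filterS xM => w h _ /=.
  by rewrite lee_fin normrM normrM ler_wpM2r// (ger0_norm M0).
Qed.

Lemma expectationE xi : ('E_P[xi] = \int[P]_w (xi w)%:E)%E.
Proof. by rewrite unlock. Qed.

Lemma polar_ge0 p eta : admissible P p -> (0 <= polar P p eta)%E.
Proof.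
move=> ap; apply: ereal_sup_ubound; exists 0.
  split; first by apply: Lfun0; rewrite leey.
  by rewrite (admissible0 ap).
rewrite expectationE (eq_integral (cst 0%E)); first by rewrite integral0.
by move=> w _; rewrite /= mul0r.
Qed.

Lemma admissible_Loo p xi : admissible P p -> xi \in Lfun P +oo%E ->
  (p xi < +oo)%E.
Proof.
move=> ap hxi; have h1 := Loo_sub_L1 hxi.
have [c c0 /(_ _ h1)[_]] := admissible_bounds ap.
move=> /le_lt_trans; apply.
have /andP[_ /[!inE]/= fin] := hxi.
by rewrite lte_mul_pinfty// lee_fin ltW.
Qed.

Lemma admissible_eq0 p xi : admissible P p -> xi \in Lfun P 1 -> p xi = 0%E ->
  {ae P, forall w, xi w = 0}.
Proof.
move=> ap h1 p0; have [c c0 /(_ _ h1)[+ _]] := admissible_bounds ap.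
rewrite p0 => le0.
have N0 : 'N[P]_1[EFin \o xi]%E = 0%E.
  apply/eqP; rewrite eq_le Lnorm_ge0 andbT.
  by move: le0; rewrite pmule_rle0// lte_fin invr_gt0.
have : EFin \o xi = cst 0%E %[ae P].
  apply: Lnorm_eq0_eq0 N0; rewrite ?lte01//.
  by apply/measurable_EFinP; exact: Lfun_measurable h1.
by apply: filterS => w /(_ I) [].
Qed.

(** By homogeneity xi can be normalized to p xi = 1, unless p xi = 0, and then
    xi vanishes almost surely. *)
Lemma hoelder_bounded p xi eta : admissible P p -> xi \in Lfun P +oo%E ->
  eta \in Lfun P 1 -> ('E_P[xi \* eta] <= p xi * polar P p eta)%E.
Proof.
move=> ap hxi heta; have h1 := Loo_sub_L1 hxi.
have fin : p xi \is a fin_num.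
  by rewrite ge0_fin_numE ?admissible_Loo// (admissible_ge0 ap).
have [p0|p0] := eqVneq (p xi) 0%E.
  rewrite p0 mul0e expectationE (ae_eq_integral (cst 0%E))//.
  - by rewrite integral0.
  - apply/measurable_EFinP; apply: measurable_funM;
      [exact: Lfun_measurable h1|exact: Lfun_measurable heta].
  - apply: filterS (admissible_eq0 ap h1 p0) => w h _ /=.
    by rewrite h mul0r.
have r0 : 0 < fine (p xi).
  by rewrite -lte_fin fineK// lt_neqAle eq_sym p0 (admissible_ge0 ap).
pose r := fine (p xi); have rE : p xi = r%:E by rewrite /r fineK.
have hz : r^-1 *: xi \in Lfun P +oo%E by apply: LfunZ; rewrite ?leey.
have pz : (p (r^-1 *: xi) <= 1)%E.
  rewrite (admissibleZ _ ap)// gtr0_norm ?invr_gt0// rE -EFinM mulVf ?gt_eqF//.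
have : ('E_P[(r^-1 *: xi) \* eta] <= polar P p eta)%E.
  by apply: ereal_sup_ubound; exists (r^-1 *: xi).
have /Lfun1_integrable ip := Loo_mul_L1 hxi heta.
rewrite !expectationE (eq_integral (fun w => (r^-1)%:E * (xi w * eta w)%:E)%E).
  by rewrite integralZl// lee_pdivrMl// rE.
by move=> w _; rewrite -EFinM mulrA.
Qed.

(** Truncation of xi and Fatou's lemma reduce this to bounded xi. *)
Lemma hoelder_ge0 p xi eta : admissible P p -> xi \in Lfun P 1 ->
  eta \in Lfun P 1 -> (forall w, 0 <= xi w) -> (forall w, 0 <= eta w) ->
  (\int[P]_w (xi w * eta w)%:E <= p xi * polar P p eta)%E.
Proof.
move=> ap hxi heta xi0 eta0.
have mxi := Lfun_measurable hxi; have meta := Lfun_measurable heta.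
pose xn n w : R := Num.min (xi w) n%:R.
have mxn n : measurable_fun setT (xn n) by apply: measurable_minr.
have xn0 n w : 0 <= xn n w by rewrite le_min xi0 ler0n.
have hxn n : xn n \in Lfun P +oo%E.
  apply: (bounded_Lfun (M := n%:R)) => // w.
  by rewrite ger0_norm// ge_min lexx orbT.
apply: (@integral_lim_le _ _ _ P (fun n w => xn n w * eta w)).
- by move=> n; exact: measurable_funM.
- by move=> n w; rewrite mulr_ge0.
- move=> w; apply: cvgMr_tmp; apply: cvg_near_cst.
  exists (Num.truncn (xi w)).+1 => // n /= hn; rewrite /xn min_l//.
  by rewrite (le_trans (ltW (truncnS_gt (xi w))))// ler_nat.
- move=> n; have := hoelder_bounded ap (hxn n) heta.
  rewrite expectationE => /le_trans; apply; apply: lee_wpmul2r.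
    exact: polar_ge0.
  apply: (admissible_mono ap) => //; first exact: Loo_sub_L1.
  by apply: nearW => w; rewrite !ger0_norm// ge_min lexx.
Qed.

Lemma polar_le p p' eta : {in Lfun P 1, forall xi, (p xi <= p' xi)%E} ->
  (polar P p' eta <= polar P p eta)%E.
Proof.
move=> pp'; apply: le_ereal_sup => _ [xi [hxi pxi] <-]; exists xi => //.
by split => //; apply: le_trans pxi; exact/pp'/Loo_sub_L1.
Qed.

End random_variables.

(** * The pairing of processes and random measures *)

Lemma measurable_sgr (R : realType) : measurable_fun setT (@Num.sg R).
Proof.
apply: nondecreasing_measurable => // x y xy.
have [x0|x0|x0] := ltgtP x 0.
- rewrite (ltr0_sg x0); have [y0|y0|->] := ltgtP y 0.
  + by rewrite (ltr0_sg y0).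
  + by rewrite (gtr0_sg y0); lra.
  + by rewrite sgr0; lra.
- by rewrite (gtr0_sg x0) gtr0_sg// (lt_le_trans x0).
- rewrite x0 sgr0; move: xy; rewrite x0 le_eqVlt => /predU1P[<-|y0].
    by rewrite sgr0.
  by rewrite gtr0_sg.
Qed.

Section path_integrals.
Context d (Omega : measurableType d) (R : realType) (P : probability Omega R).
Context (T : \bar R) (T0 : (0 < T)%E).
Local Notation M := (charge (time T0) R).
Implicit Types (y : Omega -> time T0 -> R) (u v : Omega -> M).

Definition measurable_charge u := forall A : set (time T0), measurable A ->
  measurable_fun setT (fun w => u w A).

Lemma measurable_section y t : continuous_process y ->
  measurable_fun setT (fun w => y w t).
Proof. by move=> [_ my]; exact: (measurableT_comp my (pair2_measurable t)). Qed.

Lemma measurable_path_integral y u : continuous_process y ->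
  measurable_charge u -> measurable_fun setT (path_integral y u).
Proof.
move=> cy mu; have [c _] := cy.
apply: (measurable_fun_cvg (h := fun n w => riemann_sum (u w) (y w) n)).
  move=> n; apply: measurable_sum => i.
  apply: measurable_funM; first exact: measurable_section.
  by apply: measurableT_comp => //; apply: mu; exact: measurable_cell.
move=> w _; exact: charge_riemann_cvg.
Qed.

Lemma continuous_process_cst (g : time T0 -> R) : continuous g ->
  continuous_process (fun _ : Omega => g).
Proof.
move=> cg; split; first by [].
by apply: (measurableT_comp (f := g)) => //; exact: continuous_measurable_time.
Qed.

Lemma measurable_hat_integral u n i : measurable_charge u ->
  measurable_fun setT (fun w => charge_integral (u w) (time_hat n i)).
Proof.
move=> mu; apply: (measurable_path_integral (y := fun _ => time_hat n i)) => //.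
by apply: continuous_process_cst; exact: time_hat_continuous.
Qed.

Lemma measurable_variation u : measurable_charge u ->
  measurable_fun setT (variation_process u).
Proof.
move=> mu; apply: (measurable_fun_cvg (h := fun n w => hat_variation n (u w))).
  move=> n; apply: measurable_sum => i.
  by apply: measurableT_comp => //; exact: measurable_hat_integral.
move=> w _; exact: hat_variation_cvg.
Qed.

Lemma path_integral_le y u w : continuous_process y ->
  `|path_integral y u w| <= norm_process y w * variation_process u w.
Proof.
move=> [cy _]; apply: charge_integral_le; first exact: cy.
by move=> t; exact: path_norm_ub.
Qed.

Lemma norm_process_ge0 y w : continuous_process y -> 0 <= norm_process y w.
Proof. by move=> [cy _]; exact: path_norm_ge0. Qed.

Lemma variation_process_ge0 u w : 0 <= variation_process u w.
Proof. exact: total_variation_ge0. Qed.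

Lemma continuous_process_interp n (x : nat -> Omega -> R) :
  (forall i, measurable_fun setT (x i)) ->
  continuous_process (fun w (t : time T0) => interp n (x ^~ w) (coord t)).
Proof.
move=> mx; split; first by move=> w; exact: interp_continuous.
apply: measurable_sum => i; apply: measurable_funM.
  by apply: measurableT_comp.
apply: (measurableT_comp (f := @time_hat R T T0 n i)) => //.
by apply: continuous_measurable_time; exact: time_hat_continuous.
Qed.

Lemma continuous_processM (x : Omega -> R) y : measurable_fun setT x ->
  continuous_process y -> continuous_process (fun w t => x w * y w t).
Proof.
move=> mx [cy my]; split.
  move=> w t; apply: (@continuousM R (time T0) (cst (x w)) (y w)); last exact: cy.
  exact: cst_continuous.
by apply: measurable_funM => //; exact: measurableT_comp.
Qed.

Lemma norm_processM (x : Omega -> R) y w : continuous_process y ->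
  norm_process (fun w t => x w * y w t) w = `|x w| * norm_process y w.
Proof. by move=> [cy _]; exact: path_normZ. Qed.

Lemma charge_integralZ (nu : M) (a : R) (g : time T0 -> R) : continuous g ->
  charge_integral nu (fun t => a * g t) = a * charge_integral nu g.
Proof.
move=> cg.
have := charge_integral_sum nu [:: tt] (fun=> a) (g := fun=> g) (fun=> cg).
by rewrite big_seq1; under [in X in X -> _]eq_fun do rewrite big_seq1.
Qed.

(** For each outcome the integral is at most the norm of y times the variation of
    u, so that this is Hoelder's inequality for these two variables. *)
Lemma pairing_abs_le p y u : admissible P p -> L1C P y -> L1M P u ->
  (\int[P]_w `|path_integral y u w|%:E <=
   p (norm_process y) * polar P p (variation_process u))%E.
Proof.
move=> ap [cy hy] [mu hu].
apply: le_trans (hoelder_ge0 ap hy hu _ _).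
- apply: ge0_le_integral => //.
  + by apply/measurable_EFinP; apply: measurableT_comp => //; exact: measurable_path_integral.
  + by apply/measurable_EFinP; apply: measurable_funM;
      [exact: Lfun_measurable hy|exact: Lfun_measurable hu].
  + by move=> w _; rewrite lee_fin; exact: path_integral_le.
- by move=> w; exact: norm_process_ge0.
- by move=> w; exact: variation_process_ge0.
Qed.

Lemma pairing_le p y u : admissible P p -> L1C P y -> L1M P u ->
  (pairing P y u <= p (norm_process y) * polar P p (variation_process u))%E.
Proof.
move=> ap hy hu; apply: le_trans (pairing_abs_le ap hy hu).
rewrite /pairing expectationE (le_trans (lee_abs _))//.
apply: le_abse_integral => //; apply/measurable_EFinP.
by apply: measurable_path_integral; [case: hy|case: hu].
Qed.

Lemma pairing_integrable p y u : admissible P p -> L1C P y -> L1M P u ->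
  (p (norm_process y) * polar P p (variation_process u) < +oo)%E ->
  path_integral y u \in Lfun P 1.
Proof.
move=> ap hy hu fin; apply/Lfun1_integrable/integrableP; split.
  by apply/measurable_EFinP; apply: measurable_path_integral; [case: hy|case: hu].
by apply: le_lt_trans fin; exact: (pairing_abs_le ap hy hu).
Qed.

(** The interpolations of the signs of the masses of the hats are continuous paths
    whose integrals tend to the total variation of u w, and they are measurable
    in w. Their products with |xi| are bounded processes. *)
Lemma polar_le_sup_pairing p u : admissible P p -> L1M P u ->
  (polar P p (variation_process u) <= ereal_sup [set pairing P y u | y in
    [set y | LooC P y /\ p (norm_process y) <= 1]])%E.
Proof.
move=> ap [mu hu]; apply: ge_ereal_sup => _ [xi [hxi pxi] <-].
set S := ereal_sup _.
have mxi := Lfun_measurable hxi.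
pose z n w (t : time T0) := sign_path n (u w) t.
have cz n : continuous_process (z n).
  have := @continuous_process_interp n (fun i w =>
    Num.sg (charge_integral (u w) (time_hat n i))).
  apply => i.
  by apply: measurableT_comp; [exact: measurable_sgr|exact: measurable_hat_integral].
pose y n w t := `|xi w| * z n w t.
have cy n : continuous_process (y n).
  by apply: continuous_processM => //; exact: measurableT_comp.
have ny n w : norm_process (y n) w <= `|xi w|.
  rewrite norm_processM// normr_id ler_piMr//.
  by apply: path_norm_le => t; exact: sign_path_le1.
have hy n : norm_process (y n) \in Lfun P +oo%E.
  apply: (@Lfun_dominated _ _ _ P +oo%E _ xi) => //; first by rewrite leey.
    exact: measurable_norm_process.
  by move=> w; rewrite ger0_norm// norm_process_ge0.
have iy n w : path_integral (y n) u w = `|xi w| * hat_variation n (u w).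
  rewrite -charge_integral_sign_path; apply: charge_integralZ.
  exact: interp_continuous.
have hv0 n w : 0 <= hat_variation n (u w) by rewrite sumr_ge0.
apply: (@le_trans _ _ (\int[P]_w (`|xi w| * variation_process u w)%:E)%E).
  rewrite expectationE; apply: (le_trans (lee_abs _)).
  apply: (le_trans (le_abse_integral _ _ _)) => //.
    by apply/measurable_EFinP; apply: measurable_funM => //; exact: Lfun_measurable hu.
  apply: ge0_le_integral => //.
  - apply/measurable_EFinP; apply: measurableT_comp => //.
    by apply: measurable_funM => //; exact: Lfun_measurable hu.
  - apply/measurable_EFinP; apply: measurable_funM.
      exact: measurableT_comp.
    exact: Lfun_measurable hu.
  - move=> w _; rewrite lee_fin normrM (ger0_norm (variation_process_ge0 _ _))//.
apply: (@integral_lim_le _ _ _ P (fun n w => path_integral (y n) u w)).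
- by move=> n; exact: measurable_path_integral.
- by move=> n w; rewrite iy mulr_ge0.
- move=> w; under eq_fun do rewrite iy.
  by apply: cvgMl_tmp; exact: hat_variation_cvg.
- move=> n; rewrite -expectationE; apply: ereal_sup_ubound; exists (y n) => //.
  split => //; apply: le_trans pxi; apply: (admissible_mono ap).
  + exact: Loo_sub_L1.
  + exact: Loo_sub_L1.
  + by apply: nearW => w; rewrite ger0_norm// norm_process_ge0.
Qed.

End path_integrals.

(** * The pairing on Y(C) and U(M) *)

Section duality.
Context d (Omega : measurableType d) (R : realType) (P : probability Omega R).
Context (T : \bar R) (T0 : (0 < T)%E) (pp : seminorm_seq P).
Local Notation M := (charge (time T0) R).
Implicit Types (y : Omega -> time T0 -> R) (u v : Omega -> M).

Let ap n : admissible P (pp n) := sseq_admissible pp n.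

Lemma Loo_Yspace xi : xi \in Lfun P +oo%E -> Yspace pp xi.
Proof.
move=> hxi; split.
  split; first exact: Loo_sub_L1.
  by move=> n; exact: admissible_Loo.
move=> n e e0; exists xi => // i _.
by rewrite subrr (admissible0 (ap i)) lte_fin.
Qed.

Lemma LooC_L1C y : LooC P y -> L1C P y.
Proof. by move=> [cy hy]; split => //; exact: Loo_sub_L1. Qed.

Definition YCmk y (hy : L1C P y /\ Yspace pp (norm_process y)) : YCpre T0 pp :=
  exist (fun y => y \in YCfun pp) y (asboolT hy).

Lemma YCpreP (y : YCpre T0 pp) :
  L1C P (val y) /\ Yspace pp (norm_process (val y)).
Proof. by case: y => y /= /asboolP. Qed.

Lemma LooC_YCfun y : LooC P y -> L1C P y /\ Yspace pp (norm_process y).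
Proof. by move=> hy; split; [exact: LooC_L1C|apply: Loo_Yspace; case: hy]. Qed.

Lemma pairing_le_polar n y u : L1C P y -> L1M P u ->
  (pp n (norm_process y) <= 1)%E ->
  (pairing P y u <= polar P (pp n) (variation_process u))%E.
Proof.
move=> hy hu py; apply: (le_trans (pairing_le (ap n) hy hu)).
rewrite -[leRHS]mul1e; apply: lee_wpmul2r => //; exact: polar_ge0.
Qed.

Lemma polar_variationE n u : L1M P u -> polar P (pp n) (variation_process u) =
  ereal_sup [set pairing P y u | y in
    [set y | LooC P y /\ (pp n (norm_process y) <= 1)%E]].
Proof.
move=> hu; apply/eqP; rewrite eq_le polar_le_sup_pairing//=.
apply: ge_ereal_sup => _ [y [hy py] <-].
by apply: pairing_le_polar => //; exact: LooC_L1C.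
Qed.

Lemma polar_variation_YCE n u : L1M P u ->
  polar P (pp n) (variation_process u) =
  ereal_sup [set pairing P (val y) u | y in
    [set y : YCpre T0 pp | (pp n (norm_process (val y)) <= 1)%E]].
Proof.
move=> hu; apply/eqP; rewrite eq_le; apply/andP; split.
  rewrite polar_variationE//; apply: le_ereal_sup => _ [y [hy py] <-].
  by exists (YCmk (LooC_YCfun hy)).
apply: ge_ereal_sup => _ [y py <-].
by apply: pairing_le_polar => //; have [] := YCpreP y.
Qed.

Lemma path_integral_L1 (y : YCpre T0 pp) u : UM pp u ->
  path_integral (val y) u \in Lfun P 1.
Proof.
move=> [hu [_ [n fin]]]; have [hy [[_ dy] _]] := YCpreP y.
apply: (pairing_integrable (ap n)) => //.
have := dy n; have : (0 <= pp n (norm_process (val y)))%E.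
  by apply: (admissible_ge0 (ap n)); case: hy.
case: (pp n _) => // r r0 _; exact: lte_mul_pinfty.
Qed.

Lemma pairing_fin_num (y : YCpre T0 pp) u : UM pp u ->
  pairing P (val y) u \is a fin_num.
Proof.
move=> hu; rewrite /pairing expectationE.
by apply: integrable_fin_num => //; apply/Lfun1_integrable; exact: path_integral_L1.
Qed.

Lemma path_integral_lin (a : R) y u v w : continuous_process y ->
  path_integral y (lin_comb a u v) w =
  a * path_integral y u w + path_integral y v w.
Proof. by move=> [cy _]; exact: charge_integral_lin. Qed.

Lemma variation_lin_comb (a : R) u v w :
  variation_process (lin_comb a u v) w <=
  `|a| * variation_process u w + variation_process v w.
Proof.
apply/ler_addgt0Pr => e e0.
have [g [cg g1 ge]] := total_variation_approx (lin_comb a u v w) e0.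
have hb (nu : M) : `|charge_integral nu g| <= Defs.total_variation nu.
  by rewrite -[leRHS]mul1r; exact: charge_integral_le.
have : charge_integral (lin_comb a u v w) g <=
    `|a| * variation_process u w + variation_process v w.
  rewrite charge_integral_lin// lerD//.
    by rewrite (le_trans (ler_norm _))// normrM ler_wpM2l// hb.
  by rewrite (le_trans (ler_norm _))// hb.
by move: ge; rewrite /variation_process; lra.
Qed.

Lemma measurable_charge_lin_comb (a : R) u v : measurable_charge u ->
  measurable_charge v -> measurable_charge (lin_comb a u v).
Proof.
move=> mu mv A mA; apply: emeasurable_funD; last exact: mv.
by apply: measurable_funeM; exact: mu.
Qed.

(** Polars decrease along the sequence of seminorms, so that u and v have finite
    polars at a common index; there the polar is subadditive. *)
Lemma UM_lin_comb (a : R) u v : UM pp u -> UM pp v -> UM pp (lin_comb a u v).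
Proof.
move=> [[mu hu] [_ [n finu]]] [[mv hv] [_ [m finv]]].
have mw : measurable_charge (lin_comb a u v) by exact: measurable_charge_lin_comb.
have W0 w : 0 <= `|a| * variation_process u w + variation_process v w.
  by rewrite addr_ge0 ?mulr_ge0// variation_process_ge0.
have hw : variation_process (lin_comb a u v) \in Lfun P 1.
  apply: (@Lfun_dominated _ _ _ P 1%E _ (`|a| *: variation_process u + variation_process v)) => //.
  - exact: measurable_variation.
  - by apply: LfunD => //; exact: LfunZ.
  - move=> w; rewrite ger0_norm ?variation_process_ge0// ger0_norm.
      exact: variation_lin_comb.
    exact: W0.
split; first by split.
split => //; exists (maxn n m).
have lep k l eta : (k <= l)%N -> (polar P (pp l) eta <= polar P (pp k) eta)%E.
  by move=> kl; apply: polar_le => xi hxi; exact: sseq_le.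
set N := maxn n m.
have finu' : (polar P (pp N) (variation_process u) < +oo)%E.
  by apply: le_lt_trans finu; apply: lep; rewrite leq_maxl.
have finv' : (polar P (pp N) (variation_process v) < +oo)%E.
  by apply: le_lt_trans finv; apply: lep; rewrite leq_maxr.
apply: (@le_lt_trans _ _ (`|a|%:E * polar P (pp N) (variation_process u) +
    polar P (pp N) (variation_process v))%E); last first.
  by rewrite lte_add_pinfty// lte_mul_pinfty// lee_fin.
apply: ge_ereal_sup => _ [xi [hxi pxi] <-].
have mxi := Lfun_measurable hxi.
have hxi1 := Loo_sub_L1 hxi.
have nxi : Num.norm \o xi \in Lfun P 1 by exact: Lfun_norm.
have pnxi : (pp N (Num.norm \o xi) <= 1)%E.
  apply: le_trans pxi; apply: (admissible_mono (ap N)) => //.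
  by apply: nearW => w /=; rewrite normr_id.
have key (z : Omega -> M) : measurable_charge z -> variation_process z \in Lfun P 1 ->
    (\int[P]_w (`|xi w| * variation_process z w)%:E <=
     polar P (pp N) (variation_process z))%E.
  move=> mz hz; apply: (le_trans (hoelder_ge0 (ap N) nxi hz _ _)).
  - by move=> w /=.
  - by move=> w; exact: variation_process_ge0.
  rewrite -[leRHS]mul1e; apply: lee_wpmul2r => //; exact: polar_ge0.
have mm (z : Omega -> M) : variation_process z \in Lfun P 1 ->
    measurable_fun setT (fun w => `|xi w| * variation_process z w).
  move=> hz; apply: measurable_funM; first exact: measurableT_comp.
  exact: Lfun_measurable hz.
rewrite expectationE; apply: (le_trans (lee_abs _)).
have mxw : measurable_fun setT (fun w => xi w * variation_process (lin_comb a u v) w).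
  by apply: measurable_funM => //; exact: Lfun_measurable hw.
apply: (le_trans (le_abse_integral P measurableT _)).
  exact/measurable_EFinP.
apply: (@le_trans _ _ (\int[P]_w (`|a|%:E * (`|xi w| * variation_process u w)%:E +
    (`|xi w| * variation_process v w)%:E))%E).
  apply: ge0_le_integral => //.
  - by apply/measurable_EFinP; exact: measurableT_comp.
  - apply: emeasurable_funD; last exact/measurable_EFinP/mm.
    by apply: measurable_funeM; exact/measurable_EFinP/mm.
  - move=> w _; rewrite /= -EFinM -EFinD lee_fin normrM.
    rewrite (ger0_norm (variation_process_ge0 _ _)) mulrCA -mulrDr ler_wpM2l//.
    exact: variation_lin_comb.
have p0 (z : Omega -> M) w : (0 <= (`|xi w| * variation_process z w)%:E)%E.
  by rewrite lee_fin mulr_ge0// variation_process_ge0.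
rewrite ge0_integralD//; last 3 first.
- by move=> w _; apply: mule_ge0; [rewrite lee_fin|exact: p0].
- by apply: measurable_funeM; exact/measurable_EFinP/mm.
- exact/measurable_EFinP/mm.
rewrite ge0_integralZl_EFin//; last exact/measurable_EFinP/mm.
apply: leeD; last exact: key.
by apply: lee_wpmul2l; [rewrite lee_fin|exact: key].
Qed.

Lemma pairing_lin_comb (a : R) u v (y : YCpre T0 pp) : UM pp u -> UM pp v ->
  pairing P (val y) (lin_comb a u v) =
  (a%:E * pairing P (val y) u + pairing P (val y) v)%E.
Proof.
move=> hu hv; have [[cy _] _] := YCpreP y.
have /Lfun1_integrable iu := path_integral_L1 y hu.
have /Lfun1_integrable iv := path_integral_L1 y hv.
rewrite /pairing !expectationE -integralZl// -integralD//; last exact: integrableZl.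
by apply: eq_integral => w _; rewrite path_integral_lin// EFinD EFinM.
Qed.

Lemma ae_eq_pairing u v (y : YCpre T0 pp) : UM pp u -> UM pp v ->
  ae_eq_measure P u v -> pairing P (val y) u = pairing P (val y) v.
Proof.
move=> [[mu _] _] [[mv _] _] uv; have [[cy _] _] := YCpreP y.
rewrite /pairing !expectationE; apply: ae_eq_integral => //.
- by apply/measurable_EFinP; exact: measurable_path_integral.
- by apply/measurable_EFinP; exact: measurable_path_integral.
- apply: filterS uv => w h _; congr EFin.
  by apply: charge_integral_ext => //; case: cy.
Qed.

Lemma total_variation0 (nu : M) : Defs.total_variation nu = 0 ->
  forall A, measurable A -> nu A = 0%E.
Proof.
move=> tv0 A mA; apply/eqP; rewrite -abse_eq0 eq_le abse_ge0 andbT.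
apply: (@le_trans _ _ (charge_variation (svalP (hahn nu)) A)).
  exact: (abse_charge_variation (svalP (hahn nu))) mA.
apply: (@le_trans _ _ (charge_variation (svalP (hahn nu)) setT)).
  by rewrite /charge_variation /=; apply: leeD; apply: le_measure; rewrite ?inE.
move: tv0; rewrite /Defs.total_variation => h.
rewrite -[leLHS]fineK ?h//.
by rewrite /charge_variation/= fin_numD !fin_num_measure.
Qed.

(** The difference of u and v annihilates Y(C), so that its polar vanishes by
    polar_variation_YCE; Hoelder's inequality with the constant 1 shows that its
    variation has expectation 0. *)
Lemma pairing_injective u v : UM pp u -> UM pp v ->
  (forall y : YCpre T0 pp, pairing P (val y) u = pairing P (val y) v) ->
  ae_eq_measure P u v.
Proof.
move=> hu hv uv; pose z := lin_comb (-1) u v.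
have hz : UM pp z by exact: UM_lin_comb.
have z0 (y : YCpre T0 pp) : pairing P (val y) z = 0%E.
  rewrite pairing_lin_comb// uv EFinN mulN1e addeC subee//.
  exact: pairing_fin_num.
have [[mz hvz] _] := hz.
have vz0 : {ae P, forall w, variation_process z w = 0}.
  have : (\int[P]_w (1 * variation_process z w)%:E <= 0)%E.
    have h1 : (cst 1 : Omega -> R) \in Lfun P +oo%E.
      by apply: (@bounded_Lfun _ _ _ P (cst 1) 1) => // w; rewrite normr1.
    apply: (le_trans (hoelder_ge0 (ap 0) (Loo_sub_L1 h1) hvz _ _)) => //.
      by move=> w; exact: variation_process_ge0.
    rewrite (_ : polar _ _ _ = 0%E) ?mule0//.
    apply/eqP; rewrite eq_le polar_ge0// andbT polar_variation_YCE; last by case: hz.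
    by apply: ge_ereal_sup => _ [y _ <-]; rewrite z0.
  move=> le0.
  have mvz : measurable_fun setT (fun w => (variation_process z w)%:E).
    by apply/measurable_EFinP; exact: measurable_variation.
  have := (ae_eq_integral_abs P measurableT mvz).1.
  have -> : (\int[P]_w `|(variation_process z w)%:E|)%E = 0%E.
    apply/eqP; rewrite eq_le integral_ge0// andbT; apply: le_trans le0.
    apply: ge0_le_integral => //.
    - exact: measurableT_comp.
    - by apply/measurable_EFinP; apply: measurable_funM => //; exact: measurable_variation.
    - move=> w _; rewrite mul1r gee0_abs// lee_fin; exact: variation_process_ge0.
  move=> /(_ erefl); by apply: filterS => w /(_ I) [].
apply: filterS vz0 => w h A mA.
have : ((-1)%:E * u w A + v w A = 0)%E by exact: (total_variation0 h mA).
rewrite EFinN mulN1e => /eqP; rewrite addeC sube_eq ?fin_num_measure//.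
by rewrite add0e => /eqP.
Qed.

Lemma path_integral_linl (a : R) (x y : YCpre T0 pp) u w :
  path_integral (val (a *: x + y)) u w =
  a * path_integral (val x) u w + path_integral (val y) u w.
Proof.
have [[[cx _] _] _] := YCpreP x; have [[[cy _] _] _] := YCpreP y.
rewrite /path_integral.
have -> : val (a *: x + y) w = (fun t => val y w t - (- a) * val x w t).
  by apply/funext => t; rewrite mulNr opprK [RHS]addrC.
rewrite charge_integralB; last 2 first.
- exact: cy.
- move=> t; apply: (@continuousM R (time T0) (cst (- a)) (val x w)).
    exact: cst_continuous.
  exact: cx.
by rewrite charge_integralZ ?mulNr ?opprK 1?addrC//; exact: cx.
Qed.

Lemma pairing_linl (a : R) (x y : YCpre T0 pp) u : UM pp u ->
  pairing P (val (a *: x + y)) u =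
  (a%:E * pairing P (val x) u + pairing P (val y) u)%E.
Proof.
move=> hu.
have /Lfun1_integrable ix := path_integral_L1 x hu.
have /Lfun1_integrable iy := path_integral_L1 y hu.
rewrite /pairing !expectationE -integralZl// -integralD//; last exact: integrableZl.
by apply: eq_integral => w _; rewrite path_integral_linl EFinD EFinM.
Qed.

Lemma YCrepr_class (y : YCpre T0 pp) :
  {ae P, forall w, forall t, YCrepr (YCclass y) w t = val y w t}.
Proof.
by apply/YC_eqP; rewrite reprK.
Qed.

Lemma YCseminorm_class n (y : YCpre T0 pp) :
  YCseminorm n (YCclass y) = fine (pp n (norm_process (val y))).
Proof.
have [[_ y1] _] := YCpreP y; have [[_ r1] _] := YCreprP (YCclass y).
have eqn : {ae P, forall w, norm_process (YCrepr (YCclass y)) w =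
                            norm_process (val y) w}.
  by apply: filterS (YCrepr_class y) => w h; congr path_norm; apply/funext.
congr fine; apply/eqP; rewrite eq_le; apply/andP; split;
  by apply: (admissible_mono (ap n)) => //; apply: filterS eqn => w ->.
Qed.

Lemma pairing_repr (y : YCpre T0 pp) u : UM pp u ->
  pairing P (YCrepr (YCclass y)) u = pairing P (val y) u.
Proof.
move=> [[mu _] _]; rewrite /pairing !expectationE.
have [[cy _] _] := YCpreP y.
have [[cr _] _] := YCreprP (YCclass y).
apply: ae_eq_integral => //.
- by apply/measurable_EFinP; exact: measurable_path_integral.
- by apply/measurable_EFinP; exact: measurable_path_integral.
- apply: filterS (YCrepr_class y) => w h _; congr EFin.
  by rewrite /path_integral; congr charge_integral; apply/funext.
Qed.

Lemma pairing_seminorm_le n (y : YCpre T0 pp) u : UM pp u ->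
  (polar P (pp n) (variation_process u) < +oo)%E ->
  `|fine (pairing P (val y) u)| <=
  fine (pp n (norm_process (val y))) * fine (polar P (pp n) (variation_process u)).
Proof.
move=> hu fin; have [hu1 _] := hu; have [hy [[_ dy] _]] := YCpreP y.
have p0 : (0 <= pp n (norm_process (val y)))%E.
  by apply: (admissible_ge0 (ap n)); case: hy.
have pf : pp n (norm_process (val y)) \is a fin_num by rewrite ge0_fin_numE.
have qf : polar P (pp n) (variation_process u) \is a fin_num.
  by rewrite ge0_fin_numE ?polar_ge0.
rewrite -lee_fin EFinM !fineK// -abse_EFin fineK ?pairing_fin_num//.
apply: le_trans (pairing_abs_le (ap n) hy hu1).
rewrite /pairing expectationE; apply: le_abse_integral => //.
by apply/measurable_EFinP; apply: measurable_path_integral; [case: hy|case: hu1].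
Qed.

Section functional.
Variables (u : Omega -> M) (hu : UM pp u).

(** The proof of membership is an argument, from which the linear structure is
    inferred. *)
Definition pairing_functional & UM pp u := fun y : YC T0 pp =>
  fine (pairing P (YCrepr y) u) : R^o.

Lemma pairing_functionalE (y : YCpre T0 pp) :
  (pairing_functional hu) (YCclass y) = fine (pairing P (val y) u).
Proof. by rewrite /pairing_functional pairing_repr. Qed.

Lemma YCclassK (y : YC T0 pp) : exists x : YCpre T0 pp, y = YCclass x.
Proof. by exists (repr (y : YCquot T0 pp)); rewrite /YCclass reprK. Qed.

Lemma YCclassP (a : R) (x y : YCpre T0 pp) :
  a *: (YCclass x : YC T0 pp) + YCclass y = YCclass (a *: x + y).
Proof.
by rewrite /YCclass pi_quot_add pi_quot_scale.
Qed.

Lemma pairing_functional_linear : linear (pairing_functional hu).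
Proof.
move=> a x y; have [x' ->] := YCclassK x; have [y' ->] := YCclassK y.
rewrite YCclassP !pairing_functionalE pairing_linl//.
by rewrite fineD ?fin_numM ?pairing_fin_num// fineM ?pairing_fin_num.
Qed.

HB.instance Definition _ := GRing.isLinear.Build R (YC T0 pp) R^o *:%R
  (pairing_functional hu) pairing_functional_linear.

Lemma pairing_functional_continuous : continuous (pairing_functional hu).
Proof.
have [_ [_ [n fin]]] := hu; pose C := fine (polar P (pp n) (variation_process u)).
have C0 : 0 <= C by rewrite fine_ge0// polar_ge0.
move=> x A /nbhs_ballP[e /= e0 sA]; exists (n, e / (C + 1)) => /=.
  by rewrite divr_gt0// ltr_wpDl.
move=> y /= xy; apply: sA; rewrite /ball /= distrC -linearB /=.
have [z zE] := YCclassK (y - x); have := xy n (leqnn n).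
rewrite zE pairing_functionalE => h.
have := pairing_seminorm_le z hu fin; rewrite -/C => /le_lt_trans; apply.
rewrite -YCseminorm_class; rewrite ltr_pdivlMr ?ltr_wpDl// in h.
apply: le_lt_trans h; rewrite ler_wpM2l ?lerDl//.
rewrite YCseminorm_class fine_ge0// (admissible_ge0 (ap n))//.
by have [[]] := YCpreP z.
Qed.

End functional.

Lemma UM_functional u : UM pp u -> exists f : {linear YC T0 pp -> R^o},
  continuous f /\
  forall y : YCpre T0 pp, ((f (YCclass y))%:E = pairing P (val y) u)%E.
Proof.
move=> hu; exists (pairing_functional hu); split.
  exact: pairing_functional_continuous.
by move=> y; rewrite /= pairing_functionalE fineK// pairing_fin_num.
Qed.

End duality.

(** * Completeness of Y(C) *)

Section seminormed_frechet.
Context (R : realType) (V : lmodType R).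
Context (q : nat -> V -> R) (qP : forall n, seminorm (q n)).
Hypothesis q_separates : forall z, (forall n, q n z = 0) -> z = 0.
Local Notation E := (seminormed qP).

Lemma seminorm0 i : q i 0 = 0.
Proof. by rewrite -(scale0r (0 : V)) (qP i).2 normr0 mul0r. Qed.

Lemma seminormC i x y : q i (x - y) = q i (y - x).
Proof. by have := (qP i).2 (-1) (y - x); rewrite scaleN1r opprB normrN normr1 mul1r. Qed.

Lemma seminorm_distD i x y z : q i (x - z) <= q i (x - y) + q i (y - z).
Proof.
have -> : x - z = (x - y) + (y - z) by rewrite addrA subrK.
exact: (qP i).1.
Qed.

Lemma seminorm_ge0 i x : 0 <= q i x.
Proof.
have := (qP i).1 x (- x); rewrite subrr seminorm0 -scaleN1r (qP i).2.
by rewrite normrN normr1 mul1r -mulr2n pmulrn_lge0.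
Qed.

(** The truncation level tends to 0, so that a ball of the resulting distance
    restricts only finitely many of the seminorms. *)
Definition truncated_seminorm n x : R := Num.min n.+1%:R^-1 (q n x).

Definition seminorm_dist (x y : V) : R :=
  sup (range (fun n => truncated_seminorm n (x - y))).

Lemma truncated_seminorm_le x y n :
  truncated_seminorm n (x - y) <= seminorm_dist x y.
Proof.
apply: ub_le_sup; last by exists n.
exists 1 => _ [m _ <-]; rewrite /truncated_seminorm ge_min; apply/orP; left.
by rewrite invf_le1 ?ler1n// ltr0Sn.
Qed.

Lemma seminorm_dist_le x y e :
  (forall n, truncated_seminorm n (x - y) <= e) -> seminorm_dist x y <= e.
Proof.
move=> h; apply: ge_sup; first by exists (truncated_seminorm 0 (x - y)); exists 0%N.
by move=> _ [n _ <-].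
Qed.

Lemma truncated_seminorm_ge0 n x : 0 <= truncated_seminorm n x.
Proof. by rewrite le_min invr_ge0 ler0n seminorm_ge0. Qed.

Lemma truncated_seminormD n (x y z : V) : truncated_seminorm n (x - z) <=
  truncated_seminorm n (x - y) + truncated_seminorm n (y - z).
Proof.
have := seminorm_distD n x y z; have := seminorm_ge0 n (x - y).
have := seminorm_ge0 n (y - z).
have : 0 < n.+1%:R^-1 :> R by rewrite invr_gt0 ltr0Sn.
rewrite /truncated_seminorm !minEle; move: n.+1%:R^-1 => a *.
by do 3 case: ifPn; rewrite -?ltNge => *; lra.
Qed.

Lemma seminormed_metrizable : metrizable R E.
Proof.
exists seminorm_dist; split.
- move=> x y; split=> [d0|->].
    apply/eqP; rewrite -subr_eq0; apply/eqP/q_separates => n; apply/eqP.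
    rewrite eq_le seminorm_ge0 andbT.
    have := truncated_seminorm_le x y n; rewrite d0 /truncated_seminorm ge_min.
    by rewrite leNgt invr_gt0 ltr0Sn.
  apply/eqP; rewrite eq_le; apply/andP; split.
    by apply: seminorm_dist_le => n; rewrite subrr /truncated_seminorm seminorm0 ge_min lexx orbT.
  exact: le_trans (truncated_seminorm_ge0 0 _) (truncated_seminorm_le y y 0).
- move=> x y; apply/eqP; rewrite eq_le; apply/andP.
  by split; apply: seminorm_dist_le => n; rewrite /truncated_seminorm seminormC;
    exact: truncated_seminorm_le.
- move=> x y z; apply: seminorm_dist_le => n.
  apply: le_trans (lerD (truncated_seminorm_le x y n) (truncated_seminorm_le y z n)).
  exact: truncated_seminormD.
- move=> x; apply/seteqP; split=> A.
    move=> [[n e] /= e0 sA]; exists (Num.min e n.+1%:R^-1).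
      by rewrite /= lt_min e0 invr_gt0 ltr0Sn.
    move=> y /= xy; apply: sA => i hi /=.
    have := le_lt_trans (truncated_seminorm_le x y i) xy.
    have : n.+1%:R^-1 <= i.+1%:R^-1 :> R by rewrite lef_pV2 ?posrE ?ltr0Sn// ler_nat.
    rewrite /truncated_seminorm seminormC !minEle.
    move: n.+1%:R^-1 i.+1%:R^-1 => a b ab.
    by do 2 case: ifPn; rewrite -?ltNge => *; lra.
  move=> [e /= e0 sA].
  pose n := Num.truncn (e / 2)^-1.
  exists (n, e / 2) => /=; first by rewrite divr_gt0.
  move=> y xy; apply: sA => /=; apply: (@le_lt_trans _ _ (e / 2)); last by lra.
  apply: seminorm_dist_le => i; rewrite /truncated_seminorm ge_min.
  have [hi|hi] := leqP i n.
    by rewrite seminormC (ltW (xy i hi)) orbT.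
  apply/orP; left; rewrite invf_ple ?posrE ?ltr0Sn ?divr_gt0//.
  rewrite (le_trans (ltW (truncnS_gt _)))// ler_nat; exact: leq_trans hi _.
Qed.

Hypothesis q_complete : forall x : nat -> V,
  (forall i j k, (i <= j <= k)%N -> q i (x j - x k) <= 2 ^- j) ->
  exists l, forall i j, (i <= j)%N -> q i (x j - l) <= 2 ^- j.

(** A Cauchy filter has members A k which are smaller than 2 ^- k for the first
    k + 1 seminorms. Points of the intersections of A 0, ..., A k form a fast
    Cauchy sequence, whose limit is a limit of the filter. *)
Lemma seminormed_complete (F : set_system E) : ProperFilter F -> cauchy F ->
  exists x : E, F --> x.
Proof.
move=> FF cF.
have small k : exists A : set E, F A /\
    forall x y, A x -> A y -> forall i, (i <= k)%N -> q i (x - y) < 2 ^- k.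
  have : entourage [set xy : E * E | seminorm_ball q 0 k (2 ^- k) (xy.1 - xy.2)].
    exists (seminorm_ball q 0 k (2 ^- k)); split.
      by exists (k, 2 ^- k) => //=; rewrite invr_gt0 exprn_gt0.
    by move=> xy; rewrite !inE.
  move=> /cF[[A B] /= [FA FB] sAB]; exists (A `&` B); split; first exact: filterI.
  move=> x y [Ax _] [_ By] i hi; have := sAB (x, y) (conj Ax By) i hi.
  by rewrite /= subr0.
have [A hA] := choice small.
have ne k : exists x, forall j, (j <= k)%N -> A j x.
  have : F [set x | forall j, (j <= k)%N -> A j x].
    elim: k => [|k ih].
      by apply: filterS (hA 0).1 => x Ax j; rewrite leqn0 => /eqP ->.
    apply: filterS2 ih (hA k.+1).1 => x hx Ax j.
    by rewrite leq_eqVlt => /predU1P[->//|]; exact: hx.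
  by move=> /filter_ex.
have [x hx] := choice ne.
have [l hl] : exists l, forall i j, (i <= j)%N -> q i (x j - l) <= 2 ^- j.
  apply: q_complete => i j k /andP[ij jk]; apply: ltW.
  by apply: (hA j).2 => //; exact: hx.
exists l => B [[n e] /= e0 sB].
have e20 : 0 < e / 2 by rewrite divr_gt0.
have [k nk ke] : exists2 k, (n <= k)%N & 2 ^- k < e / 2.
  have [N _ hN] := near_half_pow e20.
  exists (maxn n N); first exact: leq_maxl.
  exact: (hN _ (leq_maxr n N)).
apply: filterS (hA k).1 => y Ay; apply: sB => i hi /=.
have ik := leq_trans hi nk.
rewrite (le_lt_trans (seminorm_distD i y (x k) l))// (splitr e) ltr_leD//.
  by rewrite (lt_trans _ ke)// (hA k).2//; exact: hx.
by rewrite (le_trans (hl i k ik))// ltW.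
Qed.

Lemma seminormed_frechet : frechet E.
Proof. by split; [exact: seminormed_metrizable|exact: seminormed_complete]. Qed.

End seminormed_frechet.

Section fast_cauchy_sequences.
Context d (Omega : measurableType d) (R : realType) (P : probability Omega R).
Context (T : \bar R) (T0 : (0 < T)%E) (pp : seminorm_seq P).
Implicit Types (xi g : Omega -> R).

Let ap n : admissible P (pp n) := sseq_admissible pp n.

Lemma L1_dominated_ae xi g : measurable_fun setT xi -> measurable_fun setT g ->
  {ae P, forall w, `|xi w| <= g w} -> (forall w, 0 <= g w) ->
  (\int[P]_w `|xi w|%:E <= \int[P]_w (g w)%:E)%E.
Proof.
move=> mxi mg xig g0; apply: ae_ge0_le_integral => //.
- by apply/measurable_EFinP; exact: measurableT_comp.
- by move=> w _; rewrite lee_fin.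
- exact/measurable_EFinP.
- by apply: filterS xig => w h _; rewrite lee_fin.
Qed.

Lemma integral_lty_L1 xi : measurable_fun setT xi ->
  (\int[P]_w `|xi w|%:E < +oo)%E -> xi \in Lfun P 1.
Proof.
move=> mxi fin; apply/Lfun1_integrable/integrableP; split => //.
exact/measurable_EFinP.
Qed.

Lemma geometric_tail k m : (k <= m)%N ->
  \sum_(k <= i < m) (2 ^- i : R) <= 2 * 2 ^- k.
Proof.
move=> km; suff -> : \sum_(k <= i < m) (2 ^- i : R) = 2 * (2 ^- k - 2 ^- m).
  by rewrite ler_pM2l// gerBl invr_ge0 exprn_ge0.
elim: m km => [|m ih]; first by rewrite leqn0 => /eqP ->; rewrite big_geq// subrr mulr0.
rewrite leq_eqVlt => /predU1P[->|]; first by rewrite big_geq// subrr mulr0.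
rewrite ltnS => km; rewrite big_nat_recr//= ih// exprSr invfM.
by lra.
Qed.

Variable y : nat -> Omega -> time T0 -> R.
Hypothesis cy : forall k, continuous_process (y k).
Hypothesis ny : forall k, norm_process (y k) \in Lfun P 1.
Hypothesis fast : forall i j k, (i <= j <= k)%N ->
  (pp i (norm_process (y j - y k)%R) <= (2 ^- j)%:E)%E.

Let cyB j k : continuous_process (y j - y k).
Proof.
rewrite -scaleN1r; apply: continuous_processD => //.
exact: continuous_processZ.
Qed.

Let N i := norm_process (y i - y i.+1).

Let mN i : measurable_fun setT (N i).
Proof. exact: measurable_norm_process. Qed.

Let N0 i w : 0 <= N i w.
Proof. exact: norm_process_ge0. Qed.

Let norm_processB_le (x z : Omega -> time T0 -> R) w :
  continuous_process x -> continuous_process z ->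
  norm_process (x - z) w <= norm_process x w + norm_process z w.
Proof.
move=> [cx _] [cz _]; rewrite /norm_process.
apply: path_norm_le => t.
by rewrite (le_trans (ler_normB _ _))// lerD// path_norm_ub.
Qed.

Let norm_processD_le (x z : Omega -> time T0 -> R) w :
  continuous_process x -> continuous_process z ->
  norm_process (x + z) w <= norm_process x w + norm_process z w.
Proof. by move=> [cx _] [cz _]; exact: path_normD. Qed.

Let nyB j k : norm_process (y j - y k) \in Lfun P 1.
Proof.
apply: (@Lfun_dominated _ _ _ P 1%E _ (norm_process (y j) + norm_process (y k))) => //.
- exact: measurable_norm_process.
- exact: LfunD.
- move=> w; rewrite ger0_norm ?norm_process_ge0// ger0_norm.
    exact: norm_processB_le.
  by rewrite addr_ge0// norm_process_ge0.
Qed.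

Lemma L1_bound_seminorm : exists2 c : R, 0 < c & forall xi (r : R),
  xi \in Lfun P 1 -> (pp 0%N xi <= r%:E)%E -> (\int[P]_w `|xi w|%:E <= (c * r)%:E)%E.
Proof.
have [c c0 hc] := admissible_bounds (ap 0); exists c => // xi r hxi pr.
have [+ _] := hc _ hxi; rewrite Lnorm1 => /le_trans/(_ pr).
by rewrite lee_pdivrMl.
Qed.

(** The seminorms dominate the L^1 norm, so that the norms of the increments have
    a finite expected sum: almost surely the paths converge uniformly, and the
    limit is set to 0 on the remaining event. *)
Lemma fast_cauchy_limit : exists l : Omega -> time T0 -> R,
  [/\ continuous_process l, norm_process l \in Lfun P 1 &
      forall i j, (i <= j)%N -> (pp i (norm_process (y j - l)%R) <= (2 ^- j)%:E)%E].
Proof.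
have [c c0 hc] := L1_bound_seminorm.
have intN i : (\int[P]_w (N i w)%:E <= (c * 2 ^- i)%:E)%E.
  have := hc _ _ (nyB i i.+1) (fast (i := 0) (j := i) (k := i.+1) _).
  rewrite leq0n leqnSn => /(_ isT); apply: le_trans.
  apply: ge0_le_integral => //.
  - by move=> w _; rewrite lee_fin.
  - exact/measurable_EFinP.
  - by apply/measurable_EFinP; apply: measurableT_comp => //; exact: measurable_norm_process.
  - by move=> w _; rewrite lee_fin ler_norm.
pose tail k m w := \sum_(k <= i < m) N i w.
have tail0 k m w : 0 <= tail k m w by apply: sumr_ge0.
have mtail k m : measurable_fun setT (tail k m) by apply: measurable_sum.
have inttail k m : (k <= m)%N ->
    (\int[P]_w (tail k m w)%:E <= (c * (2 * 2 ^- k))%:E)%E.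
  move=> km; apply: (@le_trans _ _ (\sum_(k <= i < m) (c * 2 ^- i)%:E)%E).
    under eq_integral do rewrite /tail -sumEFin.
    rewrite ge0_integral_sum//; first last.
    - by move=> i w _; rewrite lee_fin.
    - by move=> i; exact/measurable_EFinP.
    by apply: lee_sum => i _.
  rewrite sumEFin lee_fin -mulr_sumr ler_pM2l//; exact: geometric_tail.
have tailS k m w : (k <= m)%N -> tail 0 m w = tail 0 k w + tail k m w.
  by move=> km; rewrite /tail -big_cat_nat.
have tail_nd w : nondecreasing_seq (fun k => (tail 0 k w)%:E).
  by move=> k m km; rewrite lee_fin (tailS _ _ w km) lerDl.
pose S w := limn (fun k => (tail 0 k w)%:E).
have cS w : (fun k => (tail 0 k w)%:E) @ \oo --> S w.
  exact: ereal_nondecreasing_is_cvgn.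
have mS : measurable_fun setT S.
  apply: (emeasurable_fun_cvg (fun k w => (tail 0 k w)%:E)) => //.
  by move=> k; exact/measurable_EFinP.
have S_ub w k : ((tail 0 k w)%:E <= S w)%E.
  rewrite /S (cvg_lim _ (ereal_nondecreasing_cvgn (tail_nd w)))//.
  by apply: ereal_sup_ubound; exists k.
have intS : (\int[P]_w S w < +oo)%E.
  apply: (@le_lt_trans _ _ (c * (2 * 2 ^- 0))%:E); last exact: ltry.
  rewrite /S monotone_convergence//.
  - apply: lime_le; last by apply: nearW => k; exact: inttail.
    apply: ereal_nondecreasing_is_cvgn => k m km.
    apply: ge0_le_integral => //.
    + by move=> w _; rewrite lee_fin.
    + exact/measurable_EFinP.
    + exact/measurable_EFinP.
    + by move=> w _; exact: tail_nd.
  - by move=> k; exact/measurable_EFinP.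
  - by move=> k w _; rewrite lee_fin.
have S0 w : (0 <= S w)%E by apply: le_trans (S_ub w 0); rewrite lee_fin.
pose G := [set w | (S w < +oo)%E].
have mG : measurable G.
  by rewrite -[G]setTI; exact: emeasurable_fun_infty_o.
have aeG : {ae P, forall w, G w}.
  have : P.-integrable setT S.
    by apply/integrableP; split => //; under eq_integral do rewrite gee0_abs//.
  move=> /(integrable_ae measurableT); apply: filterS => w /(_ I).
  by rewrite ge0_fin_numE.
pose s w := fine (S w).
have sE w : G w -> (s w)%:E = S w by move=> Gw; rewrite fineK// ge0_fin_numE.
have scvg w : G w -> tail 0 k w @[k --> \oo] --> s w.
  move=> Gw; have := cS w; rewrite -(sE w Gw) => /fine_cvgP[_]; exact.
have s_ub w k : G w -> tail 0 k w <= s w.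
  by move=> Gw; rewrite -lee_fin sE.
have tele j k w t : (j <= k)%N -> `|y j w t - y k w t| <= tail j k w.
  elim: k => [|k ih]; first by rewrite leqn0 => /eqP ->; rewrite subrr normr0.
  rewrite leq_eqVlt => /predU1P[->|]; first by rewrite subrr normr0.
  rewrite ltnS => jk; rewrite /tail big_nat_recr//=.
  rewrite (le_trans (ler_distD (y k w t) _ _))// lerD ?ih//.
  by have [ck _] := cyB k k.+1; apply: (path_norm_ub t (ck w)).
have tele_s j k w t : G w -> (j <= k)%N ->
    `|y j w t - y k w t| <= s w - tail 0 j w.
  move=> Gw jk; apply: (le_trans (tele _ _ _ _ jk)).
  by rewrite lerBrDl -tailS// s_ub.
pose z k w t := \1_G w * y k w t.
have zE k w t : G w -> z k w t = y k w t.
  by move=> Gw; rewrite /z indicE mem_set// mul1r.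
have zE0 k w t : ~ G w -> z k w t = 0.
  by move=> Gw; rewrite /z indicE memNset// mul0r.
pose l w t := limn (fun k => z k w t).
have zl w t : z k w t @[k --> \oo] --> l w t.
  have [Gw|nGw] := pselect (G w); last first.
    rewrite /l (_ : (fun k => z k w t) = cst 0).
      by rewrite lim_cst//; exact: cvg_cst.
    by apply/funext => k; rewrite zE0.
  apply/cauchy_cvgP; apply: cauchy_exP => e e0.
  move/cvgrPdist_lt : (scvg w Gw) => /(_ e e0)[K _ hK].
  exists (z K w t); exists K => // k /= Kk.
  rewrite /ball /= !zE// (le_lt_trans (tele_s _ _ _ _ Gw Kk))//.
  by have := hK K (leqnn K); rewrite ger0_norm// subr_ge0 s_ub.
have yl j w t : G w -> `|y j w t - l w t| <= s w - tail 0 j w.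
  move=> Gw; apply/ler_addgt0Pr => e e0.
  move/cvgrPdist_lt : (zl w t) => /(_ e e0)[K _ hK].
  have := hK (maxn K j) (leq_maxl _ _); rewrite zE// => h.
  rewrite (le_trans (ler_distD (y (maxn K j) w t) _ _))// lerD//.
    by apply: tele_s => //; exact: leq_maxr.
  by rewrite distrC ltW.
have l0 w t : ~ G w -> l w t = 0.
  move=> nGw; rewrite /l; under eq_fun do rewrite zE0//; exact: lim_cst.
have cl : continuous_process l.
  split.
    move=> w; have [Gw|nGw] := pselect (G w); last first.
      rewrite (_ : l w = cst 0); first exact: cst_continuous.
      by apply/funext => t; rewrite l0.
    move=> t A /nbhs_ballP[e /= e0 sA].
    have e30 : 0 < e / 3 by rewrite divr_gt0.
    move/cvgrPdist_lt : (scvg w Gw) => /(_ _ e30)[K _ /(_ K (leqnn K))] /=.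
    rewrite ger0_norm ?subr_ge0 ?s_ub// => hK.
    have [cK _] := cy K.
    have : nbhs t ((y K w) @^-1` ball (y K w t) (e / 3)).
      by apply: (cK w t); exact: nbhsx_ballx.
    apply: filterS => t'; rewrite /ball /= => htt; apply: sA; rewrite /ball /=.
    have h1 := yl K w t Gw; have h2 := yl K w t' Gw.
    have -> : l w t - l w t' = (l w t - y K w t) + (y K w t - y K w t') +
        (y K w t' - l w t') by ring.
    rewrite (le_lt_trans (ler_normD _ _))//.
    have := ler_normD (l w t - y K w t) (y K w t - y K w t').
    rewrite [`|l w t - _|]distrC; lra.
  apply: (measurable_fun_cvg (h := fun k x => z k x.1 x.2)) => //.
    move=> k; apply: measurable_funM; last by case: (cy k).
    by apply: measurableT_comp => //; exact: measurable_indic.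
have cyl j : continuous_process (y j - l).
  by rewrite -scaleN1r; apply: continuous_processD => //; exact: continuous_processZ.
pose r k w := \1_G w * (s w - tail 0 k w).
have rE k w : G w -> r k w = s w - tail 0 k w.
  by move=> Gw; rewrite /r indicE mem_set// mul1r.
have r0 k w : 0 <= r k w.
  have [Gw|nGw] := pselect (G w); first by rewrite rE// subr_ge0 s_ub.
  by rewrite /r indicE memNset// mul0r.
have rcvg k w : \1_G w * tail k (m + k)%N w @[m --> \oo] --> r k w.
  have [Gw|nGw] := pselect (G w); last first.
    rewrite /r indicE memNset// mul0r; under eq_fun do rewrite mul0r.
    exact: cvg_cst.
  apply: cvgMl_tmp.
  rewrite (_ : (fun m => _) = (fun m => tail 0 (m + k)%N w - tail 0 k w)).
    apply: cvgB; last exact: cvg_cst.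
    by have := scvg w Gw; rewrite -(cvg_shiftn k).
  by apply/funext => m; rewrite (tailS k (m + k)%N) ?leq_addl// addrAC subrr add0r.
have mr k : measurable_fun setT (r k).
  apply: (measurable_fun_cvg (h := fun m w => \1_G w * tail k (m + k)%N w)) => //.
  by move=> m; apply: measurable_funM => //; exact: measurable_indic.
have intr k : (\int[P]_w (r k w)%:E <= (c * (2 * 2 ^- k))%:E)%E.
  apply: (integral_lim_le (f_ := fun m w => \1_G w * tail k (m + k)%N w)) => //.
  - by move=> m; apply: measurable_funM => //; exact: measurable_indic.
  - by move=> m w; rewrite mulr_ge0.
  - move=> m; apply: le_trans (inttail _ _ (leq_addl m k)).
    apply: ge0_le_integral => //.
    + by move=> w _; rewrite lee_fin mulr_ge0.
    + by apply/measurable_EFinP; apply: measurable_funM => //; exact: measurable_indic.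
    + exact/measurable_EFinP.
    + by move=> w _; rewrite lee_fin ler_piMl// indicE lern1 leq_b1.
have DLr j : {ae P, forall w, `|norm_process (y j - l) w| <= r j w}.
  apply: filterS aeG => w Gw; rewrite ger0_norm ?norm_process_ge0// rE//.
  by apply: path_norm_le => t; exact: yl.
have hDL j : norm_process (y j - l) \in Lfun P 1.
  apply: integral_lty_L1; first exact: measurable_norm_process.
  apply: le_lt_trans (le_lt_trans (intr j) (ltry _)).
  by apply: L1_dominated_ae => //; exact: measurable_norm_process.
exists l; split => //.
  apply: (@Lfun_dominated _ _ _ P 1%E _ (norm_process (y 0) + norm_process (y 0 - l))) => //.
  - exact: measurable_norm_process.
  - exact: LfunD.
  - move=> w; rewrite ger0_norm ?norm_process_ge0// ger0_norm; last first.
      by rewrite addr_ge0// norm_process_ge0.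
    apply: le_trans (norm_processB_le w (cy 0) (cyl 0)).
    by rewrite opprB addrC subrK.
(* By lower semicontinuity, an excess over 2 ^- j in the limit would be present
   already for y j - y k with k large. *)
move=> i j ij; rewrite leNgt; apply/negP => lt.
have [e e0 he] := admissible_lsc (ap i) (hDL j) lt.
have d0 : 0 < e / (c * 2) by rewrite divr_gt0// mulr_gt0.
have [K _ hK] := near_half_pow d0.
pose k := maxn K j.
have kd : 2 ^- k < e / (c * 2) by exact: (hK _ (leq_maxl K j)).
have := fast (i := i) (j := j) (k := k); rewrite ij leq_maxr => /(_ isT).
rewrite leNgt => /negP; apply; apply: he; first exact: nyB.
rewrite Lnorm1; apply: (@le_lt_trans _ _ (\int[P]_w (r k w)%:E)%E).
  apply: L1_dominated_ae => //.
    by apply: measurable_funB; exact: measurable_norm_process.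
  apply: filterS aeG => w Gw.
  have [cjk _] := cyB j k; have [cjl _] := cyl j; have [ckl _] := cyl k.
  have key : norm_process (y k - l) w <= r k w.
    by rewrite rE//; apply: path_norm_le => t; exact: yl.
  have h1 := norm_processB_le w (cyl j) (cyl k); rewrite opprB addrA subrK in h1.
  have h2 := norm_processD_le w (cyB j k) (cyl k); rewrite addrA subrK in h2.
  suff : `|norm_process (y j - y k) w - norm_process (y j - l) w| <= r k w by [].
  by rewrite ler_norml; apply/andP; split; lra.
apply: (le_lt_trans (intr k)); rewrite lte_fin mulrA -ltr_pdivlMl ?mulr_gt0//.
by rewrite mulrC.
Qed.

End fast_cauchy_sequences.

Section frechet_YC.
Context d (Omega : measurableType d) (R : realType) (P : probability Omega R).
Context (T : \bar R) (T0 : (0 < T)%E) (pp : seminorm_seq P).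

Let ap n : admissible P (pp n) := sseq_admissible pp n.

Lemma YCseminorm_separates (z : YCquot T0 pp) :
  (forall n, YCseminorm n z = 0) -> z = 0.
Proof.
move=> z0; have [x zE] := YCclassK z.
have [[cx x1] [[_ dx] _]] := YCpreP x.
have p0 : pp 0%N (norm_process (val x)) = 0%E.
  have fin : pp 0%N (norm_process (val x)) \is a fin_num.
    by rewrite ge0_fin_numE// (admissible_ge0 (ap 0)).
  by rewrite -(fineK fin); have := z0 0%N; rewrite zE YCseminorm_class => ->.
have n0 := admissible_eq0 (ap 0) x1 p0.
rewrite zE -(scale0r (YCclass x : YCquot T0 pp)) -pi_quot_scale.
apply/YC_eqP; apply: filterS n0 => w h t.
have -> : val (0 *: x) w t = 0 * val x w t by [].
rewrite mul0r; apply/eqP; rewrite -normr_le0 -h.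
by apply: path_norm_ub; case: cx.
Qed.

Lemma YCseminorm_le_admissible n (y : YCpre T0 pp) (r : R) :
  YCseminorm n (YCclass y) <= r -> (pp n (norm_process (val y)) <= r%:E)%E.
Proof.
have [[_ y1] [[_ dy] _]] := YCpreP y.
rewrite YCseminorm_class -lee_fin fineK// ge0_fin_numE//.
exact: (admissible_ge0 (ap n)).
Qed.

(** By the reverse triangle inequality the norm process of the limit is
    approximated by those of the sequence, hence by bounded variables. *)
Lemma YCseminorm_complete (x : nat -> YCquot T0 pp) :
  (forall i j k, (i <= j <= k)%N -> YCseminorm i (x j - x k) <= 2 ^- j) ->
  exists l, forall i j, (i <= j)%N -> YCseminorm i (x j - l) <= 2 ^- j.
Proof.
move=> fast.
have [y yE] := choice (fun k => YCclassK (x k)).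
have classB (u v : YCpre T0 pp) :
    (YCclass u : YCquot T0 pp) - YCclass v = YCclass (u - v).
  have E : (YCclass u : YCquot T0 pp) = YCclass (u - v) + YCclass v.
    by rewrite /YCclass -[in LHS](subrK v u) pi_quot_add.
  by rewrite E addrK.
have [|||l [cl l1 hl]] := @fast_cauchy_limit _ _ _ P _ T0 pp (fun k => val (y k)).
- by move=> k; have [[]] := YCpreP (y k).
- by move=> k; have [[]] := YCpreP (y k).
- move=> i j k ijk; have := fast i j k ijk.
  by rewrite !yE classB => /YCseminorm_le_admissible.
have cB j : continuous_process (val (y j) - l).
  rewrite -scaleN1r; apply: continuous_processD.
    by have [[]] := YCpreP (y j).
  exact: continuous_processZ.
have nB j : norm_process (val (y j) - l) \in Lfun P 1.
  apply: (@Lfun_dominated _ _ _ P 1%E _ (norm_process (val (y j)) + norm_process l)) => //.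
  - exact: measurable_norm_process.
  - by apply: LfunD => //; have [[]] := YCpreP (y j).
  - move=> w; have [[[cy my] _] _] := YCpreP (y j); have [cl1 _] := cl.
    rewrite ger0_norm ?norm_process_ge0// ger0_norm; last first.
      by rewrite addr_ge0// path_norm_ge0.
    apply: path_norm_le => t.
    by rewrite (le_trans (ler_normB _ _))// lerD// path_norm_ub.
have dist j w : `|norm_process l w - norm_process (val (y j)) w| <=
    `|norm_process (val (y j) - l) w|.
  have [[[cy my] _] _] := YCpreP (y j); have [cl1 _] := cl; have [cB1 _] := cB j.
  rewrite [leRHS]ger0_norm ?norm_process_ge0//.
  rewrite ler_norml lerBrDr lerBlDr addrC lerBlDr; apply/andP; split.
    apply: path_norm_le => t; rewrite -[val (y j) w t](subrK (l w t)) addrC.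
    rewrite (le_trans (ler_normD _ _))// lerD//; first exact: path_norm_ub.
    exact: (path_norm_ub t (cB1 w)).
  apply: path_norm_le => t; rewrite -[l w t](subrK (val (y j) w t)).
  rewrite (le_trans (ler_normD _ _))// lerD//; last exact: path_norm_ub.
  rewrite distrC; exact: (path_norm_ub t (cB1 w)).
have LB f g : f \in Lfun P 1 -> g \in Lfun P 1 -> f - g \in Lfun P 1.
  by move=> hf hg; apply: LfunD => //; rewrite -scaleN1r; exact: LfunZ.
have y1 j : norm_process (val (y j)) \in Lfun P 1 by have [[]] := YCpreP (y j).
have near i j : (i <= j)%N ->
    (pp i (norm_process l - norm_process (val (y j)))%R <= (2 ^- j)%:E)%E.
  move=> ij; apply: le_trans (hl i j ij).
  apply: (admissible_mono (ap i)); [exact: LB|exact: nB|].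
  by apply: nearW => w; exact: dist.
have Yl : Yspace pp (norm_process l).
  split.
    split => // n.
    rewrite -[norm_process l](subrK (norm_process (val (y n)))).
    apply: le_lt_trans (admissible_subadd (ap n) _ _) _ => //; first exact: LB.
    apply: lte_add_pinfty; last by have [_ [[_ +] _]] := YCpreP (y n); exact.
    exact: le_lt_trans (near n n (leqnn n)) (ltry _).
  move=> n e e0; have e20 : 0 < e / 2 by rewrite divr_gt0.
  have [K _ hK] := near_half_pow e20.
  pose j := maxn K n.
  have je : 2 ^- j < e / 2 by exact: (hK _ (leq_maxl K n)).
  have [_ [_ /(_ n _ e20)[eta heta hclose]]] := YCpreP (y j).
  exists eta => // i hi.
  have -> : norm_process l - eta = (norm_process l - norm_process (val (y j))) +
      (norm_process (val (y j)) - eta) by rewrite addrA subrK.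
  have heta1 := Loo_sub_L1 heta.
  apply: le_lt_trans (admissible_subadd (ap i) _ _) _; [exact: LB|exact: LB|].
  rewrite (splitr e) EFinD; apply: lteD; last exact: hclose.
  have ij : (i <= j)%N by rewrite (leq_trans hi)// leq_maxr.
  by apply: le_lt_trans (near i j ij) _; rewrite lte_fin.
exists (YCclass (YCmk (conj (conj cl l1) Yl))) => i j ij.
rewrite yE classB YCseminorm_class -lee_fin fineK; first exact: (hl i j ij).
rewrite ge0_fin_numE; first exact: le_lt_trans (hl i j ij) (ltry _).
by apply: (admissible_ge0 (ap i)); exact: (nB j).
Qed.

Lemma YC_frechet : frechet (YC T0 pp).
Proof.
exact: (seminormed_frechet (@YCseminormP _ _ _ P _ T0 pp)
  YCseminorm_separates YCseminorm_complete).
Qed.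

End frechet_YC.

(** * The positive part of a bounded functional *)

Lemma fin_num_admissible d (Omega : measurableType d) (R : realType)
    (P : probability Omega R) (p : (Omega -> R) -> \bar R) xi :
  admissible P p -> xi \in Lfun P +oo%E -> p xi \is a fin_num.
Proof.
move=> ap hxi; rewrite ge0_fin_numE; first exact: (admissible_Loo ap hxi).
by apply: (admissible_ge0 ap); exact: Loo_sub_L1.
Qed.

Section bounded_processes.
Context d (Omega : measurableType d) (R : realType) (P : probability Omega R).
Context (T : \bar R) (T0 : (0 < T)%E).
Implicit Types (y z : Omega -> time T0 -> R) (xi : Omega -> R).

Lemma LooC_lin (a : R) y z : LooC P y -> LooC P z -> LooC P (a *: y + z).
Proof.
move=> [cy hy] [cz hz].
have c : continuous_process (a *: y + z).
  by apply: continuous_processD => //; exact: continuous_processZ.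
split => //.
apply: (@Lfun_dominated _ _ _ P +oo%E _ (`|a| *: norm_process y + norm_process z)).
- by rewrite leey.
- exact: measurable_norm_process.
- by apply: LfunD; rewrite ?leey//; apply: LfunZ; rewrite ?leey.
- move=> w; rewrite ger0_norm ?norm_process_ge0// ger0_norm; last first.
    by rewrite addr_ge0 ?mulr_ge0 ?norm_process_ge0//= mulr_ge0 ?norm_process_ge0.
  have [ca _] := continuous_processZ a cy; have [cz1 _] := cz; have [cy1 _] := cy.
  apply: (le_trans (path_normD (ca w) (cz1 w))).
  by rewrite lerD2r (path_normZ a (cy1 w)).
Qed.

Lemma LooC0 : LooC P (0 : Omega -> time T0 -> R).
Proof.
split; first exact: continuous_process0.
rewrite (_ : norm_process _ = 0); first by apply: Lfun0; rewrite leey.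
by apply/funext => w; exact: path_norm0.
Qed.

Lemma LooC_mul xi y : xi \in Lfun P +oo%E -> LooC P y ->
  (exists M : R, forall w, norm_process y w <= M) ->
  LooC P (fun w t => xi w * y w t).
Proof.
move=> hxi [cy hy] [M yM]; have mxi := Lfun_measurable hxi.
have c := continuous_processM mxi cy; split => //.
apply: (@Lfun_dominated _ _ _ P +oo%E _ (M *: xi)).
- by rewrite leey.
- exact: measurable_norm_process.
- by apply: LfunZ; rewrite ?leey.
- move=> w; rewrite ger0_norm ?norm_process_ge0// norm_processM//.
  rewrite -[(M *: xi) w]/(M * xi w) normrM mulrC ler_wpM2r//.
  by rewrite (le_trans (yM w))// ler_norm.
Qed.

Lemma LooC_cst (g : time T0 -> R) : continuous g -> LooC P (fun=> g).
Proof.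
move=> cg; split; first exact: continuous_process_cst.
apply: (@bounded_Lfun _ _ _ P _ (path_norm g)) => [|w].
  exact/measurable_norm_process/continuous_process_cst.
by rewrite ger0_norm// path_norm_ge0.
Qed.

Lemma indic_Loo (A : set Omega) : measurable A ->
  (\1_A : Omega -> R) \in Lfun P +oo%E.
Proof.
move=> mA; apply: (@bounded_Lfun _ _ _ P _ 1); first exact: measurable_indic.
by move=> w; rewrite indicE normr_nat lern1 leq_b1.
Qed.

Definition restrict_process (A : set Omega) y : Omega -> time T0 -> R :=
  fun w t => \1_A w * y w t.

Lemma restrict_process_le (A : set Omega) y w : continuous_process y ->
  norm_process (restrict_process A y) w <= norm_process y w.
Proof.
move=> cy; rewrite norm_processM// ler_piMl ?norm_process_ge0//.
by rewrite indicE normr_nat lern1 leq_b1.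
Qed.

Lemma LooC_restrict (A : set Omega) y : measurable A -> LooC P y ->
  LooC P (restrict_process A y).
Proof.
move=> mA [cy hy].
have c : continuous_process (restrict_process A y).
  by apply: continuous_processM => //; exact: measurable_indic.
split => //; apply: (@Lfun_dominated _ _ _ P +oo%E _ (norm_process y)) => //.
- by rewrite leey.
- exact: measurable_norm_process.
- move=> w; rewrite !ger0_norm ?norm_process_ge0//.
  exact: restrict_process_le.
Qed.

Lemma dominated_LooC y g : continuous g -> continuous_process y ->
  (forall w t, `|y w t| <= g t) -> LooC P y.
Proof.
move=> cg cy yg; split => //.
apply: (@bounded_Lfun _ _ _ P _ (path_norm g)) => [|w].
  exact: measurable_norm_process.
rewrite ger0_norm ?norm_process_ge0//; apply: path_norm_le => t.
by rewrite (le_trans (yg w t))// (le_trans (ler_norm _))// path_norm_ub.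
Qed.

End bounded_processes.

(** A functional on the bounded continuous processes which is bounded by an
    admissible seminorm of the norm process. *)
Record bounded_functional d (Omega : measurableType d) (R : realType)
    (P : probability Omega R) (T : \bar R) (T0 : (0 < T)%E)
    (p : (Omega -> R) -> \bar R) (Phi : (Omega -> time T0 -> R) -> R) : Prop := {
  bf_admissible : admissible P p ;
  bf_linear : forall (a : R) y z, LooC P y -> LooC P z ->
    Phi (a *: y + z) = a * Phi y + Phi z ;
  bf_bounded : exists2 C : R, 0 <= C & forall y, LooC P y ->
    `|Phi y| <= C * fine (p (norm_process y)) }.

Section positive_part.
Context d (Omega : measurableType d) (R : realType) (P : probability Omega R).
Context (T : \bar R) (T0 : (0 < T)%E).
Variables (p : (Omega -> R) -> \bar R) (Phi : (Omega -> time T0 -> R) -> R).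
Hypothesis HPhi : bounded_functional P p Phi.
Implicit Types (y z : Omega -> time T0 -> R) (g : time T0 -> R).

Let ap : admissible P p := bf_admissible HPhi.

Lemma fine_admissible_mono xi eta : xi \in Lfun P +oo%E ->
  eta \in Lfun P +oo%E -> {ae P, forall w, `|xi w| <= `|eta w|} ->
  fine (p xi) <= fine (p eta).
Proof.
move=> hxi heta h.
rewrite fine_le ?(fin_num_admissible ap)//.
by apply: (admissible_mono ap) => //; exact: Loo_sub_L1.
Qed.

Lemma fine_admissible_ge0 xi : xi \in Lfun P +oo%E -> 0 <= fine (p xi).
Proof.
by move=> h; rewrite fine_ge0// (admissible_ge0 ap)//; exact: Loo_sub_L1.
Qed.

Lemma bfD y z : LooC P y -> LooC P z -> Phi (y + z) = Phi y + Phi z.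
Proof.
by move=> hy hz; have := bf_linear HPhi 1 hy hz; rewrite scale1r mul1r.
Qed.

Lemma bf0 : Phi 0 = 0.
Proof.
have := bfD (LooC0 P T0) (LooC0 P T0); rewrite addr0 => /eqP.
by rewrite -subr_eq0 opprD addrA subrr sub0r oppr_eq0 => /eqP.
Qed.

Definition below g : set (Omega -> time T0 -> R) :=
  [set z | continuous_process z /\ forall w t, 0 <= z w t <= g t].

Lemma below_LooC g z : continuous g -> below g z -> LooC P z.
Proof.
move=> cg [cz zg]; apply: (dominated_LooC _ cg) => // w t.
by have /andP[z0 z1] := zg w t; rewrite ger0_norm.
Qed.

Lemma below0 g : (forall t, 0 <= g t) -> below g 0.
Proof.
by move=> g0; split; [exact: continuous_process0|move=> w t; rewrite lexx g0].
Qed.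

Definition positive_part_set g (A : set Omega) : set R :=
  [set Phi (restrict_process A z) | z in below g].

(** The value at 1_A g of the Riesz-Kantorovich positive part of Phi. *)
Definition positive_part g (A : set Omega) : R := sup (positive_part_set g A).

Lemma Phi_restrict_bound : exists2 C, 0 <= C &
  forall g (A : set Omega) z, continuous g -> (forall t, 0 <= g t) ->
  measurable A -> below g z ->
  `|Phi (restrict_process A z)| <= C * (path_norm g * fine (p \1_A)).
Proof.
have [C C0 hC] := bf_bounded HPhi; exists C => // g A z cg g0 mA bz.
have hz := below_LooC cg bz; have hr := LooC_restrict mA hz.
apply: (le_trans (hC _ hr)); rewrite ler_wpM2l//.
have hA := indic_Loo P mA.
have gA : path_norm g * fine (p \1_A) = fine (p (path_norm g *: \1_A)).
  rewrite (admissibleZ _ ap) ?fineM ?(fin_num_admissible ap)//; last exact: Loo_sub_L1.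
  by rewrite ger0_norm// path_norm_ge0.
rewrite gA; apply: fine_admissible_mono.
- by case: hr.
- by apply: LfunZ => //; rewrite leey.
- apply: nearW => w; have [cz zg] := bz.
  rewrite ger0_norm ?norm_process_ge0//; last by case: hr.
  rewrite norm_processM// -[(path_norm g *: \1_A) w]/(path_norm g * \1_A w).
  rewrite normrM mulrC ler_wpM2r// ger0_norm ?path_norm_ge0//.
  apply: path_norm_le => t; have /andP[z0 z1] := zg w t.
  by rewrite ger0_norm// (le_trans z1)// (le_trans (ler_norm _))// path_norm_ub.
Qed.

Lemma positive_part_ub g (A : set Omega) z : continuous g ->
  (forall t, 0 <= g t) -> measurable A -> below g z ->
  Phi (restrict_process A z) <= positive_part g A.
Proof.
move=> cg g0 mA bz; apply: ub_le_sup; last by exists z.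
have [C C0 hC] := Phi_restrict_bound.
exists (C * (path_norm g * fine (p \1_A))) => _ [x bx <-].
by apply: (le_trans (ler_norm _)); exact: hC.
Qed.

Lemma positive_part_le g (A : set Omega) (r : R) : (forall t, 0 <= g t) ->
  (forall z, below g z -> Phi (restrict_process A z) <= r) ->
  positive_part g A <= r.
Proof.
move=> g0 hr; apply: ge_sup; last by move=> _ [z bz <-]; exact: hr.
by exists (Phi (restrict_process A 0)); exists 0 => //; exact: below0.
Qed.

Lemma restrict_process0 (A : set Omega) :
  restrict_process A (0 : Omega -> time T0 -> R) = 0.
Proof. by apply/funext => w; apply/funext => t; rewrite /restrict_process mulr0. Qed.

Lemma positive_part_ge0 g (A : set Omega) : continuous g ->
  (forall t, 0 <= g t) -> measurable A -> 0 <= positive_part g A.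
Proof.
move=> cg g0 mA; have := positive_part_ub cg g0 mA (below0 g0).
by rewrite restrict_process0 bf0.
Qed.

Lemma positive_part_bound : exists2 C, 0 <= C &
  forall g (A : set Omega), continuous g -> (forall t, 0 <= g t) ->
  measurable A -> positive_part g A <= C * (path_norm g * fine (p \1_A)).
Proof.
have [C C0 hC] := Phi_restrict_bound; exists C => // g A cg g0 mA.
apply: positive_part_le => // z bz.
by apply: (le_trans (ler_norm _)); exact: hC.
Qed.

Lemma positive_part_mono g h (A : set Omega) : continuous h ->
  (forall t, 0 <= g t <= h t) -> measurable A ->
  positive_part g A <= positive_part h A.
Proof.
move=> ch gh mA; have g0 t : 0 <= g t by have /andP[] := gh t.
apply: positive_part_le => // z [cz zg]; apply: positive_part_ub => //.
  by move=> t; have /andP[/le_trans] := gh t; apply.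
split => // w t; have /andP[-> /= zt] := zg w t.
by rewrite (le_trans zt)//; have /andP[] := gh t.
Qed.

Lemma restrict_processU (A B : set Omega) z : A `&` B = set0 ->
  restrict_process (A `|` B) z = restrict_process A z + restrict_process B z.
Proof.
move=> AB; apply/funext => w; apply/funext => t.
rewrite -[RHS]/(\1_A w * z w t + \1_B w * z w t) -mulrDl /restrict_process.
congr (_ * _); rewrite !indicE in_setU.
have [wA|wA] := boolP (w \in A); have [wB|wB] := boolP (w \in B);
  rewrite ?addr0 ?add0r//.
have : (A `&` B) w by split; apply: set_mem.
by rewrite AB.
Qed.

(** Processes below g can be glued along disjoint events. *)
Lemma positive_partU g (A B : set Omega) : continuous g ->
  (forall t, 0 <= g t) -> measurable A -> measurable B -> A `&` B = set0 ->
  positive_part g (A `|` B) = positive_part g A + positive_part g B.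
Proof.
move=> cg g0 mA mB AB; apply/eqP; rewrite eq_le; apply/andP; split.
  apply: positive_part_le => // z bz; have hz := below_LooC cg bz.
  rewrite restrict_processU// bfD; [|exact: LooC_restrict|exact: LooC_restrict].
  by rewrite lerD// positive_part_ub.
rewrite -lerBrDr; apply: positive_part_le => // z bz.
rewrite lerBrDr -lerBrDl; apply: positive_part_le => // x bx.
rewrite lerBrDl; have hz := below_LooC cg bz; have hx := below_LooC cg bx.
pose v := restrict_process A z + restrict_process B x.
have bv : below g v.
  have [cz zg] := bz; have [cx xg] := bx; split.
    by apply: continuous_processD; apply: continuous_processM => //;
      exact: measurable_indic.
  move=> w t; rewrite -[v w t]/(\1_A w * z w t + \1_B w * x w t) !indicE.
  have [wA|wA] := boolP (w \in A); have [wB|wB] := boolP (w \in B);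
    rewrite ?mul1r ?mul0r ?addr0 ?add0r ?zg ?xg ?lexx ?g0//.
  have : (A `&` B) w by split; apply: set_mem.
  by rewrite AB.
have -> : Phi (restrict_process A z) + Phi (restrict_process B x) =
    Phi (restrict_process (A `|` B) v).
  rewrite -bfD; [|exact: LooC_restrict|exact: LooC_restrict].
  congr Phi; apply/funext => w; apply/funext => t.
  rewrite /restrict_process -[v w t]/(\1_A w * z w t + \1_B w * x w t).
  rewrite -[LHS]/(\1_A w * z w t + \1_B w * x w t) !indicE in_setU.
  have [wA|wA] := boolP (w \in A); have [wB|wB] := boolP (w \in B);
    rewrite ?mul1r ?mul0r ?addr0 ?add0r//.
apply: positive_part_ub => //; exact: measurableU.
Qed.

Lemma positive_part0 g : continuous g -> (forall t, 0 <= g t) ->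
  positive_part g set0 = 0.
Proof.
move=> cg g0; have := positive_partU cg g0 measurable0 measurable0 (setI0 _).
by rewrite setU0 => /eqP; rewrite -subr_eq0 opprD addrA subrr sub0r oppr_eq0 => /eqP.
Qed.

Section measure.
Variables (g : time T0 -> R) (cg : continuous g) (g0 : forall t, 0 <= g t).

(** The sign of positive_part is only under control on measurable sets. The two
    proofs are arguments, from which the structure of a measure is inferred. *)
Definition positive_part_measure (_ : continuous g) (_ : forall t, 0 <= g t)
    (A : set Omega) : \bar R :=
  if A \in (@measurable _ Omega) then (positive_part g A)%:E else 0%E.

Local Notation m := (positive_part_measure cg g0).

Lemma positive_part_measureE (A : set Omega) : measurable A ->
  m A = (positive_part g A)%:E.
Proof. by move=> mA; rewrite /positive_part_measure mem_set. Qed.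

Let m0 : m set0 = 0%E.
Proof. by rewrite positive_part_measureE// positive_part0. Qed.

Let m_ge0 A : (0 <= m A)%E.
Proof.
rewrite /positive_part_measure; case: ifPn => // /set_mem mA.
by rewrite lee_fin positive_part_ge0.
Qed.

Let m_sigma_additive : semi_sigma_additive m.
Proof.
move=> F mF tF mU.
pose U n := \big[setU/set0]_(i < n) F i.
have mUn n : measurable (U n) by exact: bigsetU_measurable.
have UF n : U n `<=` \bigcup_k F k.
  by rewrite /U -bigcup_mkord => w [k _ Fk]; exists k.
have sumE n : \sum_(i < n) positive_part g (F i) = positive_part g (U n).
  elim: n => [|n ih]; first by rewrite /U !big_ord0 positive_part0.
  rewrite big_ord_recr/= ih /U big_ord_recr/= positive_partU//.
    exact: bigsetU_measurable.
  rewrite -bigcup_mkord; apply/seteqP; split=> w // -[[k /= kn Fk] Fn].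
  have := tF _ _ I I (ex_intro _ w (conj Fk Fn)) => kE.
  by rewrite kE ltnn in kn.
(* The remainders decrease to the empty set, so that the seminorms of their
   indicators tend to 0. *)
pose V n := (\bigcup_k F k) `\` U n.
have mV n : measurable (V n) by exact: measurableD.
have rest n : positive_part g (\bigcup_k F k) =
    positive_part g (U n) + positive_part g (V n).
  rewrite -positive_partU//; first by rewrite /V setDUK.
  by rewrite /V setIDA setIC -setIDA setDv setI0.
rewrite [m (\bigcup_n F n)]positive_part_measureE//; apply/fine_cvgP; split.
  apply: nearW => n; rewrite sum_fin_num; apply/allP => _ /mapP[i _ ->].
  by rewrite positive_part_measureE.
rewrite (_ : fine \o _ = fun n => positive_part g (\bigcup_k F k) - positive_part g (V n)).
  rewrite -[X in _ --> X]subr0; apply: cvgB; first exact: cvg_cst.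
  have [C C0 hC] := positive_part_bound.
  apply: (@squeeze_cvgr _ _ _ _ (cst 0) (fun n => C * (path_norm g * fine (p \1_(V n))))).
  - apply: nearW => n; rewrite positive_part_ge0//=; exact: hC.
  - exact: cvg_cst.
  - rewrite -[X in _ --> X](mulr0 C); apply: cvgMl_tmp.
    rewrite -[X in _ --> X](mulr0 (path_norm g)); apply: cvgMl_tmp.
    have /fine_cvgP[_] : (fun n => p \1_(V n)) @ \oo --> 0%:E; last exact.
    apply: (admissible_cvg0 ap) => [n|]; first exact: indic_Loo.
    apply: nearW => w; split.
      move=> i j ij; rewrite /= !indicE; case: (boolP (w \in V j)) => // /set_mem[Fw nU].
      rewrite mem_set//; split => // Ui; apply: nU; move: Ui.
      rewrite /U -!bigcup_mkord => -[k /= ki Fk]; exists k => //=.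
      exact: leq_trans ij.
    apply: cvg_near_cst.
    have [[k _ Fk]|nF] := pselect ((\bigcup_k F k) w).
      exists k.+1 => // n /= kn; rewrite indicE memNset// => -[_]; apply.
      by rewrite /U -bigcup_mkord; exists k.
    by apply: nearW => n; rewrite indicE memNset// => -[].
apply/funext => n /=; rewrite (rest n) addrK -sumE big_mkord -sum_fine/=.
  by apply: eq_bigr => i _; rewrite positive_part_measureE.
by move=> i _; rewrite positive_part_measureE.
Qed.

HB.instance Definition _ := isMeasure.Build _ _ _ m
  m0 m_ge0 m_sigma_additive.

Let m_fin : fin_num_fun m.
Proof. by move=> A mA; rewrite positive_part_measureE. Qed.

HB.instance Definition _ := @Measure_isFinite.Build _ _ _ m m_fin.

(** The density is that of Radon and Nikodym: the indicator of an event of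
    probability 0 has seminorm 0. *)
Lemma positive_part_density : exists h : Omega -> R,
  [/\ forall w, 0 <= h w, P.-integrable setT (EFin \o h) &
      forall A, measurable A ->
        (\int[P]_(w in A) (h w)%:E)%E = (positive_part g A)%:E].
Proof.
have dom : m `<< P.
  apply/null_content_dominatesP => A mA PA0.
  rewrite positive_part_measureE//; congr EFin.
  apply/eqP; rewrite eq_le positive_part_ge0// andbT.
  have [C C0 hC] := positive_part_bound; apply: (le_trans (hC _ _ cg g0 mA)).
  rewrite (_ : fine (p \1_A) = 0) ?mulr0//.
  apply/eqP; rewrite eq_le fine_admissible_ge0 ?indic_Loo// andbT.
  rewrite -[leRHS](_ : fine (p 0) = 0); last by rewrite (admissible0 ap).
  apply: fine_admissible_mono; first exact: indic_Loo.
    by apply: Lfun0; rewrite leey.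
  exists A; split => // w /=; apply: contra_notP => nA.
  by rewrite indicE memNset// normr0.
have [h [h0 hfin hi hE]] := radon_nikodym_sigma_finite (mu := P) (nu := m) dom.
exists (fine \o h); split.
- by move=> w; rewrite fine_ge0.
- rewrite (_ : EFin \o _ = h)//; apply/funext => w /=; exact: fineK.
- move=> A mA; rewrite -positive_part_measureE// hE//.
  by apply: eq_integral => w _; rewrite fineK.
Qed.

End measure.

End positive_part.

(** * Random measures from the masses of ramps *)

Section ranks.
Context d (Omega : measurableType d) (R : realType).
Variables (K : nat -> nat -> Omega -> R) (Kt : Omega -> R).

(** K n i stands for the mass which a random measure on the unit interval
    gives to the ramp that descends from 1 to 0 between the nodes i and i + 1
    of the dyadic grid of level n. *)
Record ramp_masses : Prop := {
  rm_measurable : forall n i, measurable_fun setT (K n i) ;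
  rm_ge0 : forall n i w, 0 <= K n i w ;
  rm_mono : forall n i w, K n i w <= K n i.+1 w ;
  rm_total : forall n w, K n (2 ^ n) w = Kt w ;
  rm_refine : forall n i w, K n.+1 i.*2 w <= K n i w <= K n.+1 i.*2.+1 w }.

Hypothesis HK : ramp_masses.

Definition rank n w s : nat := \sum_(i < 2 ^ n) (K n i w < s)%R.

(** The quantile function of the measure which puts the mass of each hat of
    level n on its node. *)
Definition level_quantile n w s : R := grid R n (rank n w s).

Lemma rm_homo n w : {homo (fun i => K n i w) : i j / (i <= j)%N >-> i <= j}.
Proof. by apply: homo_leq => // [x y z|i]; [exact: le_trans|exact: rm_mono]. Qed.

Lemma rank_telescope n w s (x : nat -> R) : x (rank n w s) =
  x 0%N + \sum_(i < 2 ^ n) (K n i w < s)%R%:R * (x i.+1 - x i).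
Proof.
rewrite /rank; elim: (2 ^ n)%N => [|M ih]; first by rewrite !big_ord0 addr0.
rewrite !big_ord_recr /= addrA -ih.
case: (ltP (K n M w) s) => [lt|_]; last by rewrite addn0 mul0r addr0.
rewrite mul1r (_ : \sum_(i < M) _ = M)%N; first by rewrite addn1 addrC subrK.
rewrite -[RHS]card_ord -sum1_card; apply: eq_bigr => i _.
by rewrite (le_lt_trans _ lt)//; apply: rm_homo; exact: ltnW.
Qed.

Lemma sum_double (a : nat -> nat) M :
  (\sum_(i < M.*2) a i = \sum_(i < M) (a i.*2 + a i.*2.+1))%N.
Proof.
elim: M => [|M ih]; first by rewrite !big_ord0.
by rewrite doubleS !big_ord_recr/= ih addnA.
Qed.

(** By the interlacing of the masses, the even indices of the finer grid
    contribute the rank of the coarser one or one more, and the odd indices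
    contribute it or one less. *)
Lemma rank_refine n w s :
  (rank n.+1 w s <= (rank n w s).*2.+1)%N /\ ((rank n w s).*2 <= (rank n.+1 w s).+1)%N.
Proof.
pose a i : nat := (K n i w < s)%R; pose b j : nat := (K n.+1 j w < s)%R.
have imp (x y : R) : x <= y -> (nat_of_bool (y < s)%R <= nat_of_bool (x < s)%R)%N.
  by move=> xy; case: (ltP y s) => // ys; rewrite (le_lt_trans xy ys).
have ab i : (a i <= b i.*2)%N by apply: imp; have /andP[] := rm_refine HK n i w.
have ba i : (b i.*2.+1 <= a i)%N by apply: imp; have /andP[] := rm_refine HK n i w.
have bS j : (b j.+1 <= b j)%N by apply: imp; exact: rm_mono.
have -> : rank n.+1 w s = (\sum_(i < 2 ^ n) (b i.*2 + b i.*2.+1))%N.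
  by rewrite /rank -sum_double expnS mul2n.
have -> : rank n w s = (\sum_(i < 2 ^ n) a i)%N by [].
rewrite big_split /=; set M := (2 ^ n)%N.
have h1 : (\sum_(i < M) b i.*2.+1 <= \sum_(i < M) a i)%N by apply: leq_sum.
have h2 : (\sum_(i < M) b i.*2 <= 1 + \sum_(i < M) a i)%N.
  apply: (@leq_trans (\sum_(i < M.+1) b i.*2)); first by rewrite big_ord_recr/= leq_addr.
  rewrite big_ord_recl/= leq_add ?leq_b1//; apply: leq_sum => i _.
  by rewrite /= /bump/= add1n doubleS (leq_trans (bS _)).
have h3 : (\sum_(i < M) a i <= \sum_(i < M) b i.*2)%N by apply: leq_sum.
have h4 : (\sum_(i < M) a i <= 1 + \sum_(i < M) b i.*2.+1)%N.
  apply: (@leq_trans (\sum_(i < M.+1) a i)); first by rewrite big_ord_recr/= leq_addr.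
  rewrite big_ord_recl/= leq_add ?leq_b1//; apply: leq_sum => i _.
  rewrite /= /bump/= add1n (leq_trans (ab _))// doubleS; exact: bS.
move: h1 h2 h3 h4.
move: (\sum_(i < M) a i)%N (\sum_(i < M) b i.*2)%N (\sum_(i < M) b i.*2.+1)%N => A B C.
by rewrite -!addnn; split; lia.
Qed.

Lemma level_quantile_step n w s :
  `|level_quantile n w s - level_quantile n.+1 w s| <= 2 ^- n.+1.
Proof.
have [h1 h2] := rank_refine n w s.
rewrite /level_quantile /grid; set a := rank n w s; set b := rank n.+1 w s.
have -> : a%:R / 2 ^+ n - b%:R / 2 ^+ n.+1 = (a.*2%:R - b%:R) / 2 ^+ n.+1 :> R.
  rewrite mulrBl; congr (_ - _); rewrite exprS invfM mulrA -muln2 natrM.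
  by rewrite mulfK.
rewrite normrM [X in _ * X]ger0_norm ?invr_ge0 ?exprn_ge0//.
rewrite ler_piMl ?invr_ge0 ?exprn_ge0// ler_norml lerBrDr lerBlDl addrC lerBlDr.
by rewrite !natr1 !ler_nat h1 h2.
Qed.

Lemma level_quantile_dist n m w s : (n <= m)%N ->
  `|level_quantile n w s - level_quantile m w s| <= 2 ^- n.
Proof.
move=> nm; apply: (@le_trans _ _ (2 ^- n - 2 ^- m)); last first.
  by rewrite gerBl invr_ge0 exprn_ge0.
elim: m nm => [|m ih]; first by rewrite leqn0 => /eqP ->; rewrite !subrr normr0.
rewrite leq_eqVlt => /predU1P[->|]; first by rewrite !subrr normr0.
rewrite ltnS => nm; rewrite (le_trans (ler_distD (level_quantile m w s) _ _))//.
apply: le_trans (lerD (ih nm) (level_quantile_step m w s)) _.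
have : 2 ^- m = 2 * 2 ^- m.+1 :> R by rewrite exprS invfM mulrA divff// mul1r.
by move: (2 ^- n) (2 ^- m) (2 ^- m.+1) => x y z; lra.
Qed.

Definition quantile w s : R := limn (fun n => level_quantile n w s).

Lemma quantile_cvg w s : level_quantile n w s @[n --> \oo] --> quantile w s.
Proof.
apply/cauchy_cvgP; apply: cauchy_exP => e e0.
have [N _ hN] := near_half_pow e0.
exists (level_quantile N w s); exists N => // m /= Nm.
rewrite /ball /= (le_lt_trans (level_quantile_dist _ _ Nm))//.
exact: (hN _ (leqnn N)).
Qed.

Lemma measurable_level_quantile n : measurable_fun setT
  (fun x : Omega * R => level_quantile n x.1 x.2).
Proof.
rewrite /level_quantile /grid.
apply: measurable_funM => //.
under eq_fun do rewrite /rank natr_sum.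
apply: measurable_sum => i.
pose B := [set x : Omega * R | K n i x.1 < x.2].
have mB : measurable B.
  have := @measurable_fun_ltr _ _ _ setT (fun x : Omega * R => K n i x.1) snd.
  move=> /(_ _ _ measurableT [set true] I); rewrite setTI; apply => //.
  by apply: measurableT_comp => //; exact: (rm_measurable HK).
rewrite (_ : (fun x => _) = \1_B); first exact: measurable_indic.
apply/funext => x; rewrite indicE /B; congr (_%:R).
congr nat_of_bool; by apply/idP/idP => [h|/set_mem//]; rewrite mem_set.
Qed.

Lemma measurable_quantile : measurable_fun setT
  (fun x : Omega * R => quantile x.1 x.2).
Proof.
apply: (measurable_fun_cvg (h := fun n x => level_quantile n x.1 x.2)).
  exact: measurable_level_quantile.
by move=> x _; exact: quantile_cvg.
Qed.

End ranks.

Section quantile_measure.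
Context d (Omega : measurableType d) (R : realType).
Context (T : \bar R) (T0 : (0 < T)%E).
Variables (K : nat -> nat -> Omega -> R) (Kt : Omega -> R).
Hypothesis HK : ramp_masses K Kt.

Let Kt0 w : 0 <= Kt w.
Proof. by rewrite -(rm_total HK 0); exact: (rm_ge0 HK). Qed.

Lemma rm_le_total n i w : (i <= 2 ^ n)%N -> K n i w <= Kt w.
Proof. by move=> i2; rewrite -(rm_total HK n); exact: (rm_homo HK). Qed.

Definition quantile_levels (k : R) : set (measurableTypeR R) := `]0, k]%classic.

Lemma measurable_quantile_levels k : measurable (quantile_levels k).
Proof. exact: measurable_itv. Qed.

Lemma quantile_levels_lty k : (@lebesgue_measure R (quantile_levels k) < +oo)%E.
Proof. by rewrite lebesgue_measure_itv; case: ifPn => //= _; rewrite -EFinB ltry. Qed.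

Definition level_measure k : {finite_measure set (measurableTypeR R) -> \bar R} :=
  mfrestr (measurable_quantile_levels k) (quantile_levels_lty k).

Lemma level_measure_gt k a : 0 <= a <= k ->
  level_measure k [set s | a < s] = (k - a)%:E.
Proof.
move=> /andP[a0 ak].
rewrite -[LHS]/(@lebesgue_measure R ([set s : R | a < s] `&` quantile_levels k)).
rewrite (_ : _ `&` _ = `]a, k]%classic); last first.
  apply/seteqP; split => s /=; rewrite /quantile_levels/= !in_itv/=.
    by move=> [-> /andP[_ ->]].
  by move=> /andP[as_ ->]; rewrite as_ (le_lt_trans a0 as_).
rewrite lebesgue_measure_itv/= lte_fin; case: ifPn => [_|]; first by rewrite EFinB.
by rewrite -leNgt => ka; congr EFin; lra.
Qed.

Lemma level_measureT k : 0 <= k -> level_measure k setT = k%:E.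
Proof.
move=> k0; rewrite -[LHS]/(@lebesgue_measure R (setT `&` quantile_levels k)).
rewrite setTI lebesgue_measure_itv/= lte_fin; case: ifPn => [_|].
  by rewrite sube0.
by rewrite -leNgt => k0'; congr EFin; lra.
Qed.

Let position w (s : measurableTypeR R) : time T0 := node T0 (quantile K w s).

Let measurable_position w : measurable_fun setT (position w).
Proof.
apply: measurableT_comp; first exact: node_measurable.
exact: (measurableT_comp (measurable_quantile HK) (pair1_measurable w)).
Qed.

(** The image of Lebesgue measure on the levels ]0, Kt w] under the quantile
    function. The proof is an argument, from which the structure of a finite
    measure is inferred. *)
Definition quantile_measure & ramp_masses K Kt := fun w =>
  pushforward (level_measure (Kt w)) (position w).

Section measure.
Variable w : Omega.

Local Notation m := (quantile_measure HK w).

Let measurable_position_preimage (A : set (time T0)) : measurable A ->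
  measurable (position w @^-1` A).
Proof. by move=> mA; rewrite -[X in measurable X]setTI; exact: measurable_position. Qed.

Let m0 : m set0 = 0%E.
Proof. by rewrite /quantile_measure /pushforward preimage_set0 measure0. Qed.

Let m_ge0 A : (0 <= m A)%E.
Proof. exact: measure_ge0. Qed.

Let m_sigma_additive : semi_sigma_additive m.
Proof.
move=> F mF tF mU; rewrite /quantile_measure /pushforward preimage_bigcup.
apply: measure_semi_sigma_additive.
- by move=> n; exact: measurable_position_preimage.
- apply/trivIsetP => /= i j _ _ ij; rewrite -preimage_setI.
  by move/trivIsetP : tF => /(_ _ _ _ _ ij) ->//; rewrite preimage_set0.
- by rewrite -preimage_bigcup; exact: measurable_position_preimage.
Qed.

HB.instance Definition _ := isMeasure.Build _ _ _ m
  m0 m_ge0 m_sigma_additive.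

Let m_fin : fin_num_fun m.
Proof.
move=> A mA; rewrite /quantile_measure /pushforward fin_num_measure//.
exact: measurable_position_preimage.
Qed.

HB.instance Definition _ := @Measure_isFinite.Build _ _ _ m m_fin.

End measure.

Lemma quantile_measureT w : quantile_measure HK w setT = (Kt w)%:E.
Proof.
by rewrite /quantile_measure /pushforward preimage_setT level_measureT.
Qed.

Lemma measurable_quantile_measure (A : set (time T0)) : measurable A ->
  measurable_fun setT (fun w => quantile_measure HK w A).
Proof.
move=> mA.
pose B := [set x : Omega * measurableTypeR R |
  0 < x.2 /\ x.2 <= Kt x.1 /\ A (position x.1 x.2)].
have mKt : measurable_fun setT Kt.
  rewrite (_ : Kt = K 0 (2 ^ 0)%N); first exact: (rm_measurable HK).
  by apply/funext => w; rewrite (rm_total HK).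
have mB : measurable B.
  rewrite (_ : B = [set x | 0 < x.2] `&` ([set x | x.2 <= Kt x.1] `&`
      (fun x => position x.1 x.2) @^-1` A)); last by apply/seteqP; split.
  apply: measurableI; last apply: measurableI.
  - have := @measurable_fun_ltr _ _ _ setT (cst 0) (fun x : Omega * measurableTypeR R => x.2).
    move=> /(_ _ _ measurableT [set true] I); rewrite setTI; apply => //.
    exact: measurable_snd.
  - have := @measurable_fun_ler _ _ _ setT (fun x : Omega * measurableTypeR R => x.2) (fun x => Kt x.1).
    move=> /(_ _ _ measurableT [set true] I); rewrite setTI; apply => //.
      exact: measurable_snd.
    exact: measurableT_comp.
  - rewrite -[X in measurable X]setTI.
    suff : measurable_fun setT (fun x : Omega * measurableTypeR R => position x.1 x.2) by apply.
    apply: measurableT_comp; first exact: node_measurable.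
    exact: (measurable_quantile HK).
rewrite (_ : (fun w => _) = (@lebesgue_measure R \o xsection B)).
  exact: measurable_fun_xsection.
apply/funext => w /=.
rewrite -[LHS]/(@lebesgue_measure R (position w @^-1` A `&` quantile_levels (Kt w))).
congr lebesgue_measure; apply/seteqP; split => s.
  rewrite /quantile_levels /= in_itv/= => -[As /andP[s0 sK]].
  by apply/xsectionP.
by move/xsectionP => [s0 [sK As]]; split => //; rewrite /quantile_levels /= in_itv/= s0.
Qed.

(** By summation by parts, this is the sum of the values x i weighted by the
    masses of the hats: the integral of the interpolation of x. *)
Definition ramp_sum n (x : nat -> R) w : R :=
  x (2 ^ n)%N * Kt w - \sum_(i < 2 ^ n) (x i.+1 - x i) * K n i w.

(** The rank passes i at the level K n i w, and the levels beyond have measure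
    Kt w - K n i w. *)
Lemma level_integral n (x : nat -> R) w :
  \int[level_measure (Kt w)]_s (x (rank K n w s)) = ramp_sum n x w.
Proof.
have mi i : measurable [set s : measurableTypeR R | K n i w < s].
  rewrite (_ : [set s | _] = `]K n i w, +oo[%classic); first exact: measurable_itv.
  by apply/seteqP; split => s /=; rewrite in_itv/= andbT.
pose f i (s : measurableTypeR R) := (x i.+1 - x i) * \1_[set s : measurableTypeR R | K n i w < s] s.
have fi i : (level_measure (Kt w)).-integrable setT (EFin \o f i).
  rewrite (_ : _ \o _ = (fun s => (x i.+1 - x i)%:E *
      (\1_[set s : measurableTypeR R | K n i w < s] s)%:E)%E).
    by apply: integrableZl => //; exact: integrable_indic.
  by apply/funext => s /=; rewrite EFinM.
have E s : x (rank K n w s) = x 0%N + \sum_(i < 2 ^ n) f i s.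
  rewrite (rank_telescope HK); congr (_ + _); apply: eq_bigr => i _.
  rewrite mulrC /f indicE; congr (_ * _%:R); congr nat_of_bool.
  by apply/idP/idP => [h|/set_mem//]; rewrite mem_set.
under eq_Rintegral do rewrite E.
have [si sE] := Rintegral_sum (index_enum 'I_(2 ^ n)) (fun i => fi (val i)).
rewrite RintegralD//; last exact: finite_measure_integrable_cst.
have -> : \int[level_measure (Kt w)]_s (x 0%N) = x 0%N * Kt w.
  rewrite [LHS]Rintegral_cst//; congr (_ * _).
  exact: (congr1 fine (level_measureT (Kt0 w))).
rewrite [X in _ + X]sE.
have -> : \sum_(i < 2 ^ n) \int[level_measure (Kt w)]_s f i s =
    \sum_(i < 2 ^ n) ((x i.+1 - x i) * Kt w - (x i.+1 - x i) * K n i w).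
  apply: eq_bigr => i _; rewrite RintegralZl//; last exact: integrable_indic.
  rewrite -mulrBr; congr (_ * _); rewrite /Rintegral integral_indic// setIT.
  have itv : 0 <= K n i w <= Kt w.
    by rewrite (rm_ge0 HK) rm_le_total// ltnW.
  exact: (congr1 fine (level_measure_gt itv)).
rewrite sumrB -mulr_suml /ramp_sum addrA -mulrDl; congr (_ * _ - _).
have := telescope_sumr x (leq0n (2 ^ n)); rewrite big_mkord => ->.
by rewrite addrC subrK.
Qed.

Lemma quantile_measure_integral w g : continuous g ->
  ramp_sum n (sample n g) w @[n --> \oo] --> \int[quantile_measure HK w]_t g t.
Proof.
move=> cg.
have mg := continuous_measurable_time cg.
have -> : \int[quantile_measure HK w]_t g t =
    \int[level_measure (Kt w)]_s g (position w s).
  congr fine; apply: (integral_pushforward (measurable_position w)) => //.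
    exact/measurable_EFinP.
  apply: measurable_bounded_integrable => //.
  - by rewrite preimage_setT.
  - apply: (@le_lt_trans _ _ (Kt w)%:E); last exact: ltry.
    by have /eqP := level_measureT (Kt0 w); rewrite eq_le => /andP[].
  - by apply: measurable_funTS; exact: measurableT_comp.
  - exists (path_norm g); split; first exact: num_real.
    by move=> M gM t _ /=; rewrite (le_trans (path_norm_ub _ cg))// ltW.
rewrite (_ : (fun n => _) = (fun n =>
    \int[level_measure (Kt w)]_s sample n g (rank K n w s))); last first.
  by apply/funext => n; rewrite level_integral.
apply: (@Rintegral_dominated_cvg _ _ _ (level_measure (Kt w)) _ _ (cst (path_norm g)) _ _ _ _ _).2.
- move=> n; apply: (measurableT_comp (f := g)) => //.
  apply: measurableT_comp; first exact: node_measurable.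
  exact: (measurableT_comp (measurable_level_quantile HK n) (pair1_measurable w)).
- exact: finite_measure_integrable_cst.
- apply: nearW => s.
  have cn : continuous (fun r => g (node T0 r)).
    move=> r; apply: (@continuous_comp R (time T0) R (node T0) g).
      exact: node_continuous.
    exact: cg.
  exact: (cvg_comp _ _ (@quantile_cvg _ _ _ _ _ HK w s) (cn (quantile K w s))).
- exact: measurableT_comp.
- by move=> n; apply: nearW => s; exact: path_norm_ub.
Qed.

End quantile_measure.

(** * Representation of bounded functionals *)

Section comparison.
Context d (Omega : measurableType d) (R : realType) (P : probability Omega R).
Implicit Types (h : Omega -> R).

(** Compare the integrals over the event that h1 exceeds h2. *)
Lemma ae_le_integrals h1 h2 : P.-integrable setT (EFin \o h1) ->
  P.-integrable setT (EFin \o h2) ->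
  (forall A, measurable A ->
    (\int[P]_(w in A) (h1 w)%:E <= \int[P]_(w in A) (h2 w)%:E)%E) ->
  {ae P, forall w, h1 w <= h2 w}.
Proof.
move=> i1 i2 le12.
have m1 : measurable_fun setT h1 by apply/measurable_EFinP; case/integrableP: i1.
have m2 : measurable_fun setT h2 by apply/measurable_EFinP; case/integrableP: i2.
pose A := [set w | h2 w < h1 w].
have mA : measurable A.
  have := measurable_fun_ltr m2 m1 measurableT (Y := [set true]) I.
  by rewrite setTI.
have Ai1 : P.-integrable A (EFin \o h1) by exact: integrableS i1.
have Ai2 : P.-integrable A (EFin \o h2) by exact: integrableS i2.
have A0 : (\int[P]_(w in A) `|(h1 w - h2 w)%:E| = 0)%E.
  apply/eqP; rewrite eq_le integral_ge0// andbT.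
  rewrite (eq_integral (fun w => (h1 w)%:E - (h2 w)%:E)%E); last first.
    by move=> w /set_mem Aw; rewrite /= ger0_norm ?EFinB// subr_ge0 ltW.
  rewrite integralB_EFin// leeBlDr ?add0e ?le12//.
  exact: (integrable_fin_num mA Ai2).
have [|N [mN PN hN]] := (ae_eq_integral_abs P mA _).1 A0.
  by apply: measurable_funTS; apply/measurable_EFinP; exact: measurable_funB.
exists N; split => // w /= /negP; rewrite -ltNge => Aw; apply: hN => /=.
by move=> /(_ Aw) /eqP; rewrite eqe subr_eq0 gt_eqF.
Qed.

Lemma ae_measurable (Q : Omega -> Prop) : {ae P, forall w, Q w} ->
  exists G, [/\ measurable G, P (~` G) = 0%E & forall w, G w -> Q w].
Proof.
move=> [N [mN PN QN]]; exists (~` N); split.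
- exact: measurableC.
- by rewrite setCK.
- by move=> w nN; apply: contrapT => nQ; apply: nN; exact: QN.
Qed.

End comparison.

Section dominated.
Context d (Omega : measurableType d) (R : realType) (P : probability Omega R).
Variables (p : (Omega -> R) -> \bar R).
Hypothesis ap : admissible P p.

(** The sequence is dominated by its tail suprema, which decrease to 0. *)
Lemma admissible_dominated_cvg (dist : nat -> Omega -> R) (eta : Omega -> R) :
  eta \in Lfun P +oo%E -> (forall n, measurable_fun setT (dist n)) ->
  (forall n w, 0 <= dist n w <= eta w) ->
  (forall w, dist n w @[n --> \oo] --> 0) ->
  fine (p (dist n)) @[n --> \oo] --> 0.
Proof.
move=> heta md d0 dcvg.
pose e n w := sups (dist ^~ w) n.
have ub w : has_ubound (range (dist ^~ w)).
  by exists (eta w) => _ [n _ <-]; have /andP[] := d0 n w.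
have de n w : dist n w <= e n w.
  by apply: ub_le_sup; [exact/has_ubound_sdrop/ub|exists n => /=].
have eeta n w : e n w <= eta w.
  apply: ge_sup; first by exists (dist n w), n => /=.
  by move=> _ [k /= _ <-]; have /andP[] := d0 k w.
have e0 n w : 0 <= e n w by rewrite (le_trans _ (de n w))//; have /andP[] := d0 n w.
have me n : measurable_fun setT (e n).
  by apply: measurable_fun_sups => [w _|m]; [exact: ub|exact: md].
have eoo n : e n \in Lfun P +oo%E.
  apply: Lfun_dominated heta _; rewrite ?leey// => w.
  by rewrite !ger0_norm// (le_trans (e0 n w)).
have doo n : dist n \in Lfun P +oo%E.
  apply: Lfun_dominated (eoo n) _; rewrite ?leey// => w.
  by rewrite !ger0_norm//; have /andP[] := d0 n w.
have /fine_cvgP[_ pe] : (fun n => p (e n)) @ \oo --> 0%:E.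
  apply: (admissible_cvg0 ap) => //; apply: nearW => w; split.
    exact: nonincreasing_sups.
  by have := cvg_sups (dcvg w).
apply: (squeeze_cvgr _ (cvg_cst 0) pe); apply: nearW => n.
rewrite fine_ge0 ?(admissible_ge0 ap) ?Loo_sub_L1//=.
rewrite fine_le ?(fin_num_admissible ap)//; apply: (admissible_mono ap).
- exact: Loo_sub_L1.
- exact: Loo_sub_L1.
- by apply: nearW => w; rewrite !ger0_norm//; have /andP[] := d0 n w.
Qed.

End dominated.

(** The sum is the minimum of N and the integer part of x. *)
Lemma layer_sum (R : realType) N (x : R) : 0 <= x ->
  let s := \sum_(j < N) (j.+1%:R <= x)%R%:R in
  s <= x /\ (x <= N%:R -> x <= s + 1).
Proof.
move=> x0 /=; elim: N => [|N [ih1 ih2]].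
  by rewrite big_ord0; split => // x0'; rewrite add0r (le_trans x0').
rewrite big_ord_recr /=.
have full (M : nat) : M%:R <= x -> \sum_(j < M) (j.+1%:R <= x)%R%:R = M%:R :> R.
  move=> Mx; rewrite (eq_bigr (fun=> 1)) ?sumr_const ?card_ord// => j _.
  by rewrite (le_trans _ Mx)// ler_nat.
have [Nx|xN] := leP N.+1%:R x.
  rewrite full; last by rewrite (le_trans _ Nx)// ler_nat.
  by rewrite natr1; split => // /le_trans; apply; rewrite lerDl.
rewrite addr0; split => // _; have [/ih2//|Nx] := leP x N%:R.
by rewrite full ?natr1; exact: ltW.
Qed.

Section density.
Context d (Omega : measurableType d) (R : realType) (P : probability Omega R).
Variables (L : (Omega -> R) -> R) (k : Omega -> R).
Implicit Types (xi eta : Omega -> R).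

(** Both sides are linear and continuous for the essential supremum norm, and
    they agree on indicator functions, whose linear combinations are dense. *)
Lemma functional_density :
  (forall (a : R) xi eta, xi \in Lfun P +oo%E -> eta \in Lfun P +oo%E ->
    L (a *: xi + eta) = a * L xi + L eta) ->
  (exists2 C : R, 0 <= C & forall xi (M : R), xi \in Lfun P +oo%E -> 0 <= M ->
    {ae P, forall w, `|xi w| <= M} -> `|L xi| <= C * M) ->
  P.-integrable setT (EFin \o k) ->
  (forall A, measurable A -> (\int[P]_(w in A) (k w)%:E)%E = (L \1_A)%:E) ->
  forall xi, xi \in Lfun P +oo%E -> L xi = \int[P]_w (xi w * k w).
Proof.
move=> Llin [C C0 hC] ik Lind xi hxi.
have L1k : k \in Lfun P 1 by exact/Lfun1_integrable.
have ixk eta : eta \in Lfun P +oo%E -> P.-integrable setT (EFin \o (eta \* k)).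
  by move=> h; apply/Lfun1_integrable; exact: Loo_mul_L1.
pose D eta := L eta - \int[P]_w (eta w * k w).
have Dlin a x y : x \in Lfun P +oo%E -> y \in Lfun P +oo%E ->
    D (a *: x + y) = a * D x + D y.
  move=> hx hy; rewrite /D Llin//.
  rewrite (_ : \int[P]_w _ = a * \int[P]_w (x w * k w) + \int[P]_w (y w * k w)).
    by rewrite mulrBr opprD !addrA; congr (_ - _); rewrite addrAC.
  rewrite -RintegralZl//; last exact: ixk.
  rewrite -RintegralD//; last exact: ixk.
    apply: eq_Rintegral => w _.
    by rewrite -[(a *: x + y) w]/(a * x w + y w) mulrDl mulrA.
  rewrite (_ : EFin \o _ = (fun w => a%:E * ((x \* k) w)%:E)%E).
    by apply: integrableZl => //; exact: ixk.
  by apply/funext => w /=; rewrite EFinM.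
have D0 : D 0 = 0.
  have h0 : (0 : Omega -> R) \in Lfun P +oo%E by apply: Lfun0; rewrite leey.
  by have := Dlin (-1) _ _ h0 h0; rewrite scaler0 addr0 mulN1r addNr.
have Dind A : measurable A -> D \1_A = 0.
  move=> mA; apply/eqP; rewrite subr_eq0; apply/eqP/EFin_inj.
  rewrite -Lind// integral_mkcond /Rintegral fineK; last first.
    by apply: integrable_fin_num => //; exact/ixk/indic_Loo.
  apply: eq_integral => w _; rewrite patchE indicE /=.
  by case: ifPn => _; rewrite ?mul1r ?mul0r.
have DlinI a x A : x \in Lfun P +oo%E -> measurable A ->
    D (a *: \1_A + x) = D x.
  by move=> hx mA; rewrite Dlin ?indic_Loo// Dind// mulr0 add0r.
have [N mN hN] : exists2 B : R, 0 <= B & forall eta (M : R), eta \in Lfun P +oo%E ->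
    0 <= M -> {ae P, forall w, `|eta w| <= M} -> `|D eta| <= B * M.
  exists (C + \int[P]_w `|k w|).
    by rewrite addr_ge0// Rintegral_ge0.
  move=> eta M heta M0 etaM; rewrite mulrDl (le_trans (ler_normB _ _))// lerD ?hC//.
  apply: (le_trans (le_normr_Rintegral measurableT (ixk _ heta))).
  rewrite mulrC -RintegralZl//; last first.
    by have := integrable_abse ik; apply: eq_integrable => // w _ /=; rewrite abse_EFin.
  have mk : measurable_fun setT k by apply/measurable_EFinP; case/integrableP: ik.
  have meta := Lfun_measurable heta.
  rewrite fine_le//.
  - apply: integrable_fin_num => //; have := integrable_abse (ixk _ heta).
    by apply: eq_integrable => // w _ /=; rewrite abse_EFin.
  - apply: integrable_fin_num => //.
    have := integrableZl measurableT M (integrable_abse ik).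
    by apply: eq_integrable => // w _ /=; rewrite EFinM abse_EFin.
  apply: ae_ge0_le_integral => //.
  - apply/measurable_EFinP/measurableT_comp => //; exact: measurable_funM.
  - by move=> w _; rewrite lee_fin mulr_ge0.
  - apply/measurable_EFinP/measurable_funM => //; exact: measurableT_comp.
  by apply: filterS etaM => w h _; rewrite lee_fin normrM ler_wpM2r.
have [M M0 xiM] := Lfun_bounded hxi.
have mxi := Lfun_measurable hxi.
suff small n : (0 < n)%N -> `|D xi| <= N * n%:R^-1.
  suff : D xi = 0 by move/eqP; rewrite subr_eq0 => /eqP.
  apply/eqP; rewrite -normr_eq0 eq_le normr_ge0 andbT leNgt; apply/negP => D0'.
  have nN : 0 <= N / `|D xi| by rewrite divr_ge0.
  have := archi_boundP nN; set b := Num.bound _; rewrite ltr_pdivrMr// => lt.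
  have b0 : (0 < b)%N.
    by case: b lt => //; rewrite mul0r ltNge mN.
  by have := small _ b0; rewrite ler_pdivlMr ?ltr0n// mulrC leNgt lt.
(* The value xi + M is rounded down to a multiple of n^-1. *)
move=> n0; pose A j := [set w | j.+1%:R <= n%:R * (xi w + M)].
have mA j : measurable (A j).
  have mf : measurable_fun setT (fun w => n%:R * (xi w + M)).
    by apply: measurable_funM => //; exact: measurable_funD.
  have mj : measurable_fun setT (fun _ : Omega => j.+1%:R : R) by exact: measurable_cst.
  have := measurable_fun_ler mj mf measurableT (Y := [set true]) I.
  by rewrite setTI.
pose m := (n * Num.bound (2 * M))%N.
pose x := - M *: (\1_setT : Omega -> R) + \sum_(j < m) n%:R^-1 *: \1_(A j).
have sumE q : (\sum_(j < q) n%:R^-1 *: (\1_(A j) : Omega -> R) \in Lfun P +oo%E) /\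
    forall y, y \in Lfun P +oo%E ->
    D (y - \sum_(j < q) n%:R^-1 *: (\1_(A j) : Omega -> R)) = D y.
  elim: q => [|q [ih1 ih2]].
    rewrite big_ord0; split; first by apply: Lfun0; rewrite leey.
    by move=> y _; rewrite subr0.
  rewrite big_ord_recr /=; split.
    by apply: LfunD; rewrite ?leey//; apply: LfunZ; rewrite ?leey//; exact: indic_Loo.
  move=> y hy; rewrite opprD addrA addrC -scaleNr DlinI ?ih2//.
  by apply: LfunD; rewrite ?leey// -scaleN1r; apply: LfunZ; rewrite ?leey.
have [hs Ds] := sumE m.
have hx : x \in Lfun P +oo%E.
  by apply: LfunD; rewrite ?leey//; apply: LfunZ; rewrite ?leey//; exact: indic_Loo.
have hMx : M *: (\1_setT : Omega -> R) + xi \in Lfun P +oo%E.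
  by apply: LfunD; rewrite ?leey//; apply: LfunZ; rewrite ?leey//; exact: indic_Loo.
have -> : D xi = D (xi - x).
  rewrite -(DlinI M xi setT)// -Ds//; congr D.
  by rewrite /x opprD addrA scaleNr opprK [xi + _]addrC.
apply: hN.
- by apply: LfunD; rewrite ?leey// -scaleN1r; apply: LfunZ; rewrite ?leey.
- by rewrite invr_ge0.
apply: filterS xiM => w; rewrite ler_norml => /andP[xiM1 xiM2].
have nr0 : 0 < n%:R :> R by rewrite ltr0n.
have y0 : 0 <= n%:R * (xi w + M) by rewrite mulr_ge0// -lerBlDr sub0r.
have [s1 s2] := layer_sum m y0.
have {s2}/s2 : n%:R * (xi w + M) <= m%:R.
  rewrite natrM ler_wpM2l//.
  have := archi_boundP (mulr_ge0 (ler0n R 2) M0).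
  by move=> /ltW; apply: le_trans; rewrite mulr_natl mulr2n lerD2r.
set s := \sum_(j < m) _ in s1 * => s2.
have -> : (xi - x) w = (n%:R * (xi w + M) - s) / n%:R.
  rewrite -[LHS]/(xi w - (- M *: (\1_setT : Omega -> R) + \sum_(j < m) n%:R^-1 *: \1_(A j)) w).
  have -> : (- M *: (\1_setT : Omega -> R) + \sum_(j < m) n%:R^-1 *: \1_(A j)) w =
      - M + n%:R^-1 * s.
    rewrite -[LHS]/(- M * \1_setT w + (\sum_(j < m) n%:R^-1 *: (\1_(A j) : Omega -> R)) w).
    rewrite indicE in_setT mulr1 fct_sumE mulr_sumr; congr (_ + _); apply: eq_bigr => j _.
    rewrite -[LHS]/(n%:R^-1 * \1_(A j) w) indicE; congr (_ * _%:R); congr nat_of_bool.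
    by apply/idP/idP => [/set_mem//|h]; rewrite mem_set.
  by rewrite mulrBl mulrAC divff ?gt_eqF// mul1r opprD opprK addrA [s / _]mulrC.
rewrite normrM [X in _ * X]ger0_norm ?invr_ge0// ler_piMl ?invr_ge0//.
by rewrite ger0_norm ?subr_ge0// lerBlDl.
Qed.

End density.

Section masses.
Context d (Omega : measurableType d) (R : realType) (P : probability Omega R).
Context (T : \bar R) (T0 : (0 < T)%E).
Variables (p : (Omega -> R) -> \bar R) (Phi : (Omega -> time T0 -> R) -> R).
Hypothesis HPhi : bounded_functional P p Phi.
Implicit Types (y z : Omega -> time T0 -> R) (g : time T0 -> R).

Lemma bounded_functionalN : bounded_functional P p (fun y => - Phi y).
Proof.
split.
- exact: (bf_admissible HPhi).
- by move=> a y z hy hz; rewrite (bf_linear HPhi)// opprD mulrN.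
- have [C C0 hC] := bf_bounded HPhi; exists C => // y hy.
  by rewrite normrN; exact: hC.
Qed.

(** The masses are densities of the positive part of the functional on the
    ramps; the countably many relations between them, which hold almost surely,
    are made to hold everywhere. *)
Lemma positive_part_masses : exists K Kt, [/\ ramp_masses K Kt,
  forall n i, P.-integrable setT (EFin \o K n i) &
  forall n i A, measurable A ->
    (\int[P]_(w in A) (K n i w)%:E)%E = (positive_part Phi (time_ramp n i) A)%:E].
Proof.
have /choice[kap hk] : forall g, exists h : Omega -> R,
    continuous g -> (forall t, 0 <= g t) ->
    [/\ forall w, 0 <= h w, P.-integrable setT (EFin \o h) &
      forall A, measurable A ->
        (\int[P]_(w in A) (h w)%:E)%E = (positive_part Phi g A)%:E].
  move=> g; have [cg|ncg] := pselect (continuous g); last by exists (cst 0).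
  have [g0|ng0] := pselect (forall t, 0 <= g t); last by exists (cst 0).
  by have [h hh] := positive_part_density HPhi cg g0; exists h.
pose k n i := kap (time_ramp n i).
have hkn n i := hk _ (@time_ramp_continuous R T T0 n i) (@time_ramp_ge0 R T T0 n i).
have le n i m j : (forall t : time T0, time_ramp n i t <= time_ramp m j t) ->
    {ae P, forall w, k n i w <= k m j w}.
  move=> rr; have [_ i1 e1] := hkn n i; have [_ i2 e2] := hkn m j.
  apply: ae_le_integrals => // A mA; rewrite e1// e2// lee_fin.
  apply: (positive_part_mono HPhi) => //; first exact: time_ramp_continuous.
  by move=> t; rewrite time_ramp_ge0 rr.
have [G [mG PG hG]] : exists G, [/\ measurable G, P (~` G) = 0%E &
    forall w, G w -> forall n i, k n i w <= k n i.+1 w /\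
      k n.+1 i.*2 w <= k n i w <= k n.+1 i.*2.+1 w].
  apply: ae_measurable; apply: ae_foralln => n; apply: ae_foralln => i.
  have h1 : {ae P, forall w, k n i w <= k n i.+1 w}.
    by apply: le => t; exact: ramp_nondecreasing.
  have h2 : {ae P, forall w, k n.+1 i.*2 w <= k n i w}.
    by apply: le => t; have /andP[] := ramp_refine n i (coord t).
  have h3 : {ae P, forall w, k n i w <= k n.+1 i.*2.+1 w}.
    by apply: le => t; have /andP[] := ramp_refine n i (coord t).
  by apply: filterS3 h1 h2 h3 => w -> -> ->.
pose K n i w := \1_G w * k n i w.
have K1 n i w : G w -> K n i w = k n i w.
  by move=> Gw; rewrite /K indicE mem_set// mul1r.
have K0 n i w : ~ G w -> K n i w = 0.
  by move=> Gw; rewrite /K indicE memNset// mul0r.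
have mk n i : measurable_fun setT (k n i).
  by apply/measurable_EFinP; have [_ /integrableP[]] := hkn n i.
have mK n i : measurable_fun setT (K n i).
  by apply: measurable_funM => //; exact: measurable_indic.
exists K, (K 0%N 1%N); split.
- split => //.
  + by move=> n i w; have [k0 _ _] := hkn n i; apply: mulr_ge0; [rewrite indicE|exact: k0].
  + move=> n i w; have [Gw|nG] := pselect (G w); last by rewrite !K0.
    by rewrite !K1//; have [] := hG w Gw n i.
  + move=> n w; rewrite /K /k; congr (_ * kap _ w); apply/funext => t.
    by rewrite time_ramp_top (time_ramp_top 0).
  + move=> n i w; have [Gw|nG] := pselect (G w); last by rewrite !K0// lexx.
    by rewrite !K1//; have [] := hG w Gw n i.
- move=> n i; have [_ ik _] := hkn n i.
  by apply/Lfun1_integrable; apply: (Loo_mul_L1 (indic_Loo P mG)); exact/Lfun1_integrable.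
- move=> n i A mA; have [_ _ <-//] := hkn n i.
  apply: ae_eq_integral => //.
  + by apply: measurable_funTS; apply/measurable_EFinP; exact: mK.
  + by apply: measurable_funTS; apply/measurable_EFinP; exact: mk.
  exists (~` G); split => //; first exact: measurableC.
  by move=> w /= nh Gw; apply: nh => _; rewrite K1.
Qed.

(** If z lies between 0 and g, then so does g - z, and the values of Phi at 1_A z
    and at 1_A (g - z) add up to the value at 1_A g. *)
Lemma positive_part_le_opp g A : continuous g -> (forall t, 0 <= g t) ->
  measurable A -> positive_part Phi g A <=
  Phi (restrict_process A (fun=> g)) + positive_part (fun y => - Phi y) g A.
Proof.
move=> cg g0 mA; apply: positive_part_le => // z bz.
have hz := LooC_restrict mA (below_LooC P cg bz).
have hg := LooC_restrict mA (LooC_cst P cg).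
pose y : Omega -> time T0 -> R := fun w t => g t - z w t.
have by_ : below g y.
  have [cz zg] := bz; split.
    have -> : y = (-1) *: z + (fun=> g).
      by apply/funext => w; apply/funext => t; rewrite addrC scaleN1r.
    apply: continuous_processD; first exact: continuous_processZ.
    exact: continuous_process_cst.
  move=> w t; have /andP[z0 z1] := zg w t.
  by rewrite subr_ge0 z1/= gerBl.
rewrite -lerBlDl; apply: le_trans (positive_part_ub bounded_functionalN cg g0 mA by_).
rewrite (_ : restrict_process A y =
  (-1) *: restrict_process A z + restrict_process A (fun=> g)).
  by rewrite (bf_linear HPhi)// mulN1r opprD opprK.
apply/funext => w; apply/funext => t.
by rewrite -[RHS]/(-1 * (\1_A w * z w t) + \1_A w * g t) mulN1r addrC -mulrBr.
Qed.

End masses.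

(** The Jordan decomposition of Phi: the inequality of positive_part_le_opp for
    - Phi is the converse of that for Phi. *)
Lemma positive_partB d (Omega : measurableType d) (R : realType)
    (P : probability Omega R) (T : \bar R) (T0 : (0 < T)%E)
    (p : (Omega -> R) -> \bar R) (Phi : (Omega -> time T0 -> R) -> R)
    (g : time T0 -> R) (A : set Omega) :
  bounded_functional P p Phi -> continuous g -> (forall t, 0 <= g t) ->
  measurable A -> Phi (restrict_process A (fun=> g)) =
  positive_part Phi g A - positive_part (fun y => - Phi y) g A.
Proof.
move=> HPhi cg g0 mA; apply/eqP; rewrite eq_le lerBlDr.
rewrite (positive_part_le_opp HPhi)// andbT lerBrDl.
have := positive_part_le_opp (bounded_functionalN HPhi) cg g0 mA.
rewrite (_ : (fun y => - - Phi y) = Phi); last by apply/funext => y; rewrite opprK.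
by rewrite [X in _ <= X -> _]addrC lerBrDr.
Qed.

(** The masses of the hats are nonnegative and add up to Kt w. *)
Lemma ramp_sum_le d (Omega : measurableType d) (R : realType)
    (K : nat -> nat -> Omega -> R) (Kt : Omega -> R) n (x : nat -> R) w (M : R) :
  ramp_masses K Kt -> (forall i, `|x i| <= M) ->
  `|ramp_sum K Kt n x w| <= M * Kt w.
Proof.
move=> HK xM; rewrite /ramp_sum -(rm_total HK n).
elim: (2 ^ n)%N => [|N ih].
  by rewrite big_ord0 subr0 normrM [X in _ * X]ger0_norm ?(rm_ge0 HK)// ler_wpM2r ?(rm_ge0 HK).
rewrite big_ord_recr /=.
set S := \sum_(i < N) _ in ih *.
have -> : x N.+1 * K n N.+1 w - (S + (x N.+1 - x N) * K n N w) =
    (x N * K n N w - S) + x N.+1 * (K n N.+1 w - K n N w) by ring.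
rewrite (le_trans (ler_normD _ _))//.
have -> : M * K n N.+1 w = M * K n N w + M * (K n N.+1 w - K n N w) by ring.
have d0 : 0 <= K n N.+1 w - K n N w by rewrite subr_ge0; exact: (rm_mono HK).
by rewrite lerD// normrM [X in _ * X]ger0_norm// ler_wpM2r.
Qed.

Section random_measure.
Context d (Omega : measurableType d) (R : realType) (P : probability Omega R).
Context (T : \bar R) (T0 : (0 < T)%E).
Variables (K : nat -> nat -> Omega -> R) (Kt : Omega -> R).
Hypothesis HK : ramp_masses K Kt.

Definition quantile_charge :
    Omega -> {charge set (time T0) -> \bar R} :=
  fun w => charge_of_finite_measure (quantile_measure HK w).

Lemma quantile_charge_integral y w : continuous_process y ->
  ramp_sum K Kt n (sample n (y w)) w @[n --> \oo] -->
  path_integral y quantile_charge w.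
Proof.
move=> [cy _]; rewrite /path_integral charge_integral_measure; last exact: cy.
exact: quantile_measure_integral.
Qed.

Lemma variation_quantile_charge w :
  variation_process quantile_charge w <= Kt w.
Proof.
apply/ler_addgt0Pl => e e0.
have [g [cg g1]] := total_variation_approx (quantile_charge w) e0.
rewrite lerBlDl => /le_trans; apply; rewrite lerD2l charge_integral_measure//.
have -> : Kt w = \int[quantile_measure HK w]_(t in [set: time T0]) 1.
  by rewrite Rintegral_cst// mul1r (congr1 fine (@quantile_measureT _ _ _ _ T0 _ _ HK w)).
apply: le_Rintegral => //; first exact: continuous_integrable.
  exact: finite_measure_integrable_cst.
by move=> t _; rewrite (le_trans (ler_norm _)).
Qed.

Lemma L1M_quantile_charge : P.-integrable setT (EFin \o Kt) ->
  L1M P quantile_charge.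
Proof.
move=> iK.
have m : measurable_charge quantile_charge.
  by move=> A mA; exact: (measurable_quantile_measure HK mA).
split => //; apply: (@Lfun_dominated _ _ _ P 1%E _ Kt) => //.
- exact: measurable_variation.
- exact/Lfun1_integrable.
- move=> w; rewrite ger0_norm ?variation_process_ge0//.
  by rewrite (le_trans (variation_quantile_charge w))// ler_norm.
Qed.

End random_measure.

Section representation.
Context d (Omega : measurableType d) (R : realType) (P : probability Omega R).
Context (T : \bar R) (T0 : (0 < T)%E).
Variables (p : (Omega -> R) -> \bar R) (Phi : (Omega -> time T0 -> R) -> R).
Hypothesis HPhi : bounded_functional P p Phi.
Implicit Types (y z : Omega -> time T0 -> R) (g : time T0 -> R) (xi : Omega -> R).

Let ap : admissible P p := bf_admissible HPhi.

Lemma bf_sum I (s : seq I) (z : I -> Omega -> time T0 -> R) :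
  (forall i, LooC P (z i)) ->
  LooC P (\sum_(i <- s) z i) /\ Phi (\sum_(i <- s) z i) = \sum_(i <- s) Phi (z i).
Proof.
move=> hz; elim: s => [|i s [ih1 ih2]].
  by rewrite !big_nil (bf0 HPhi); split => //; exact: LooC0.
rewrite !big_cons -ih2 -(bfD HPhi)//; split => //.
by rewrite -[z i]scale1r; exact: LooC_lin.
Qed.

Lemma LooC_product xi g : xi \in Lfun P +oo%E -> continuous g ->
  LooC P (fun w t => xi w * g t).
Proof.
move=> hxi cg; apply: (LooC_mul hxi (LooC_cst P cg)).
by exists (path_norm g).
Qed.

(** For fixed g, the value at xi g is continuous in xi for the essential supremum
    norm. *)
Lemma product_density g k : continuous g -> P.-integrable setT (EFin \o k) ->
  (forall A, measurable A ->
    (\int[P]_(w in A) (k w)%:E)%E = (Phi (restrict_process A (fun=> g)))%:E) ->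
  forall xi, xi \in Lfun P +oo%E ->
  Phi (fun w t => xi w * g t) = \int[P]_w (xi w * k w).
Proof.
move=> cg ik hk xi hxi.
apply: (functional_density (L := fun x => Phi (fun w t => x w * g t))) => //.
  move=> a x y hx hy; rewrite -(bf_linear HPhi); try exact: LooC_product.
  congr Phi; apply/funext => w; apply/funext => t.
  rewrite -[(a *: x + y) w]/(a * x w + y w) mulrDl -mulrA.
  by [].
have [C C0 hC] := bf_bounded HPhi.
exists (C * (path_norm g * fine (p \1_setT))).
  rewrite mulr_ge0// mulr_ge0 ?path_norm_ge0//.
  by apply: (fine_admissible_ge0 HPhi); exact: indic_Loo.
move=> x M hx M0 xM; have hxg := LooC_product hx cg.
apply: (le_trans (hC _ hxg)); rewrite -mulrA ler_wpM2l//.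
have h1 : (\1_setT : Omega -> R) \in Lfun P +oo%E by exact: indic_Loo.
have gM : path_norm g * fine (p \1_setT) * M = fine (p ((path_norm g * M) *: \1_setT)).
  rewrite (admissibleZ _ ap) ?fineM ?(fin_num_admissible ap)//; last exact: Loo_sub_L1.
  by rewrite ger0_norm ?mulr_ge0 ?path_norm_ge0// mulrAC.
rewrite gM; apply: (fine_admissible_mono HPhi).
- by case: hxg.
- by apply: LfunZ => //; rewrite leey.
apply: filterS xM => w xM.
rewrite ger0_norm ?norm_process_ge0//; last by case: hxg.
rewrite norm_processM; last exact: continuous_process_cst.
rewrite -[((path_norm g * M) *: \1_setT) w]/(path_norm g * M * \1_setT w).
rewrite indicE in_setT mulr1 [leRHS]ger0_norm ?mulr_ge0 ?path_norm_ge0//.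
by rewrite mulrC ler_wpM2l// path_norm_ge0.
Qed.

Lemma LooC_sample n i y : LooC P y ->
  (fun w => sample n (y w) i) \in Lfun P +oo%E.
Proof.
move=> [cy hy]; apply: Lfun_dominated hy _; rewrite ?leey//.
  exact: measurable_section.
move=> w; rewrite [leRHS]ger0_norm ?norm_process_ge0//.
by apply: path_norm_ub; have [+ _] := cy; exact.
Qed.

Definition interp_process n y : Omega -> time T0 -> R :=
  fun w t => interp n (sample n (y w)) (coord t).

Lemma LooC_interp n y : LooC P y -> LooC P (interp_process n y).
Proof.
move=> hy; have [cy yoo] := hy.
have c : continuous_process (interp_process n y).
  apply: (@continuous_process_interp _ _ _ _ T0 n (fun i w => sample n (y w) i)).
  by move=> i; exact: measurable_section.
split => //; apply: Lfun_dominated yoo _; rewrite ?leey//.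
  exact: measurable_norm_process.
move=> w; rewrite !ger0_norm ?norm_process_ge0//; apply: path_norm_le => t.
apply: interp_bound => [|i _]; first by have /andP[] := coord_itv t.
by apply: path_norm_ub; have [+ _] := cy; exact.
Qed.

(** For each outcome the interpolations converge uniformly in time, and their
    error is at most twice the norm of the path. *)
Lemma bf_interp_cvg y : LooC P y ->
  Phi (interp_process n y) @[n --> \oo] --> Phi y.
Proof.
move=> hy; have [cy yoo] := hy.
have hd n : LooC P (interp_process n y - y).
  by rewrite addrC -scaleN1r; apply: LooC_lin => //; exact: LooC_interp.
have [C C0 hC] := bf_bounded HPhi.
pose dist n := norm_process (interp_process n y - y).
have /(_ (2 *: norm_process y)) := @admissible_dominated_cvg _ _ _ _ _ ap dist.
have hle n w : 0 <= dist n w <= (2 *: norm_process y) w.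
  have [cd _] := hd n; rewrite norm_process_ge0//=.
  rewrite -[leRHS]/(2 * norm_process y w); apply: path_norm_le => t.
  rewrite mulr_natl mulr2n (le_trans (ler_normB _ _))// lerD//.
    apply: interp_bound => [|i _]; first by have /andP[] := coord_itv t.
    by apply: path_norm_ub; have [+ _] := cy; exact.
  by apply: path_norm_ub; have [+ _] := cy; exact.
have dcvg w : dist n w @[n --> \oo] --> 0.
  apply/cvgrPdist_le => e e0.
  have [cyw _] := cy; have := interp_cvg (cyw w) e0.
  apply: filterS => n hn; rewrite sub0r normrN ger0_norm; last by have /andP[] := hle n w.
  by apply: path_norm_le => t; exact: hn.
have pd : fine (p (dist n)) @[n --> \oo] --> 0.
  apply: (admissible_dominated_cvg ap _ _ hle dcvg).
    by apply: LfunZ; rewrite ?leey.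
  by move=> n; apply: measurable_norm_process; case: (hd n).
move=> _; apply/cvgrPdist_le => e e0.
have Cp : C * fine (p (dist n)) @[n --> \oo] --> 0.
  by rewrite -(mulr0 C); exact: cvgMl_tmp.
move/cvgrPdist_le : Cp => /(_ _ e0); apply: filterS => n.
rewrite sub0r normrN => h; rewrite distrC.
have -> : Phi (interp_process n y) - Phi y = Phi (interp_process n y - y).
  rewrite addrC -mulN1r -(bf_linear HPhi)//; last exact: LooC_interp.
  by rewrite scaleN1r addrC.
by apply: (le_trans (hC _ (hd n))); rewrite (le_trans (ler_norm _)).
Qed.

(** The representing random measure is the difference of those which are built
    from the masses of the positive and of the negative part. An interpolation of
    y is a finite combination of products of bounded variables with ramps, so
    that the value of Phi there is the expected difference of the two ramp sums.
    Refining the grid, these expectations converge to the pairing by dominated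
    convergence, and the values of Phi to Phi y. *)
Lemma bounded_functional_representation : exists u : Omega -> {charge set (time T0) -> \bar R},
  L1M P u /\ forall y, LooC P y -> pairing P y u = (Phi y)%:E.
Proof.
have [Kp [Ktp [HKp iKp eKp]]] := positive_part_masses HPhi.
have [Km [Ktm [HKm iKm eKm]]] := positive_part_masses (bounded_functionalN HPhi).
have total K Kt : ramp_masses K Kt -> (forall n i, P.-integrable setT (EFin \o K n i)) ->
    P.-integrable setT (EFin \o Kt).
  move=> HK iK; rewrite (_ : Kt = K 0%N (2 ^ 0)%N); first exact: iK.
  by apply/funext => w; rewrite (rm_total HK).
have iKtp := total _ _ HKp iKp; have iKtm := total _ _ HKm iKm.
pose up : Omega -> {charge set (time T0) -> \bar R} := quantile_charge T0 HKp.
pose um : Omega -> {charge set (time T0) -> \bar R} := quantile_charge T0 HKm.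
have [mup vup] : L1M P up by exact: L1M_quantile_charge.
have [mum vum] : L1M P um by exact: L1M_quantile_charge.
exists (lin_comb (-1) um up).
have mu := measurable_charge_lin_comb (-1) mum mup.
split.
  split => //; apply: (@Lfun_dominated _ _ _ P 1%E _
      (variation_process um + variation_process up)) => //.
  - exact: measurable_variation.
  - exact: LfunD.
  move=> w; rewrite ger0_norm ?variation_process_ge0//.
  apply: (le_trans (variation_lin_comb _ _ _ _)); rewrite normrN1 mul1r.
  exact: ler_norm.
move=> y hy; have [cy yoo] := hy.
pose k n i w := Kp n i w - Km n i w.
have ik n i : P.-integrable setT (EFin \o k n i).
  apply/Lfun1_integrable; have /Lfun1_integrable hp := iKp n i; have /Lfun1_integrable hm := iKm n i.
  rewrite (_ : k n i = (-1) *: Km n i + Kp n i).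
    by apply: LfunD => //; exact: LfunZ.
  by apply/funext => w; rewrite addrC scaleN1r.
have dens n i xi : xi \in Lfun P +oo%E ->
    Phi (fun w t => xi w * time_ramp n i t) = \int[P]_w (xi w * k n i w).
  move=> hxi; apply: product_density => //; first exact: time_ramp_continuous.
  move=> A mA; rewrite (positive_partB HPhi)//; first last.
  - exact: time_ramp_ge0.
  - exact: time_ramp_continuous.
  rewrite EFinB -eKp// -eKm// -integralB_EFin//.
  + exact: integrableS (iKp n i).
  + exact: integrableS (iKm n i).
pose Z n w := ramp_sum Kp Ktp n (sample n (y w)) w - ramp_sum Km Ktm n (sample n (y w)) w.
have ZE n : \int[P]_w Z n w = Phi (interp_process n y).
  pose a w := sample n (y w) (2 ^ n)%N.
  pose b i w := sample n (y w) i.+1 - sample n (y w) i.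
  have ha : a \in Lfun P +oo%E by exact: LooC_sample.
  have hb i : b i \in Lfun P +oo%E.
    rewrite (_ : b i = (-1) *: (fun w => sample n (y w) i) + (fun w => sample n (y w) i.+1)).
      by apply: LfunD; rewrite ?leey//; [apply: LfunZ; rewrite ?leey//|]; exact: LooC_sample.
    by apply/funext => w; rewrite addrC scaleN1r.
  have hB i : LooC P (fun w (t : time T0) => b i w * time_ramp n i t).
    by apply: LooC_product => //; exact: time_ramp_continuous.
  have hA : LooC P (fun w (t : time T0) => a w * time_ramp n (2 ^ n) t).
    by apply: LooC_product => //; exact: time_ramp_continuous.
  have [hS PhiS] := bf_sum (index_enum 'I_(2 ^ n)) (fun i => hB (val i)).
  have -> : interp_process n y = (-1) *: (\sum_(i < 2 ^ n)
      (fun w (t : time T0) => b i w * time_ramp n i t)) +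
      (fun w (t : time T0) => a w * time_ramp n (2 ^ n) t).
    apply/funext => w; apply/funext => t.
    rewrite /interp_process interp_by_parts; last by have /andP[] := coord_itv t.
    rewrite addrC scaleN1r -[RHS]/(- (\sum_(i < 2 ^ n)
      (fun w (t : time T0) => b i w * time_ramp n i t)) w t + a w * time_ramp n (2 ^ n) t).
    by rewrite !fct_sumE.
  rewrite (bf_linear HPhi)// mulN1r PhiS dens//.
  under [in RHS]eq_bigr do rewrite dens//.
  have iak : P.-integrable setT (EFin \o (a \* k n (2 ^ n)%N)).
    by apply/Lfun1_integrable; apply: Loo_mul_L1 => //; exact/Lfun1_integrable.
  have ibk i : P.-integrable setT (EFin \o (b i \* k n i)).
    by apply/Lfun1_integrable; apply: Loo_mul_L1 => //; exact/Lfun1_integrable.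
  have [iS intS] := Rintegral_sum (index_enum 'I_(2 ^ n)) (fun i => ibk (val i)).
  rewrite -intS addrC -RintegralB//; apply: eq_Rintegral => w _.
  rewrite /Z /ramp_sum -(rm_total HKp n) -(rm_total HKm n) /k /a.
  set s1 := \sum_(i < _) _; set s2 := \sum_(i < _) _; set s3 := \sum_(i < _) _.
  have -> : s3 = s1 - s2.
    rewrite /s1 /s2 /s3 -sumrB; apply: eq_bigr => i _.
    by rewrite /= mulrBr.
  ring.
have Zcvg w : Z n w @[n --> \oo] --> path_integral y (lin_comb (-1) um up) w.
  rewrite path_integral_lin// mulN1r addrC.
  by apply: cvgB; exact: quantile_charge_integral.
have mZ n : measurable_fun setT (Z n).
  have mK K Kt : ramp_masses K Kt -> measurable_fun setT
      (fun w => ramp_sum K Kt n (sample n (y w)) w).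
    move=> HK; have ms i : measurable_fun setT (fun w => sample n (y w) i).
      exact: measurable_section.
    apply: measurable_funB.
      apply: measurable_funM => //.
      rewrite (_ : Kt = K 0%N (2 ^ 0)%N); first exact: (rm_measurable HK).
      by apply/funext => w; rewrite (rm_total HK).
    apply: measurable_sum => i; apply: measurable_funM; last exact: (rm_measurable HK).
    exact: measurable_funB.
  by apply: measurable_funB; exact: mK.
pose B w := norm_process y w * (Ktp w + Ktm w).
have iB : P.-integrable setT (EFin \o B).
  apply/Lfun1_integrable; apply: Loo_mul_L1 => //.
  by apply: LfunD => //; exact/Lfun1_integrable.
have ZB n w : `|Z n w| <= B w.
  have sy i : `|sample n (y w) i| <= norm_process y w.
    by apply: path_norm_ub; have [+ _] := cy; exact.
  rewrite /B mulrDr (le_trans (ler_normB _ _))// lerD//; exact: ramp_sum_le.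
have [iI IZ] : P.-integrable setT (EFin \o path_integral y (lin_comb (-1) um up)) /\
    \int[P]_w Z n w @[n --> \oo] --> \int[P]_w path_integral y (lin_comb (-1) um up) w.
  apply: (Rintegral_dominated_cvg mZ iB).
  - by apply: nearW.
  - exact: measurable_path_integral.
  - by move=> n; apply: nearW.
rewrite /pairing expectationE -[LHS]fineK; last exact: integrable_fin_num.
congr EFin; apply: (cvg_seq_unique IZ).
by rewrite (_ : (fun n => _) = (fun n => Phi (interp_process n y)));
  [exact: bf_interp_cvg|exact/funext].
Qed.

End representation.

(** * Continuous functionals on Y(C) *)

Section surjectivity.
Context d (Omega : measurableType d) (R : realType) (P : probability Omega R).
Context (T : \bar R) (T0 : (0 < T)%E) (pp : seminorm_seq P).
Implicit Types (x y : YCpre T0 pp).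

Let ap n : admissible P (pp n) := sseq_admissible pp n.

Lemma YCseminorm_le i n (z : YC T0 pp) : (i <= n)%N ->
  YCseminorm i z <= YCseminorm n z.
Proof.
move=> i_n; have [x ->] := YCclassK z; rewrite !YCseminorm_class.
have [[_ x1] [[_ dx] _]] := YCpreP x.
by rewrite fine_le ?sseq_le// ge0_fin_numE ?(admissible_ge0 (ap _)).
Qed.

(** The seminorms increase along the sequence, so that a basic neighbourhood of 0
    is a ball of a single one of them. *)
Lemma continuous_functional_bound (f : {linear YC T0 pp -> R^o}) : continuous f ->
  exists n (C : R), 0 <= C /\ forall z, `|f z| <= C * YCseminorm n z.
Proof.
move=> cf; have := cf 0 _ (nbhsx_ballx (f 0) 1 ltr01).
move=> [[n e]/= e0 sA]; exists n, e^-1; split; first by rewrite invr_ge0 ltW.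
move=> z; apply/ler_addgt0Pl => r r0.
set q := YCseminorm n z.
have [_ qZ] := YCseminormP T0 pp n.
have q0 : 0 <= q.
  have [x zx] := YCclassK z; rewrite /q zx YCseminorm_class fine_ge0//.
  by apply: (admissible_ge0 (ap n)); have [[_ ?] _] := YCpreP x.
have qd : 0 < q + r * e by rewrite ltr_wpDl// mulr_gt0.
pose a := e / (q + r * e).
have a0 : 0 < a by rewrite divr_gt0.
have /sA : seminorm_ball (@YCseminorm _ _ _ P _ T0 pp) 0 n e (a *: z).
  move=> i i_n; rewrite subr0 (le_lt_trans (YCseminorm_le _ i_n))// qZ gtr0_norm//.
  by rewrite /a mulrAC ltr_pdivrMr// ltr_pM2l// ltrDl mulr_gt0.
rewrite /ball/= linear0 sub0r normrN linearZ /= normrM (gtr0_norm a0).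
rewrite mulrC -ltr_pdivlMr// div1r => /ltW; move=> /le_trans; apply.
by rewrite invf_div mulrDl mulfK ?gt_eqF// addrC [q / e]mulrC.
Qed.

Section restriction.
Variable f : {linear YC T0 pp -> R^o}.

Definition restrict_functional (y : Omega -> time T0 -> R) : R :=
  if pselect (LooC P y) is left h then f (YCclass (YCmk (LooC_YCfun pp h))) else 0.

Lemma restrict_functionalE x : LooC P (val x) ->
  restrict_functional (val x) = f (YCclass x).
Proof.
move=> hx; rewrite /restrict_functional; case: pselect => // h.
by congr (f (YCclass _)); exact: val_inj.
Qed.

Lemma restrict_functional_bounded n (C : R) : 0 <= C ->
  (forall z, `|f z| <= C * YCseminorm n z) ->
  bounded_functional P (pp n) restrict_functional.
Proof.
move=> C0 hC; split.
- exact: ap.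
- move=> a y z hy hz.
  pose my := YCmk (LooC_YCfun pp hy); pose mz := YCmk (LooC_YCfun pp hz).
  have vE : val (a *: my + mz) = a *: y + z by rewrite linearP.
  have h : LooC P (val (a *: my + mz)) by rewrite vE; exact: LooC_lin.
  rewrite -vE restrict_functionalE// -YCclassP linearP.
  by rewrite -(restrict_functionalE (x := my))// -(restrict_functionalE (x := mz)).
- exists C => // y hy; pose my := YCmk (LooC_YCfun pp hy).
  rewrite -[y]/(val my) restrict_functionalE// -YCseminorm_class.
  exact: hC.
Qed.

End restriction.

(** Truncation of the paths at the level M: if a variable eta with values in
    [- M, M] approximates the norm process, then the truncation moves the paths by
    at most the distance of eta to their norm. *)
Lemma LooC_dense n x (e : R) : 0 < e -> exists2 y, LooC P (val y) &
  fine (pp n (norm_process (val (-1 *: y + x)))) < e.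
Proof.
move=> e0; have [[cx x1] [[_ dx] hx]] := YCpreP x.
have [eta hoo heta] := hx n e e0.
have [M0 M00 etaM0] := Lfun_bounded hoo.
pose M := M0 + 1; have M_gt0 : 0 < M by rewrite ltr_wpDl.
pose N := norm_process (val x).
have mN : measurable_fun setT N by exact: measurable_norm_process.
have N0 w : 0 <= N w by exact: norm_process_ge0.
pose th w := M / Num.max (N w) M.
have max0 w : 0 < Num.max (N w) M by rewrite lt_max M_gt0 orbT.
have mth : measurable_fun setT th.
  have cm : continuous (fun r : R => (Num.max r M)^-1).
    move=> r; apply: (@continuousV _ _ (fun r : R => Num.max r M)).
      by rewrite gt_eqF// lt_max M_gt0 orbT.
    apply: (@continuous_max R R id (cst M)); first exact: cvg_id.
    exact: cst_continuous.
  apply: measurable_funM => //.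
  exact: (measurableT_comp (continuous_measurable_fun cm) mN).
have th0 w : 0 <= th w by rewrite divr_ge0// ltW.
have th1 w : th w <= 1 by rewrite ler_pdivrMr// mul1r le_max lexx orbT.
have ch := continuous_processM mth cx.
have hh : LooC P (fun w t => th w * val x w t).
  split => //; apply: (@bounded_Lfun _ _ _ P _ M).
    exact: measurable_norm_process.
  move=> w; rewrite ger0_norm ?norm_process_ge0// norm_processM// ger0_norm//.
  by rewrite /th mulrAC ler_pdivrMr// ler_pM2l// le_max lexx.
pose y := YCmk (LooC_YCfun pp hh); exists y => //.
have vE : val (-1 *: y + x) = (fun w t => (1 - th w) * val x w t).
  rewrite linearP; apply/funext => w; apply/funext => t.
  by rewrite -[LHS]/(-1 * (th w * val x w t) + val x w t); ring.
have [[_ z1] [[_ dz] _]] := YCpreP (-1 *: y + x).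
have LB : N - eta \in Lfun P 1.
  rewrite addrC -scaleN1r; apply: LfunD => //; apply: LfunZ => //.
  exact: Loo_sub_L1.
have ltp := heta n (leqnn n).
have fz : pp n (norm_process (val (-1 *: y + x))) \is a fin_num.
  by rewrite ge0_fin_numE// (admissible_ge0 (ap n)).
have : (pp n (norm_process (val (-1 *: y + x)%R)) < e%:E)%E.
  apply: le_lt_trans ltp; apply: (admissible_mono (ap n)) => //.
  apply: filterS etaM0 => w etaM; rewrite vE norm_processM// normrM normr_id.
  rewrite [X in _ * X]ger0_norm ?N0// ger0_norm ?subr_ge0//.
  rewrite -[(N - eta) w]/(N w - eta w) mulrBl mul1r.
  have [NM|MN] := leP (N w) M.
    by rewrite /th max_r// divff ?gt_eqF// mul1r subrr.
  rewrite /th (max_l (ltW MN)) mulfVK; last by rewrite gt_eqF// (lt_trans M_gt0).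
  apply: le_trans (ler_norm _); rewrite lerB//.
  by rewrite (le_trans (ler_norm _))// (le_trans etaM)// /M lerDl.
by rewrite -[pp n _]fineK// lte_fin.
Qed.

(** On bounded processes the functional is represented by some u, whose polar is
    at most C by polar_variationE. Hence f and the pairing with u are both
    continuous for the n-th seminorm and agree on a dense subspace. *)
Lemma UM_surjective (f : {linear YC T0 pp -> R^o}) : continuous f ->
  exists2 u, UM pp u &
    forall x, ((f (YCclass x))%:E = pairing P (val x) u)%E.
Proof.
move=> cf; have [n [C [C0 hC]]] := continuous_functional_bound cf.
have HPhi := restrict_functional_bounded C0 hC.
have [u [hu uE]] := bounded_functional_representation HPhi.
have polC : (polar P (pp n) (variation_process u) <= C%:E)%E.
  rewrite polar_variationE//; apply: ge_ereal_sup => _ [y [hy y1] <-].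
  rewrite uE// lee_fin (le_trans (ler_norm _))//.
  pose my := YCmk (LooC_YCfun pp hy).
  rewrite -[y]/(val my) restrict_functionalE// (le_trans (hC _))//.
  rewrite YCseminorm_class ler_piMr//= -lee_fin fineK//.
  by apply: (fin_num_admissible (ap n)); have [] := hy.
have UMu : UM pp u.
  split => //; split; first by case: hu.
  by exists n; rewrite (le_lt_trans polC)// ltry.
exists u => // x; rewrite -[RHS]fineK ?pairing_fin_num//; congr EFin.
set B := fine (polar P (pp n) (variation_process u)).
have B0 : 0 <= B by rewrite fine_ge0// polar_ge0.
apply/eqP; rewrite -subr_eq0 -normr_eq0 eq_le normr_ge0 andbT.
apply/ler_addgt0Pl => r r0; rewrite addr0.
have [y hy xy] := LooC_dense n x (divr_gt0 r0 (ltr_wpDl (addr_ge0 C0 B0) ltr01)).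
have pl := pairing_linl (-1) y x UMu.
have fl : f (YCclass (-1 *: y + x)) = - f (YCclass y) + f (YCclass x).
  by rewrite -YCclassP linearP scaleN1r.
have {}pl : fine (pairing P (val (-1 *: y + x)) u) =
    - f (YCclass y) + fine (pairing P (val x) u).
  rewrite pl fineD ?fin_numM ?pairing_fin_num// fineM ?pairing_fin_num//= mulN1r.
  by rewrite uE// restrict_functionalE.
have -> : f (YCclass x) - fine (pairing P (val x) u) =
    f (YCclass (-1 *: y + x)) - fine (pairing P (val (-1 *: y + x)) u).
  by rewrite fl pl opprD addrACA subrr add0r.
rewrite (le_trans (ler_normB _ _))//.
set q := fine (pp n _) in xy.
have q0 : 0 <= q.
  by rewrite fine_ge0//; apply: (admissible_ge0 (ap n)); have [[]] := YCpreP (-1 *: y + x).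
have h1 : `|f (YCclass (-1 *: y + x))| <= C * q.
  by rewrite (le_trans (hC _))// YCseminorm_class.
have h2 : `|fine (pairing P (val (-1 *: y + x)) u)| <= q * B.
  by apply: pairing_seminorm_le => //; rewrite (le_lt_trans polC)// ltry.
rewrite (le_trans (lerD h1 h2))// [q * B]mulrC -mulrDl.
move: xy; rewrite ltr_pdivlMr ?(ltr_wpDl (addr_ge0 C0 B0) ltr01)// => /ltW.
by apply: le_trans; rewrite mulrC ler_wpM2l// lerDl.
Qed.

End surjectivity.

Unset Implicit Arguments.

Theorem corollary19 (R : realType) (d : measure_display)
    (Omega : measurableType d) (P : probability Omega R)
    (Pcomplete : measure_is_complete P)
    (T : \bar R) (T0 : (0 < T)%E) (pp : seminorm_seq P) :
  frechet (YC T0 pp)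
  /\
  [/\ forall u, UM pp u ->
        exists f : {linear YC T0 pp -> R^o}, continuous f /\
          forall y : YCpre T0 pp, ((f (YCclass y))%:E = pairing P (val y) u)%E,
      forall f : {linear YC T0 pp -> R^o}, continuous f ->
        exists2 u, UM pp u &
          forall y : YCpre T0 pp, ((f (YCclass y))%:E = pairing P (val y) u)%E,
      forall u v, UM pp u -> UM pp v ->
        ((forall y : YCpre T0 pp, pairing P (val y) u = pairing P (val y) v) <->
         ae_eq_measure P u v) &
      forall (a : R) u v, UM pp u -> UM pp v ->
        UM pp (lin_comb a u v) /\
        forall y : YCpre T0 pp,
          pairing P (val y) (lin_comb a u v) =
          (a%:E * pairing P (val y) u + pairing P (val y) v)%E]
  /\
  [/\ forall n y (u : Omega -> {charge set (time T0) -> \bar R}),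
        L1C P y -> L1M P u ->
        (pairing P y u <=
           pp n (norm_process y) * polar P (pp n) (variation_process u))%E /\
        ((pp n (norm_process y) * polar P (pp n) (variation_process u) < +oo)%E ->
         path_integral y u \in Lfun P 1),
      forall n (u : Omega -> {charge set (time T0) -> \bar R}), L1M P u ->
        polar P (pp n) (variation_process u) =
        ereal_sup [set pairing P y u | y in
          [set y | LooC P y /\ (pp n (norm_process y) <= 1)%E]] &
      forall n u, UM pp u ->
        polar P (pp n) (variation_process u) =
        ereal_sup [set pairing P (val y) u | y in
          [set y : YCpre T0 pp | (pp n (norm_process (val y)) <= 1)%E]]].
Proof.
split; first exact: YC_frechet.
split; split.
- by move=> u hu; exact: UM_functional.
- by move=> f cf; exact: UM_surjective.
- move=> u v hu hv; split; first exact: pairing_injective.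
  by move=> uv y; exact: ae_eq_pairing.
- move=> a u v hu hv; split; first exact: UM_lin_comb.
  by move=> y; exact: pairing_lin_comb.
- move=> n y u hy hu; split; first exact: (pairing_le (sseq_admissible pp n)).
  exact: (pairing_integrable (sseq_admissible pp n)).
- by move=> n u hu; exact: polar_variationE.
- by move=> n u [hu _]; exact: polar_variation_YCE.
Qed.
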